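(* Let $1\le r<\infty$, let $(p_j)_{j\ge1}\subset[1,\infty)$, and let $(d_j)_{j\ge1}\subset\mathbb N$. Let $X$ be either of the spaces $$c_0\left(\bigoplus_{j=1}^\infty\ell_{p_j}^{d_j}\right)\qquad\text{or}\qquad \ell_r\left(\bigoplus_{j=1}^\infty\ell_{p_j}^{d_j}\right).$$ Then the monomials associated with the canonical basis of $X$ (the canonical unit vectors of the blocks $\ell_{p_j}^{d_j}$, viewed in the corresponding coordinate blocks of $X$), with the square order in each homogeneous degree and with any compatible global ordering, form a Schauder basis of $(\mathcal H(X),\tau_0)$. More generally, the same conclusion holds for every $E$-sum $X=\left(\bigoplus_{j=1}^\infty X_j\right)_E$, with the basis $(e_{j,k})_{j,k}$ of coordinate-block vectors, where $E$ is a complex Banach space of scalar sequences in which $c_{00}$ is contained and dense and such that $x\in E$ and $|y_j|\le|x_j|$ for all $j$ imply $y\in E$ and $\|y\|_E\le\|x\|_E$, and each $X_j$ is a complex Banach space with a $1$-unconditional Schauder basis $(e_{j,k})_{k\ge1}$.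
   Context: For a Banach sequence space $E$, $E\left(\bigoplus_jX_j\right)=\left(\bigoplus_jX_j\right)_E=\{(x_j):x_j\in X_j,\ (\|x_j\|_{X_j})_j\in E\}$ with norm $\|(x_j)\|=\|(\|x_j\|_{X_j})_j\|_E$. $\ell_p^d$ is $\mathbb C^d$ with the $\ell_p$ norm, and $c_{00}$ is the space of finitely supported scalar sequences. The canonical vectors of these sums are enumerated as a single sequence (any enumeration of the index set of pairs (block, position in block) may be used). A Schauder basis $(e_j)$ of a Banach space $X$ is $1$-unconditional if $\|\sum_j\lambda_jx_je_j\|\le\|\sum_jx_je_j\|$ whenever $\sum_j x_je_j\in X$ and $|\lambda_j|\le1$ for all $j$. $\mathcal H(X)$ is the space of entire holomorphic functions $X\to\mathbb C$, and $\tau_0$ is the compact-open topology, generated by the seminorms $\|f\|_K=\sup_{x\in K}|f(x)|$, $K\subset X$ compact. A Schauder basis of a locally convex space is understood in the usual sense (unique convergent expansions with continuous coefficient functionals). For a Schauder basis $(e_j)$ with coefficient functionals $(e_j^* )$, the associated monomials are $e^{*\alpha}(x)=\prod_je_j^*(x)^{\alpha_j}$, where $\alpha=(\alpha_j)_{j\ge1}$ ranges over finitely supported multi-indices with entries in $\mathbb N_0$; $|\alpha|=\sum_j\alpha_j$ is the degree and $\operatorname{len}(\alpha)=\max\operatorname{supp}(\alpha)$, $\operatorname{len}(0)=0$. Square order: for multi-indices of the same degree, $\alpha\prec\beta$ if either $\operatorname{len}(\alpha)<\operatorname{len}(\beta)$, or $\operatorname{len}(\alpha)=\operatorname{len}(\beta)$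 and $\alpha_j<\beta_j$ for $j=\max\{i:\alpha_i\ne\beta_i\}$. An ordering (enumeration as a sequence) of all monomials is compatible if, for every $n\in\mathbb N_0$, its restriction to the degree-$n$ monomials agrees with the square order. *)

(* Defs.v *)
From HB Require Import structures.
From mathcomp Require Import all_boot all_order all_algebra finmap.
From mathcomp Require Import complex.
From mathcomp Require Import all_classical all_reals all_analysis.

Set Implicit Arguments.
Unset Strict Implicit.
Unset Printing Implicit Defensive.

Import Order.TTheory GRing.Theory Num.Theory.
Import numFieldNormedType.Exports.
Import Normc.

Local Open Scope classical_set_scope.
Local Open Scope complex_scope.
Local Open Scope ring_scope.

(* A basis may be finite or infinite: its length is [Some d] or [None]
   (for infinity), and its vectors are indexed by the [k] with [below N k];
   the values of [e : nat -> V] at other indices are ignored. *)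
Definition below (N : option nat) (k : nat) : bool :=
  if N is Some d then (k < d)%N else true.

Section SchauderBasis.
Context {K : numFieldType}.

Definition expansion (V : preTopologicalLmodType K) (N : option nat)
    (e : nat -> V) (a : nat -> K^o) (x : V) : Prop :=
  (fun n : nat => \sum_(k < n | below N k) a k *: e k) @ \oo --> x.

Definition schauder_basis (V : preTopologicalLmodType K) (N : option nat)
    (e : nat -> V) : Prop :=
  exists f : nat -> V -> K^o,
    (forall k, below N k -> continuous (f k)) /\
    forall x, expansion N e (fun k => f k x) x /\
      forall a, expansion N e a x -> forall k, below N k -> a k = f k x.

Definition one_unconditional (V : normedModType K) (N : option nat)
    (e : nat -> V) : Prop :=
  forall (a l : nat -> K^o) (x : V), expansion N e a x ->
    (forall k, `|l k| <= 1) ->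
    exists2 y : V, expansion N e (fun k => l k * a k) y & `|y| <= `|x|.

(* The k-th coefficient functional of [e]; meaningful when [e] is an
   (infinite) Schauder basis, so that the expansion exists and is unique. *)
Definition coef_functional (V : preTopologicalLmodType K) (e : nat -> V)
    (k : nat) (x : V) : K^o :=
  xget (fun=> 0) [set a : nat -> K^o | expansion None e a x] k.

End SchauderBasis.

Definition multiindex := {fsfun nat -> nat with 0%N}.

Definition degree (alpha : multiindex) : nat :=
  (\sum_(j <- finsupp alpha) alpha j)%N.

(* Positions are counted from 0 here, hence the [j.+1]; [len 0 = 0]. *)
Definition len (alpha : multiindex) : nat :=
  (\max_(j <- finsupp alpha) j.+1)%N.

(* The index [j] below is the largest one at which alpha and beta differ. *)
Definition square_lt (alpha beta : multiindex) : Prop :=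
  (len alpha < len beta)%N \/
  len alpha = len beta /\
    exists j : nat, (alpha j < beta j)%N /\
      forall i : nat, (j < i)%N -> alpha i = beta i.

Definition compatible_ordering (sigma : nat -> multiindex) : Prop :=
  bijective sigma /\
  forall m n, degree (sigma m) = degree (sigma n) ->
    ((m < n)%N <-> square_lt (sigma m) (sigma n)).

Definition monomial (K : numFieldType) (V : preTopologicalLmodType K)
    (e : nat -> V) (alpha : multiindex) (x : V) : K^o :=
  \prod_(j <- finsupp alpha) coef_functional e j x ^+ alpha j.

Lemma differentiable_submod (K : numFieldType) (V : normedModType K) (a : K)
    (f g : V -> K^o) (x : V) :
  differentiable f x -> differentiable g x -> differentiable (a *: f + g) x.
Proof. by move=> df dg; apply: differentiableD => //; exact: differentiableZ. Qed.

(* [differentiable] over the scalar field R[i] is complex Frechet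
   differentiability. *)
Section EntireFunctions.
Context {R : realType} (X : normedModType R[i]).

Definition entire_pred : {pred X -> R[i]^o} :=
  mem [set f : X -> R[i]^o | forall x, differentiable f x].

Lemma entire_submod_closed : submod_closed entire_pred.
Proof.
split=> [|a f g]; rewrite !inE /=; first by move=> x; exact: differentiable_cst.
by move=> df dg x; exact: (differentiable_submod a (df x) (dg x)).
Qed.

HB.instance Definition _ :=
  GRing.isSubmodClosed.Build _ _ entire_pred entire_submod_closed.

Record entire := Entire {
  entire_fun :> X -> R[i]^o;
  entireP : entire_fun \in entire_pred }.

HB.instance Definition _ := [isSub for entire_fun].
HB.instance Definition _ := [Choice of entire by <:].
HB.instance Definition _ := [SubChoice_isSubLmodule of entire by <:].
(* tau_0. Entire functions are continuous, so that this is the topology of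
   uniform convergence on compact sets, cf. [compact_open_fam_compactP]. *)
HB.instance Definition _ := Topological.copy entire
  (initial_topology (entire_fun : entire -> {compact-open, X -> R[i]^o})).

End EntireFunctions.

Definition monomials_form_basis (R : realType) (V : normedModType R[i])
    (e : nat -> V) : Prop :=
  forall sigma : nat -> multiindex, compatible_ordering sigma ->
    exists m : nat -> entire V,
      (forall n x, m n x = monomial e (sigma n) x) /\ schauder_basis None m.

(* E is a normed space of scalar sequences via the injection [seq_of]; it
   contains c_00 and its norm is solid. *)
Record seq_structure (K : numFieldType) (E : normedModType K) := SeqStructure {
  seq_of :> {linear E -> (nat -> K^o)};
  seq_of_inj : injective seq_of;
  seq_of_c00 : forall x : nat -> K^o,
    (\forall j \near \oo, x j = 0) -> exists z, seq_of z = x;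
  seq_of_solid : forall (z : E) (y : nat -> K^o),
    (forall j, `|y j| <= `|seq_of z j|) ->
    exists2 w, seq_of w = y & `|w| <= `|z| }.

Section ESum.
Context {K : numFieldType} {E : normedModType K} (S : seq_structure E).
Context (X : nat -> normedModType K).

Definition esum_pred (x : forall j, X j) : Prop :=
  exists z : E, forall j, S z j = `|x j|.

Record esum := ESum { esum_val :> forall j, X j; esumP : esum_pred esum_val }.

HB.instance Definition _ := gen_eqMixin esum.
HB.instance Definition _ := gen_choiceMixin esum.

Lemma esum_ext (x y : esum) : (forall j, x j = y j) -> x = y.
Proof.
case: x y => [x Px] [y Py] /= xy.
have e : x = y by apply: functional_extensionality_dep.
by case: y / e Py {xy} => Py; congr ESum; exact: Prop_irrelevance.
Qed.

(* The element (|x_j|)_j of E. *)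
Definition esum_abs (x : esum) : E := sval (cid (esumP x)).

Lemma esum_absE x j : S (esum_abs x) j = `|x j|.
Proof. exact: (svalP (cid (esumP x))). Qed.

Lemma esum_dom (y : forall j, X j) (z : E) :
  (forall j, `|y j| <= `|S z j|) -> esum_pred y.
Proof.
move=> yz; have [|w wE _] := @seq_of_solid _ _ S z (fun j => `|y j|).
  by move=> j; rewrite normr_id.
by exists w => j; rewrite wE.
Qed.

Lemma esum_abs_le (x : esum) (z : E) : (forall j, `|x j| <= `|S z j|) -> `|esum_abs x| <= `|z|.
Proof.
move=> xz; have [|w wE wz] := @seq_of_solid _ _ S z (fun j => `|x j|).
  by move=> j; rewrite normr_id.
suff -> : esum_abs x = w by [].
by apply: (@seq_of_inj _ _ S); rewrite wE; apply/funext => j; rewrite esum_absE.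
Qed.

Lemma esum0P : esum_pred (fun j => 0).
Proof. by exists 0 => j; rewrite linear0 normr0. Qed.

Lemma esumNP (x : esum) : esum_pred (fun j => - x j).
Proof. by exists (esum_abs x) => j; rewrite esum_absE normrN. Qed.

Lemma esumD_le (x y : esum) j :
  `|x j + y j| <= `|S (esum_abs x + esum_abs y) j|.
Proof.
rewrite linearD /= fctE !esum_absE (ger0_norm (addr_ge0 _ _)) //.
exact: ler_normD.
Qed.

Lemma esumDP (x y : esum) : esum_pred (fun j => x j + y j).
Proof. exact: esum_dom (@esumD_le x y). Qed.

Lemma esumZ_eq (a : K) (x : esum) j :
  S (`|a| *: esum_abs x) j = `|a *: x j|.
Proof. by rewrite linearZ /= fctE esum_absE normrZ. Qed.

Lemma esumZP (a : K) (x : esum) : esum_pred (fun j => a *: x j).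
Proof. by exists (`|a| *: esum_abs x) => j; exact: esumZ_eq. Qed.

Definition esum_zero := ESum esum0P.
Definition esum_opp x := ESum (@esumNP x).
Definition esum_add x y := ESum (@esumDP x y).
Definition esum_scale a x := ESum (@esumZP a x).

Fact esum_addA : associative esum_add.
Proof. by move=> x y z; apply: esum_ext => j /=; rewrite addrA. Qed.
Fact esum_addC : commutative esum_add.
Proof. by move=> x y; apply: esum_ext => j /=; rewrite addrC. Qed.
Fact esum_add0 : left_id esum_zero esum_add.
Proof. by move=> x; apply: esum_ext => j /=; rewrite add0r. Qed.
Fact esum_addN : left_inverse esum_zero esum_opp esum_add.
Proof. by move=> x; apply: esum_ext => j /=; rewrite addNr. Qed.

HB.instance Definition _ :=
  GRing.isZmodule.Build esum esum_addA esum_addC esum_add0 esum_addN.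

Fact esum_scaleA a b x : esum_scale a (esum_scale b x) = esum_scale (a * b) x.
Proof. by apply: esum_ext => j /=; rewrite scalerA. Qed.
Fact esum_scale1 : left_id 1 esum_scale.
Proof. by move=> x; apply: esum_ext => j /=; rewrite scale1r. Qed.
Fact esum_scaleDr : right_distributive esum_scale +%R.
Proof. by move=> a x y; apply: esum_ext => j /=; rewrite scalerDr. Qed.
Fact esum_scaleDl x : {morph esum_scale^~ x : a b / a + b}.
Proof. by move=> a b; apply: esum_ext => j /=; rewrite scalerDl. Qed.

HB.instance Definition _ := GRing.Zmodule_isLmodule.Build K esum
  esum_scaleA esum_scale1 esum_scaleDr esum_scaleDl.

Definition esum_norm (x : esum) : K := `|esum_abs x|.

Fact esum_normD x y : esum_norm (x + y) <= esum_norm x + esum_norm y.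
Proof.
apply: le_trans (ler_normD _ _); apply: esum_abs_le => j; exact: esumD_le.
Qed.

Fact esum_normZ a x : esum_norm (a *: x) = `|a| * esum_norm x.
Proof.
rewrite /esum_norm -[X in X * _]normr_id -normrZ; congr (`|_|).
apply: (@seq_of_inj _ _ S); apply/funext => j.
by rewrite esumZ_eq esum_absE.
Qed.

Fact esum_norm0 x : esum_norm x = 0 -> x = 0.
Proof.
move=> /normr0_eq0 x0; apply: esum_ext => j; apply/normr0_eq0.
by rewrite -esum_absE x0 linear0.
Qed.

HB.instance Definition _ :=
  Lmodule_isNormed.Build K esum esum_normD esum_normZ esum_norm0.

Lemma blockP (j : nat) (v : X j) :
  esum_pred (dfwith (fun i => 0 : X i) j v).
Proof.
have [|z zE] := @seq_of_c00 _ _ S (fun i => `|dfwith (fun i => 0 : X i) j v i|).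
  near=> i; rewrite dfwithout ?normr0//.
  apply/eqP => ji.
  have : (j < i)%N by near: i; exact: nbhs_infty_gt.
  by rewrite ji ltnn.
by exists z => i; rewrite zE.
Unshelve. all: by end_near. Qed.

Definition block (j : nat) (v : X j) : esum := ESum (@blockP j v).

End ESum.

Arguments esum {K E} S X.
Arguments block {K E} S X j v.

(* [N j] is the length of the basis [e j] of the block [X j]; [phi] is an
   arbitrary enumeration of the pairs (block, position in block). *)
Definition esum_monomials_basis (R : realType) (E : normedModType R[i])
    (S : seq_structure E) (X : nat -> normedModType R[i])
    (N : nat -> option nat) (e : forall j, nat -> X j) : Prop :=
  forall phi : nat -> nat * nat,
    set_bij [set: nat] [set jk | below (N jk.1) jk.2] phi ->
    let b n := block S X (phi n).1 (e (phi n).1 (phi n).2) in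
    schauder_basis None b /\ monomials_form_basis b.

Section Modulus.
Context {R : realType}.
Implicit Types z w : R[i].

Lemma normr_normc z : `|z| = (normc z)%:C.
Proof. by case: z => a b; rewrite normc_def. Qed.

Lemma normc_ge0 z : 0 <= normc z.
Proof. by case: z => a b; exact: sqrtr_ge0. Qed.

Lemma le_normc z w : (`|z| <= `|w|) = (normc z <= normc w).
Proof. by rewrite !normr_normc lecR. Qed.
End Modulus.

Section LnormCounting.
Context {R : realType} (r : R) (hr : 1 <= r).
Local Open Scope ereal_scope.
Local Notation "'N u" := ('N[counting]_(r%:E)[EFin \o u]) (at level 10, u at level 8).
Implicit Types u v : nat -> R.

Let r0 : (0 < r)%R. Proof. exact: lt_le_trans ltr01 hr. Qed.

Lemma lnormE u : 'N u = (\sum_(k <oo) ((`|u k| `^ r)%R)%:E) `^ r^-1.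
Proof. by rewrite Lnorm_counting. Qed.

Let sum_ge0 u : 0 <= \sum_(k <oo) ((`|u k| `^ r)%R)%:E.
Proof. by apply: nneseries_ge0 => n _ _; rewrite lee_fin powR_ge0. Qed.

Lemma lnorm_mono u v : (forall k, `|u k| <= `|v k|)%R -> 'N u <= 'N v.
Proof.
move=> uv; rewrite !lnormE; apply: gt0_ler_poweR.
- by rewrite invr_ge0 ltW.
- by rewrite in_itv /= sum_ge0 leey.
- by rewrite in_itv /= sum_ge0 leey.
- apply: lee_nneseries => [n _ _|n _]; first by rewrite lee_fin powR_ge0.
  by rewrite lee_fin; apply: ge0_ler_powR; rewrite ?nnegrE // ltW.
Qed.

Lemma lnormZ (a : R) u : 'N (fun k => a * u k)%R = `|a|%:E * 'N u.
Proof.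
rewrite !lnormE (eq_eseriesr (g := fun k => ((`|a| `^ r)%R)%:E * ((`|u k| `^ r)%R)%:E)).
  rewrite nneseriesZl => [|k _]; last by rewrite lee_fin powR_ge0.
  rewrite poweRM ?lee_fin ?powR_ge0 ?sum_ge0 //; congr (_ * _).
  by rewrite poweR_EFin -powRrM mulfV ?gt_eqF // powRr1.
by move=> k _; rewrite -EFinM normrM powRM.
Qed.

Lemma lnormD u v : 'N (fun k => u k + v k)%R <= 'N u + 'N v.
Proof. by apply: (@minkowski_EFin _ _ _ counting u v r). Qed.

Lemma lnorm_eq0 u : 'N u = 0 -> forall k, u k = 0%R.
Proof.
rewrite lnormE => /poweR_eq0_eq0 -/(_ (sum_ge0 u)) s0 k.
have uk0 : (`|u k| `^ r)%:E <= 0.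
  rewrite -s0 (nneseriesD1 (n := k)) //.
  by rewrite leeDl //; apply: nneseries_ge0 => n _ _; rewrite lee_fin powR_ge0.
apply/normr0_eq0/(@powR_eq0_eq0 _ _ r)/eqP.
by rewrite eq_le powR_ge0 andbT -lee_fin.
Qed.

Lemma lnorm_fin u n : (forall k, (n <= k)%N -> u k = 0%R) ->
  'N u = (((\sum_(k < n) `|u k| `^ r) `^ r^-1)%R)%:E.
Proof.
move=> u0; rewrite lnormE (nneseries_split 0 n) => [|k _]; last first.
  by rewrite lee_fin powR_ge0.
rewrite [X in _ + X]eseries0 => [|k nk _]; last first.
  by rewrite u0 // normr0 powR0 ?gt_eqF.
by rewrite adde0 add0n sumEFin poweR_EFin big_mkord.
Qed.
End LnormCounting.

(* The space C^d with the l_p norm. *)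
Section EllPd.
Context {R : realType} (p : R) (hp : 1 <= p) (d : nat).

Definition ellpd of 1 <= p : Type := 'I_d -> R[i]^o.
Local Notation T := (ellpd hp).

HB.instance Definition _ := GRing.Lmodule.copy T ('I_d -> R[i]^o).

Definition ellpd_norm (x : T) : R[i] :=
  ((\sum_(i < d) normc (x i) `^ p) `^ p^-1)%:C.

Let pad (x : T) (k : nat) : R := if insub k is Some i then normc (x i) else 0.

Let padE x (i : 'I_d) : pad x i = normc (x i).
Proof. by rewrite /pad insubT //= => hi; congr (normc (x _)); apply: val_inj. Qed.

Let pad_ge0 x k : 0 <= pad x k.
Proof. by rewrite /pad; case: insubP => // i _ _; exact: normc_ge0. Qed.

Let pad0 x k : (d <= k)%N -> pad x k = 0.
Proof. by rewrite leqNgt /pad => dk; rewrite insubN. Qed.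

Let normE x : (ellpd_norm x) =
  (fine ('N[counting]_(p%:E)[EFin \o pad x])%E)%:C.
Proof.
rewrite (lnorm_fin hp (@pad0 x)) /ellpd_norm /=; congr ((_ `^ _)%:C).
by apply: eq_bigr => i _; rewrite padE ger0_norm // normc_ge0.
Qed.

Let pad_fin x : ('N[counting]_(p%:E)[EFin \o pad x])%E \is a fin_num.
Proof. by rewrite (lnorm_fin hp (@pad0 x)). Qed.

Fact ellpd_normD x y : ellpd_norm (x + y) <= ellpd_norm x + ellpd_norm y.
Proof.
rewrite !normE -rmorphD lecR -fineD // fine_le //.
  by rewrite fin_numD !pad_fin.
apply: le_trans (lnormD hp _ _); apply: lnorm_mono => // k.
rewrite !ger0_norm ?addr_ge0 // /pad; case: insubP => [i _ _|_].
  exact: le_normcD.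
by rewrite addr0.
Qed.

Fact ellpd_normZ (a : R[i]) x : ellpd_norm (a *: x) = `|a| * ellpd_norm x.
Proof.
rewrite !normE normr_normc -rmorphM; congr (_%:C).
rewrite -[normc a](ger0_norm (normc_ge0 _)) -[X in X * _]/(fine ( `|normc a|%:E)).
rewrite -fineM // -lnormZ //; congr (fine (Lnorm _ _ _)).
apply/funext => k /=; congr (_%:E); rewrite /pad; case: insubP => [i _ _|_].
  exact: normcM.
by rewrite mulr0.
Qed.

Fact ellpd_norm0 x : ellpd_norm x = 0 -> x = 0.
Proof.
rewrite normE => -[x0]; apply/funext => i; apply: eq0_normc; rewrite -padE.
by apply: (@lnorm_eq0 _ p hp (pad x)); rewrite -(fineK (pad_fin x)) x0.
Qed.

HB.instance Definition _ :=
  Lmodule_isNormed.Build R[i] T ellpd_normD ellpd_normZ ellpd_norm0.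

End EllPd.

Definition ellpd_unit (R : realType) (p : R) (hp : 1 <= p) (d : nat) (k : nat) :
  ellpd d hp := fun i => (k == i :> nat)%:R.
Arguments ellpd_unit {R p} hp d k.

Section Ellr.
Context {R : realType} (r : R) (hr : 1 <= r).

Let N (x : nat -> R[i]^o) : \bar R :=
  ('N[counting]_(r%:E)[EFin \o (fun n => normc (x n))])%E.

Definition ellr_pred of 1 <= r : {pred nat -> R[i]^o} :=
  mem [set x | finite_norm counting r%:E (fun n => normc (x n))].

Let N_le x y : (forall n, normc (x n) <= normc (y n)) -> (N x <= N y)%E.
Proof.
by move=> xy; apply: lnorm_mono => // k; rewrite !ger0_norm ?normc_ge0.
Qed.

Let ND x y : (N (x + y)%R <= N x + N y)%E.
Proof.
apply: le_trans (lnormD hr _ _); apply: lnorm_mono => // k.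
by rewrite !ger0_norm ?addr_ge0 ?normc_ge0 //; exact: le_normcD.
Qed.

Let NZ (a : R[i]) x : N (a *: x) = ((normc a)%:E * N x)%E.
Proof.
rewrite -[X in X%:E](ger0_norm (normc_ge0 _)) -lnormZ //.
by congr Lnorm; apply/funext => k /=; rewrite -normcM.
Qed.

Let N_fin (x : nat -> R[i]^o) n : (forall k, (n <= k)%N -> x k = 0) -> (N x < +oo)%E.
Proof.
move=> x0; rewrite /N (@lnorm_fin _ r hr _ n) ?ltry // => k /x0 ->.
exact: normc0.
Qed.

Lemma ellr_submod_closed : submod_closed (ellr_pred hr).
Proof.
split=> [|a x y]; rewrite !inE; first exact: (@N_fin _ 0%N).
move=> Nx Ny; rewrite /= /finite_norm.
apply: (le_lt_trans (ND _ _)); rewrite NZ lte_add_pinfty //.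
by rewrite lte_mul_pinfty ?lee_fin ?normc_ge0.
Qed.

HB.instance Definition _ :=
  GRing.isSubmodClosed.Build _ _ (ellr_pred hr) ellr_submod_closed.

Record ellr := Ellr {
  ellr_val :> nat -> R[i]^o;
  ellrP : ellr_val \in ellr_pred hr }.

HB.instance Definition _ := [isSub for ellr_val].
HB.instance Definition _ := [Choice of ellr by <:].
HB.instance Definition _ := [SubChoice_isSubLmodule of ellr by <:].

Definition ellr_norm (x : ellr) : R[i] :=
  (fine ('N[counting]_(r%:E)[EFin \o (fun n => normc (x n))])%E)%:C.

Let fin_N (x : ellr) : N x \is a fin_num.
Proof.
by rewrite ge0_fin_numE ?Lnorm_ge0 //; have := ellrP x; rewrite inE.
Qed.

Fact ellr_normD x y : ellr_norm (x + y) <= ellr_norm x + ellr_norm y.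
Proof.
rewrite -rmorphD lecR -fineD ?fin_N // fine_le ?fin_N //.
  by rewrite fin_numD !fin_N.
exact: ND.
Qed.

Fact ellr_normZ (a : R[i]) x : ellr_norm (a *: x) = `|a| * ellr_norm x.
Proof.
rewrite normr_normc -rmorphM; congr (_%:C).
by rewrite -[X in X * _]/(fine (normc a)%:E) -fineM ?fin_N // -NZ.
Qed.

Fact ellr_norm0 x : ellr_norm x = 0 -> x = 0.
Proof.
move=> [x0]; apply/val_inj/funext => i; apply: eq0_normc.
by apply: (@lnorm_eq0 _ r hr (fun n => normc (x n))); rewrite -[LHS](fineK (fin_N x)) x0.
Qed.

HB.instance Definition _ :=
  Lmodule_isNormed.Build R[i] ellr ellr_normD ellr_normZ ellr_norm0.

Definition ellr_seq : {linear ellr -> (nat -> R[i]^o)} := \val.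

Lemma ellr_seq_inj : injective ellr_seq.
Proof. exact: val_inj. Qed.

Lemma ellr_c00 (x : nat -> R[i]^o) :
  (\forall j \near \oo, x j = 0) -> exists z : ellr, ellr_seq z = x.
Proof.
move=> [n _ x0].
have Px : x \in ellr_pred hr by rewrite inE /=; exact: (@N_fin _ n).
by exists (Ellr Px).
Qed.

Lemma ellr_solid (z : ellr) (y : nat -> R[i]^o) :
  (forall j, `|y j| <= `|ellr_seq z j|) ->
  exists2 w : ellr, ellr_seq w = y & `|w| <= `|z|.
Proof.
move=> yz; have {}yz : (N y <= N z)%E.
  by apply: N_le => n; rewrite -le_normc; exact: yz.
have Py : y \in ellr_pred hr.
  by rewrite inE /=; apply: le_lt_trans yz _; rewrite ltey_eq fin_N.
exists (Ellr Py) => //.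
by rewrite [leLHS]/(ellr_norm _) [leRHS]/(ellr_norm _) lecR fine_le ?fin_N //;
  exact: (fin_N (Ellr Py)).
Qed.

Definition ellr_structure : seq_structure ellr :=
  SeqStructure ellr_seq_inj ellr_c00 ellr_solid.

End Ellr.

Lemma cvg0_submod (K : numFieldType) (a : K) (x y : nat -> K^o) :
  x @ \oo --> (0 : K^o) -> y @ \oo --> (0 : K^o) ->
  a *: x + y @ \oo --> (0 : K^o).
Proof.
move=> x0 y0; rewrite -[X in _ --> X]addr0 -[X in _ --> X + _](scaler0 _ a).
by apply: cvgD => //; exact: cvgZr.
Qed.

Section CNull.
Context {R : realType}.

Definition c0_pred : {pred nat -> R[i]^o} :=
  mem [set x : nat -> R[i]^o | x @ \oo --> (0 : R[i]^o)].

Lemma c0_submod_closed : submod_closed c0_pred.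
Proof.
split=> [|a x y]; rewrite !inE /=; first exact: cvg_cst.
exact: cvg0_submod.
Qed.


HB.instance Definition _ :=
  GRing.isSubmodClosed.Build _ _ c0_pred c0_submod_closed.

Record c0 := CNull {
  c0_val :> nat -> R[i]^o;
  c0P : c0_val \in c0_pred }.

HB.instance Definition _ := [isSub for c0_val].
HB.instance Definition _ := [Choice of c0 by <:].
HB.instance Definition _ := [SubChoice_isSubLmodule of c0 by <:].

Definition c0_norm (x : c0) : R[i] := (sup (range (fun n => normc (x n))))%:C.

Let range_neq0 (x : c0) : range (fun n => normc (x n)) !=set0.
Proof. by exists (normc (x 0%N)), 0%N. Qed.

Let cvg_normc (x : nat -> R[i]^o) :
  x @ \oo --> (0 : R[i]^o) <-> (fun n => normc (x n)) @ \oo --> (0 : R).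
Proof.
split=> /cvgr0Pnorm_lt x0; apply/cvgr0Pnorm_lt => e e0.
  have /x0 : 0 < e%:C by rewrite ltcR.
  by apply: filterS => n; rewrite normr_normc ltcR ger0_norm // normc_ge0.
have /eqP eE : (complex.Re e)%:C == e.
  by case: e e0 => a b /=; rewrite ltcE /= => /andP[/eqP -> _].
have /x0 : 0 < complex.Re e by rewrite -ltcR eE.
apply: filterS => n /=.
by rewrite ger0_norm ?normc_ge0 // -ltcR eE normr_normc.
Qed.

Let ubound_c0 (x : c0) : has_ubound (range (fun n => normc (x n))).
Proof.
apply/bounded_fun_has_ubound/cvg_seq_bounded; apply: cvgP.
by apply/cvg_normc; have := c0P x; rewrite inE.
Qed.

Let le_c0_norm (x : c0) n : normc (x n) <= sup (range (fun n => normc (x n))).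
Proof. by apply: ub_le_sup; [exact: ubound_c0|exists n]. Qed.

Let c0_norm_le (x : c0) (M : R) : (forall n, normc (x n) <= M) ->
  sup (range (fun n => normc (x n))) <= M.
Proof. by move=> xM; apply: ge_sup => // _ [n _ <-]. Qed.

Fact c0_normD x y : c0_norm (x + y) <= c0_norm x + c0_norm y.
Proof.
rewrite -rmorphD lecR; apply: c0_norm_le => n.
by apply: le_trans (le_normcD _ _) _; rewrite lerD // le_c0_norm.
Qed.

Fact c0_normZ (a : R[i]) x : c0_norm (a *: x) = `|a| * c0_norm x.
Proof.
rewrite normr_normc -rmorphM; congr (_%:C); apply/le_anti/andP; split.
  apply: c0_norm_le => n; rewrite normcM.
  by rewrite ler_wpM2l ?normc_ge0 // le_c0_norm.
have [->|a0] := eqVneq a 0.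
  by rewrite normc0 mul0r; apply: le_trans (le_c0_norm _ 0%N); exact: normc_ge0.
have na0 : 0 < normc a.
  by rewrite lt_def normc_ge0 andbT; apply: contra_neq a0; exact: eq0_normc.
rewrite mulrC -ler_pdivlMr //; apply: c0_norm_le => n.
by rewrite ler_pdivlMr // mulrC -normcM; exact: (le_c0_norm (a *: x)).
Qed.

Fact c0_norm0 x : c0_norm x = 0 -> x = 0.
Proof.
move=> [x0]; apply/val_inj/funext => i; apply: eq0_normc.
by apply/le_anti; rewrite normc_ge0 andbT -x0 le_c0_norm.
Qed.

HB.instance Definition _ :=
  Lmodule_isNormed.Build R[i] c0 c0_normD c0_normZ c0_norm0.

Definition c0_seq : {linear c0 -> (nat -> R[i]^o)} := \val.

Lemma c0_seq_inj : injective c0_seq.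
Proof. exact: val_inj. Qed.

Lemma c0_c00 (x : nat -> R[i]^o) :
  (\forall j \near \oo, x j = 0) -> exists z : c0, c0_seq z = x.
Proof.
move=> x0; have Px : x \in c0_pred by rewrite inE; exact: cvg_near_cst.
by exists (CNull Px).
Qed.

Lemma c0_solid (z : c0) (y : nat -> R[i]^o) :
  (forall j, `|y j| <= `|c0_seq z j|) ->
  exists2 w : c0, c0_seq w = y & `|w| <= `|z|.
Proof.
move=> yz; have {}yz n : normc (y n) <= normc (z n).
  by rewrite -le_normc; exact: yz.
have Py : y \in c0_pred.
  have z0 : (fun n => normc (z n)) @ \oo --> (0 : R).
    by apply/cvg_normc; have := c0P z; rewrite inE.
  rewrite inE; apply/cvg_normc; apply: squeeze_cvgr (cvg_cst 0) z0.
  by apply: nearW => n /=; rewrite normc_ge0 yz.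
exists (CNull Py) => //.
rewrite [leLHS]/(c0_norm _) [leRHS]/(c0_norm _) lecR; apply: c0_norm_le => n.
exact: le_trans (yz n) (le_c0_norm _ _).
Qed.

Definition c0_structure : seq_structure c0 :=
  SeqStructure c0_seq_inj c0_c00 c0_solid.

End CNull.

Arguments c0 R : clear implicits.
Arguments c0_structure R : clear implicits.
Arguments esum_monomials_basis {R E} S X N e.

(* Main.v *)
From HB Require Import structures.
Require Import Defs.
From mathcomp Require Import all_boot all_order all_algebra finmap complex.
From mathcomp Require Import all_classical all_reals all_analysis.
From mathcomp Require Import separable cyclotomic zify ring lra.
Import Order.TTheory GRing.Theory Num.Theory.
Import numFieldNormedType.Exports.
Import Normc.
Local Open Scope classical_set_scope.
Local Open Scope complex_scope.
Local Open Scope ring_scope.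

(** The proof rests on two facts about a space X with a 1-unconditional basis.
    Write x = (x_n)_n for the coordinates of x.  Call a set of scalar sequences
    solid if multiplying the entries by scalars of modulus at most 1 does not
    leave it.  In X such multiplications are contractions, and the solid hull
    of a compact set is again compact ([hull_compact]), so that sup norms over
    solid compact sets generate the compact-open topology.

    The first fact is that the partial sum operators of the monomial expansion
    are equicontinuous ([partial_sum_bound]).  Among monomials of one degree the
    square order is the colexicographic one: alpha precedes beta iff
    alpha_j < beta_j at the last index j at which they differ
    ([square_ltE]).  The multi-indices before beta are therefore the disjoint
    union of the sets {alpha_i = beta_i for i > j, alpha_j = k}, for all j and
    k < beta_j, and there are only |beta| pairs (j, k).  The part of a polynomial
    supported by such a set is an average of the polynomial over rotations of the
    coordinates by roots of unity, so that its sup norm over a solid set does not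
    increase ([part_weight]).  Hence, in degree n, every partial sum of a
    polynomial has at most n + 1 times its sup norm.  Dilating the solid set by 2
    gains 2^-n in degree n, and the sum over n of (n + 1) 2^-n is finite: the
    interleaving of the degrees chosen by the ordering does not matter.

    The second fact is that the span of the monomials is dense
    ([monomial_span_dense]).  An entire function f is, on a compact set, the
    uniform limit of its restrictions to the first m coordinates; this reduces
    density to m variables and, by induction on m, to one.  In one variable f is
    approximated by its interpolation polynomials at roots of unity, with an
    error controlled by the supremum of |f| over a larger disc only
    ([interpolation_bound]): it is uniform in the other variables.  The
    coefficients of these polynomials are finite linear combinations of
    translates of f, so that they are entire in the other variables and the
    induction goes on.  The error bound follows from Cauchy's formula for
    the boundary of a square, which is deduced from Goursat's lemma.

    The basis property follows as usual ([monomial_schauder]): by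
    equicontinuity the coefficients extend from the span of the monomials to all
    entire functions, and the expansion converges on the closure of this span.

    It remains to see that an E-sum of spaces with 1-unconditional bases has a
    basis of the same kind in every enumeration.  This is stated with coordinate
    functionals ([coordinate_system]), for which the order of the basis is
    irrelevant, and checked block by block ([esum_coordinates]). *)

Set Implicit Arguments.
Unset Strict Implicit.
Unset Printing Implicit Defensive.

(** * The norm as a real number *)

Section RealNorm.
Context {R : realType}.
Implicit Types V W : normedModType R[i].

(** The norm of a complex normed space is a nonnegative complex number; as a
    real number it is accessible to linear arithmetic. *)
Definition nm {V} (x : V) : R := complex.Re `|x|.

Lemma normE V (x : V) : `|x| = (nm x)%:C.
Proof. by rewrite /nm RRe_real // ger0_real. Qed.

Lemma nm_ge0 V (x : V) : 0 <= nm x.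
Proof. by rewrite -ler0c -normE. Qed.

Lemma nmD V (x y : V) : nm (x + y) <= nm x + nm y.
Proof. by rewrite -lecR rmorphD /= -!normE ler_normD. Qed.

Lemma nmN V (x : V) : nm (- x) = nm x.
Proof. by rewrite /nm normrN. Qed.

Lemma nmB V (x y : V) : nm (x - y) = nm (y - x).
Proof. by rewrite -nmN opprB. Qed.

Lemma nmBD V (x y : V) : nm (x - y) <= nm x + nm y.
Proof. by rewrite -(nmN y) nmD. Qed.

Lemma nm_trans V (y x z : V) : nm (x - z) <= nm (x - y) + nm (y - z).
Proof. by apply: le_trans (nmD _ _); rewrite addrA subrK. Qed.

Lemma nmZ V (a : R[i]^o) (x : V) : nm (a *: x) = nm a * nm x.
Proof. by apply: complexI; rewrite rmorphM /= -!normE normrZ. Qed.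

Lemma nmM (a b : R[i]^o) : nm (a * b : R[i]^o) = nm a * nm b.
Proof. exact: nmZ. Qed.

Lemma nm0 V : nm (0 : V) = 0.
Proof. by rewrite /nm normr0. Qed.

Lemma nm1 : nm (1 : R[i]^o) = 1.
Proof. by rewrite /nm normr1. Qed.

Lemma nmV (a : R[i]^o) : nm (a^-1 : R[i]^o) = (nm a)^-1.
Proof. by apply: complexI; rewrite fmorphV /= -!normE normfV. Qed.

Lemma nmX (a : R[i]^o) n : nm (a ^+ n : R[i]^o) = nm a ^+ n.
Proof. by apply: complexI; rewrite rmorphXn /= -!normE normrX. Qed.

Lemma nm_eq0 V (x : V) : (nm x == 0) = (x == 0).
Proof. by rewrite -[RHS]normr_eq0 normE eq_complex /= eqxx andbT. Qed.

Lemma nm_gt0 V (x : V) : (0 < nm x) = (x != 0).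
Proof. by rewrite lt_def nm_ge0 andbT nm_eq0. Qed.

Lemma nm_le V W (x : V) (y : W) : (`|x| <= `|y|) = (nm x <= nm y).
Proof. by rewrite !normE lecR. Qed.

Lemma nm_sum V I (r : seq I) (P : pred I) (F : I -> V) :
  nm (\sum_(i <- r | P i) F i) <= \sum_(i <- r | P i) nm (F i).
Proof.
elim/big_ind2 : _ => [|x a y b xa yb|//]; first by rewrite nm0.
exact: le_trans (nmD _ _) (lerD xa yb).
Qed.

Lemma nmC (a : R) : nm (a%:C : R[i]^o) = `|a|.
Proof. by rewrite /nm normc_def /= expr0n /= addr0 sqrtr_sqr. Qed.

Lemma nm_nat n : nm (n%:R : R[i]^o) = n%:R.
Proof. by rewrite -(rmorph_nat (real_complex R)) nmC normr_nat. Qed.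

Lemma pos_complex (e : R[i]) : 0 < e -> exists2 d : R, 0 < d & e = d%:C.
Proof.
by case: e => a b; rewrite ltcE /= => /andP[/eqP -> a0]; exists a.
Qed.

Lemma nbhs_nmP V (x : V) (P : set V) :
  nbhs x P <-> exists2 e : R, 0 < e & forall y, nm (y - x) < e -> P y.
Proof.
split=> [/nbhs_normP[_ /pos_complex[e e0 ->] xP]|[e e0 xP]].
  by exists e => // y yx; apply: xP; rewrite /ball_/= distrC normE ltcR.
apply/nbhs_normP; exists e%:C; first by rewrite /= ltcR.
by move=> y; rewrite /ball_/= distrC normE ltcR; exact: xP.
Qed.

Lemma cvg_nmP V (T : Type) (F : set_system T) (FF : Filter F) (f : T -> V) (x : V) :
  f @ F --> x <-> forall e : R, 0 < e -> \forall t \near F, nm (f t - x) < e.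
Proof.
split=> [fx e e0|fx A].
  by apply: (fx [set y | nm (y - x) < e]); apply/nbhs_nmP; exists e.
by move=> /nbhs_nmP[e e0 xA]; apply: filterS (fx e e0) => t; exact: xA.
Qed.

Lemma continuous_nmP V W (f : V -> W) (x : V) :
  {for x, continuous f} <-> forall e : R, 0 < e ->
    exists2 d : R, 0 < d & forall y, nm (y - x) < d -> nm (f y - f x) < e.
Proof.
split=> [/cvg_nmP fx e /fx /nbhs_nmP//|fx].
by apply/cvg_nmP => e /fx /nbhs_nmP.
Qed.

Lemma Re_le_nm (z : R[i]^o) : `|complex.Re z| <= nm z.
Proof. by rewrite -lecR -normE normc_ge_Re. Qed.

Lemma Im_le_nm (z : R[i]^o) : `|complex.Im z| <= nm z.
Proof.
rewrite -lecR -normE normc_def lecR -sqrtr_sqr ler_wsqrtr //.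
by rewrite lerDr sqr_ge0.
Qed.

Lemma nm_le_ReIm (z : R[i]^o) : nm z <= `|complex.Re z| + `|complex.Im z|.
Proof.
rewrite {1}(complexE z) -(nmC (complex.Im z)) -(nmC (complex.Re z)).
apply: le_trans (nmD _ _) _; rewrite lerD //.
by rewrite nmM; rewrite {1}/nm normc_def /= expr0n add0r expr1n sqrtr1 mul1r.
Qed.
End RealNorm.

(** * Integration of complex functions over segments *)

Section ComplexIntegral.
Context {R : realType}.
Local Notation C := (R[i]^o).
Local Notation mu := (@lebesgue_measure R).
Local Open Scope ring_scope.
Implicit Types (h : R -> C) (a b : R).

Definition seg_integral (h : R -> C) (a b : R) : C :=
  Complex (\int[mu]_(t in `[a, b]) complex.Re (h t))
          (\int[mu]_(t in `[a, b]) complex.Im (h t)).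

Definition continuous_seg h a b := forall t, a <= t <= b -> {for t, continuous h}.

Lemma continuous_seg_cst c a b : continuous_seg (fun=> c) a b.
Proof. by move=> t _; exact: cst_continuous. Qed.

Lemma continuous_segW a b c d h : a <= c -> d <= b ->
  continuous_seg h a b -> continuous_seg h c d.
Proof.
move=> ac db ch t /andP[ct td]; apply: ch.
by rewrite (le_trans ac ct) (le_trans td db).
Qed.

Lemma integrable_part (p : C -> R) h a b : (forall z w, `|p z - p w| <= nm (z - w)) ->
  continuous_seg h a b -> mu.-integrable `[a, b] (EFin \o (p \o h)).
Proof.
move=> p_lip ch; apply: continuous_compact_integrable; first exact: segment_compact.
apply: continuous_in_subspaceT => t; rewrite inE /= in_itv /= => tab.
apply/cvgrPdist_lt => e e0.
have /cvg_nmP/(_ e e0) := ch t tab.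
by apply: filterS => s; rewrite distrC; apply: le_lt_trans; exact: p_lip.
Qed.

Lemma Re_lip (z w : C) : `|complex.Re z - complex.Re w| <= nm (z - w).
Proof. by apply: le_trans (Re_le_nm _); case: z w => ? ? []. Qed.

Lemma Im_lip (z w : C) : `|complex.Im z - complex.Im w| <= nm (z - w).
Proof. by apply: le_trans (Im_le_nm _); case: z w => ? ? []. Qed.

Lemma eq_seg_integral h k a b : (forall t, a <= t <= b -> h t = k t) ->
  seg_integral h a b = seg_integral k a b.
Proof.
move=> hk; congr Complex; apply: eq_Rintegral => t;
  by rewrite inE /= in_itv /= => /hk ->.
Qed.

Lemma seg_integral_cst (c : C) a b : a <= b -> seg_integral (fun=> c) a b = (b - a)%:C * c.
Proof.
move=> ab; rewrite /seg_integral !Rintegral_cst //= lebesgue_measure_itv /= lte_fin.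
case: ltgtP ab => // [ab|->] _.
  by rewrite -EFinB /=; case: c => x y; rewrite /=; simpc; rewrite !(mulrC _ (b - a)).
by rewrite subrr !mulr0 mul0r.
Qed.

Lemma seg_integralD h k a b : continuous_seg h a b -> continuous_seg k a b ->
  seg_integral (fun t => h t + k t) a b = seg_integral h a b + seg_integral k a b.
Proof.
move=> ch ck.
have aux (p : C -> R) : {morph p : x y / x + y} ->
    (forall z w, `|p z - p w| <= nm (z - w)) ->
    \int[mu]_(t in `[a, b]) p (h t + k t) =
    \int[mu]_(t in `[a, b]) p (h t) + \int[mu]_(t in `[a, b]) p (k t).
  move=> pD p_lip; under eq_Rintegral do rewrite pD.
  rewrite RintegralD //; exact: integrable_part.
by rewrite /seg_integral !aux //; (try exact: Re_lip); (try exact: Im_lip); do 2 case=> ? ?.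
Qed.

Lemma seg_integralZ (c : C) h a b : continuous_seg h a b ->
  seg_integral (fun t => c * h t) a b = c * seg_integral h a b.
Proof.
move=> ch; case: c => x y.
have iRe := integrable_part Re_lip ch.
have iIm := integrable_part Im_lip ch.
have iZ (u : R) (f : R -> R) : mu.-integrable `[a, b] (EFin \o f) ->
    mu.-integrable `[a, b] (EFin \o (fun t => u * f t)).
  by move=> fi; apply: eq_integrable (integrableZl _ u fi).
rewrite /seg_integral; simpc; congr Complex.
  rewrite -!RintegralZl // -RintegralB //; [|exact: iZ|exact: iZ].
  by apply: eq_Rintegral => t _; case: (h t) => ? ?; simpc.
rewrite -!RintegralZl // -RintegralD //; [|exact: iZ|exact: iZ].
by apply: eq_Rintegral => t _; case: (h t) => ? ?; simpc.
Qed.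

Lemma seg_integral_cat c h a b : a <= c -> c <= b -> continuous_seg h a b ->
  seg_integral h a b = seg_integral h a c + seg_integral h c b.
Proof.
move=> ac cb ch.
have aux (p : C -> R) : (forall z w, `|p z - p w| <= nm (z - w)) ->
    \int[mu]_(t in `[a, b]) p (h t) =
    \int[mu]_(t in `[a, c]) p (h t) + \int[mu]_(t in `[c, b]) p (h t).
  move=> p_lip.
  have := @Rintegral_itvB R (p \o h) (BLeft a) (BRight b) c (integrable_part p_lip ch).
  rewrite !bnd_simp => /(_ ac cb).
  rewrite Rintegral_itv_obnd_cbnd; last first.
    apply: (integrableS _ _ _ (integrable_part p_lip (continuous_segW ac (lexx b) ch))) => //.
    exact: subset_itv_oc_cc.
  by move=> <-; rewrite addrC subrK.
by rewrite /seg_integral !aux //; [exact: Im_lip|exact: Re_lip].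
Qed.

(** The factor 2 comes from bounding the real and the imaginary parts
    separately. *)
Lemma seg_integral_bound h a b M : a <= b -> continuous_seg h a b ->
  (forall t, a <= t <= b -> nm (h t) <= M) -> nm (seg_integral h a b) <= 2 * M * (b - a).
Proof.
move=> ab ch hM.
have aux (p : C -> R) : (forall z w, `|p z - p w| <= nm (z - w)) -> p 0 = 0 ->
    `|\int[mu]_(t in `[a, b]) p (h t)| <= M * (b - a).
  move=> p_lip p0; have ip := integrable_part p_lip ch.
  apply: le_trans (le_normr_Rintegral _ ip) _ => //.
  apply: (@le_trans _ _ (\int[mu]_(t in `[a, b]) M)).
    apply: le_Rintegral => //.
    - exact: (integrable_norm ip).
    - apply: (@integrable_part (fun=> M) (fun=> 0)); last exact: continuous_seg_cst.
      by move=> z w; rewrite subrr normr0 nm_ge0.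
    - move=> t; rewrite /= in_itv /= => /hM; apply: le_trans.
      by have := p_lip (h t) 0; rewrite p0 !subr0.
  rewrite Rintegral_cst //= lebesgue_measure_itv /= lte_fin.
  by case: ltgtP ab => // -> _; rewrite subrr /= mulr0.
apply: le_trans (nm_le_ReIm _) _; rewrite /= -mulrA mulr2n mulrDl mul1r lerD //.
- exact: (aux _ Re_lip).
- exact: (aux _ Im_lip).
Qed.
End ComplexIntegral.

(** * Integration along the boundary of a rectangle *)

Section Rectangles.
Context {R : realType}.
Local Notation C := (R[i]^o).
Implicit Types (F G : C -> C) (a b c d e x y : R) (z w : C).

Definition pt x y : C := Complex x y.

Lemma ptB x y x' y' : pt x y - pt x' y' = pt (x - x') (y - y').
Proof. by []. Qed.

Lemma ptl0 x : pt x 0 = x%:C. Proof. by []. Qed.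

Lemma pt0r y : pt 0 y = 'i * y%:C. Proof. by rewrite /pt; simpc. Qed.

Lemma nm_i : nm ('i : C) = 1.
Proof. by rewrite /nm normc_def /= expr0n add0r expr1n sqrtr1. Qed.

Lemma nm_ptl x y c : nm (pt x c - pt y c) = `|x - y|.
Proof. by rewrite ptB subrr ptl0 nmC. Qed.

Lemma nm_ptr x y c : nm (pt c x - pt c y) = `|x - y|.
Proof. by rewrite ptB subrr pt0r nmM nm_i mul1r nmC. Qed.

Lemma continuous_ptl c : continuous (fun x => pt x c).
Proof.
move=> x; apply/cvg_nmP => e e0; near=> y; rewrite nm_ptl distrC.
by near: y; exact: (nbhsx_ballx x e e0).
Unshelve. all: by end_near. Qed.

Lemma continuous_ptr c : continuous (fun x => pt c x).
Proof.
move=> x; apply/cvg_nmP => e e0; near=> y; rewrite nm_ptr distrC.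
by near: y; exact: (nbhsx_ballx x e e0).
Unshelve. all: by end_near. Qed.

Definition in_rect a b c d z :=
  (a <= complex.Re z <= b) /\ (c <= complex.Im z <= d).

Definition on_boundary a b c d z := in_rect a b c d z /\
  [\/ complex.Re z = a, complex.Re z = b, complex.Im z = c | complex.Im z = d].

Definition continuous_boundary F a b c d :=
  forall z, on_boundary a b c d z -> {for z, continuous F}.

(** The contour integral over the positively oriented boundary.  Opposite
    edges are paired under one integral sign, so that an affine function has
    constant integrands. *)
Definition rect_integral F a b c d : C :=
  seg_integral (fun x => F (pt x c) - F (pt x d)) a b +
  'i * seg_integral (fun y => F (pt b y) - F (pt a y)) c d.

Lemma in_rectW a b c d a' b' c' d' z : a <= a' -> b' <= b -> c <= c' -> d' <= d ->
  in_rect a' b' c' d' z -> in_rect a b c d z.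
Proof. by rewrite /in_rect => ? ? ? ? [/andP[? ?] /andP[? ?]]; split; apply/andP; split; lra. Qed.

Lemma continuous_segB (h k : R -> C) a b : continuous_seg h a b -> continuous_seg k a b ->
  continuous_seg (fun t => h t - k t) a b.
Proof. by move=> ch ck t tab; apply: continuousB; [exact: ch|exact: ck]. Qed.

Section Fixed.
Variables (a b c d : R) (ab : a <= b) (cd : c <= d).

Let aa : a <= a <= b. Proof. by rewrite lexx ab. Qed.
Let bb : a <= b <= b. Proof. by rewrite lexx ab. Qed.
Let cc : c <= c <= d. Proof. by rewrite lexx cd. Qed.
Let dd : c <= d <= d. Proof. by rewrite lexx cd. Qed.

Lemma continuous_edges F : continuous_boundary F a b c d ->
  [/\ continuous_seg (fun x => F (pt x c)) a b,
      continuous_seg (fun x => F (pt x d)) a b,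
      continuous_seg (fun y => F (pt a y)) c d &
      continuous_seg (fun y => F (pt b y)) c d].
Proof.
move=> cF; split=> t tab.
- apply: (@continuous_comp _ _ _ (fun x => pt x c) F); first exact: continuous_ptl.
  by apply: cF; split; [|constructor 3].
- apply: (@continuous_comp _ _ _ (fun x => pt x d) F); first exact: continuous_ptl.
  by apply: cF; split; [|constructor 4].
- apply: (@continuous_comp _ _ _ (fun x => pt a x) F); first exact: continuous_ptr.
  by apply: cF; split; [|constructor 1].
- apply: (@continuous_comp _ _ _ (fun x => pt b x) F); first exact: continuous_ptr.
  by apply: cF; split; [|constructor 2].
Qed.

Lemma continuous_pairs F : continuous_boundary F a b c d ->
  continuous_seg (fun x => F (pt x c) - F (pt x d)) a b /\
  continuous_seg (fun y => F (pt b y) - F (pt a y)) c d.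
Proof. by case/continuous_edges => *; split; exact: continuous_segB. Qed.

Lemma rect_integralD F G : continuous_boundary F a b c d -> continuous_boundary G a b c d ->
  rect_integral (fun z => F z + G z) a b c d = rect_integral F a b c d + rect_integral G a b c d.
Proof.
move=> /continuous_pairs[hF vF] /continuous_pairs[hG vG]; rewrite /rect_integral.
rewrite (eq_seg_integral (k := fun x => (F (pt x c) - F (pt x d)) + (G (pt x c) - G (pt x d)))); last first.
  by move=> t _; ring.
rewrite (eq_seg_integral (h := fun y => F (pt b y) + _ - _)
  (k := fun y => (F (pt b y) - F (pt a y)) + (G (pt b y) - G (pt a y)))); last first.
  by move=> t _; ring.
rewrite (seg_integralD hF hG).
rewrite (seg_integralD vF vG).
by ring.
Qed.

Lemma rect_integralZ (u : C) F : continuous_boundary F a b c d ->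
  rect_integral (fun z => u * F z) a b c d = u * rect_integral F a b c d.
Proof.
move=> /continuous_pairs[hF vF]; rewrite /rect_integral.
rewrite (eq_seg_integral (k := fun x => u * (F (pt x c) - F (pt x d)))); last first.
  by move=> t _; ring.
rewrite (eq_seg_integral (h := fun y => u * F (pt b y) - _)
  (k := fun y => u * (F (pt b y) - F (pt a y)))); last first.
  by move=> t _; ring.
rewrite (seg_integralZ _ hF) (seg_integralZ _ vF).
by ring.
Qed.

Lemma rect_integral_affine (u v : C) : rect_integral (fun z => u + v * z) a b c d = 0.
Proof.
rewrite /rect_integral (eq_seg_integral (k := fun=> v * 'i * (c - d)%:C)); last first.
  move=> t _; rewrite [LHS](_ : _ = v * (pt t c - pt t d)); last by ring.
  by rewrite ptB subrr pt0r mulrA.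
rewrite (eq_seg_integral (h := fun y => u + v * pt b y - _) (k := fun=> v * (b - a)%:C)); last first.
  move=> t _; rewrite [LHS](_ : _ = v * (pt b t - pt a t)); last by ring.
  by rewrite ptB subrr ptl0.
by rewrite !seg_integral_cst // !rmorphB /=; ring.
Qed.

Lemma rect_integral_bound F M : continuous_boundary F a b c d ->
  (forall z, on_boundary a b c d z -> nm (F z) <= M) ->
  nm (rect_integral F a b c d) <= 4 * M * ((b - a) + (d - c)).
Proof.
move=> /continuous_pairs[hF vF] FM; apply: le_trans (nmD _ _) _; rewrite nmM.
rewrite nm_i.
have h1 : nm (seg_integral (fun x => F (pt x c) - F (pt x d)) a b) <= 2 * (2 * M) * (b - a).
  apply: seg_integral_bound => //.
  move=> t tab; apply: le_trans (nmBD _ _) _; rewrite mulr2n mulrDl mul1r.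
  by apply: lerD; apply: FM; split=> //; [constructor 3|constructor 4].
have h2 : nm (seg_integral (fun y => F (pt b y) - F (pt a y)) c d) <= 2 * (2 * M) * (d - c).
  apply: seg_integral_bound => //.
  move=> t tab; apply: le_trans (nmBD _ _) _; rewrite mulr2n mulrDl mul1r.
  by apply: lerD; apply: FM; split=> //; [constructor 2|constructor 1].
by lra.
Qed.

End Fixed.

Lemma continuous_seg_cat (h : R -> C) a b m : continuous_seg h a m ->
  continuous_seg h m b -> continuous_seg h a b.
Proof.
move=> h1 h2 t /andP[ta tb]; have [tm|/ltW tm] := leP t m.
  by apply: h1; rewrite ta tm.
by apply: h2; rewrite tm tb.
Qed.

Lemma rect_integral_splitx F a b c d m : a <= m <= b -> c <= d ->
  continuous_boundary F a m c d -> continuous_boundary F m b c d ->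
  rect_integral F a b c d = rect_integral F a m c d + rect_integral F m b c d.
Proof.
move=> /andP[am mb] cd c1 c2.
have [hc1 hd1 va vm] := continuous_edges am cd c1.
have [hc2 hd2 _ vb] := continuous_edges mb cd c2.
rewrite /rect_integral (seg_integral_cat am mb); last first.
  exact: continuous_seg_cat (continuous_segB hc1 hd1) (continuous_segB hc2 hd2).
rewrite (eq_seg_integral (h := fun y => F (pt b y) - F (pt a y))
  (k := fun y => (F (pt b y) - F (pt m y)) + (F (pt m y) - F (pt a y)))); last first.
  by move=> t _; ring.
by rewrite (seg_integralD (continuous_segB vb vm) (continuous_segB vm va)); ring.
Qed.

Lemma rect_integral_splity F a b c d m : a <= b -> c <= m <= d ->
  continuous_boundary F a b c m -> continuous_boundary F a b m d ->
  rect_integral F a b c d = rect_integral F a b c m + rect_integral F a b m d.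
Proof.
move=> ab /andP[cm md] c1 c2.
have [hc hm va1 vb1] := continuous_edges ab cm c1.
have [_ hd va2 vb2] := continuous_edges ab md c2.
rewrite /rect_integral (seg_integral_cat cm md); last first.
  exact: continuous_seg_cat (continuous_segB vb1 va1) (continuous_segB vb2 va2).
rewrite (eq_seg_integral (h := fun y => F (pt y c) - F (pt y d))
  (k := fun y => (F (pt y c) - F (pt y m)) + (F (pt y m) - F (pt y d)))); last first.
  by move=> t _; ring.
by rewrite (seg_integralD (continuous_segB hc hm) (continuous_segB hm hd)); ring.
Qed.
End Rectangles.

(** * Goursat's lemma *)

Section Goursat.
Context {R : realType}.
Local Notation C := (R[i]^o).
Implicit Types (F G : C -> C) (a b c d e x y : R) (z w : C).

(** Complex differentiability, written as a first order estimate. *)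
Definition cdiff F z := exists L : C, forall e, 0 < e ->
  exists2 d, 0 < d & forall w, nm (w - z) < d ->
    nm (F w - (F z + L * (w - z))) <= e * nm (w - z).

Lemma differentiable_cdiff F z : differentiable F z -> cdiff F z.
Proof.
move=> /derivable1_diffP dF; exists ('D_1 F z) => e e0.
have /cvg_nmP/(_ e e0) := dF.
rewrite near_withinE => /nbhs_nmP[d d0 dP]; exists d => // w wd.
have [->|wz] := eqVneq w z; first by rewrite subrr mulr0 addr0 subrr !nm0 mulr0.
have wz0 : w - z != 0 by rewrite subr_eq0.
have := dP (w - z); rewrite subr0 => /(_ wd wz0) /=.
rewrite [(w - z)%:A](_ : _ = w - z); last exact: mulr1.
rewrite subrK => /ltW.
have aux (u v D q : R[i]) : u != 0 -> q = u^-1 * v -> v - D * u = u * (q - D).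
  by move=> u0 ->; field.
rewrite opprD addrA (aux _ _ _ _ wz0 erefl).
by rewrite nmM mulrC; apply: ler_wpM2r; exact: nm_ge0.
Qed.

Lemma cdiff_continuous F z : cdiff F z -> {for z, continuous F}.
Proof.
move=> [L FL]; apply/continuous_nmP => e e0.
have [d d0 dP] := FL 1 ltr01; have M0 : 0 < nm L + 1 by have := nm_ge0 L; lra.
exists (Num.min d (e / (nm L + 1))); first by rewrite lt_min d0 divr_gt0.
move=> w; rewrite lt_min ltr_pdivlMr // => /andP[/dP wd we].
have := nmD (F w - (F z + L * (w - z))) (L * (w - z)).
have -> : F w - (F z + L * (w - z)) + L * (w - z) = F w - F z by ring.
rewrite nmM; lra.
Qed.

Lemma cdiff_local F G z e : 0 < e -> (forall w, nm (w - z) < e -> F w = G w) ->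
  cdiff F z -> cdiff G z.
Proof.
move=> e0 FG [L FL]; exists L => e' /FL[d d0 dP].
exists (Num.min d e); first by rewrite lt_min d0 e0.
move=> w; rewrite lt_min => /andP[wd we].
by rewrite -!FG //; [exact: dP|rewrite subrr nm0].
Qed.

(** The supremum of the left ends lies in all segments. *)
Lemma nested_segments (I : nat -> R * R) :
  (forall n, (I n).1 <= (I n).2) ->
  (forall n, (I n).1 <= (I n.+1).1 /\ (I n.+1).2 <= (I n).2) ->
  exists x, forall n, (I n).1 <= x <= (I n).2.
Proof.
move=> I12 Inest.
have lo m n : (m <= n)%N -> (I m).1 <= (I n).1.
  move=> /subnK <-; elim: (n - m)%N => // k; rewrite addSn => /le_trans; apply.
  by have [] := Inest (k + m)%N.
have up m n : (m <= n)%N -> (I n).2 <= (I m).2.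
  move=> /subnK <-; elim: (n - m)%N => // k; rewrite addSn; apply: le_trans.
  by have [] := Inest (k + m)%N.
have lu m n : (I m).1 <= (I n).2.
  apply: le_trans (lo m _ (leq_maxl m n)) _; apply: le_trans (I12 _) _.
  exact: up (leq_maxr m n).
exists (sup (range (fun n => (I n).1))) => n; apply/andP; split.
  apply: ub_le_sup; last by exists n.
  by exists (I 0%N).2 => _ [m _ <-]; exact: lu.
by apply: ge_sup; [exists (I 0%N).1, 0%N|move=> _ [m _ <-]; exact: lu].
Qed.

Definition half (l : bool) (I : R * R) : R * R :=
  if l then (I.1, (I.1 + I.2) / 2) else ((I.1 + I.2) / 2, I.2).

Lemma half_sub l I : I.1 <= I.2 ->
  [/\ I.1 <= (half l I).1, (half l I).2 <= I.2,
      (half l I).1 <= (half l I).2 & (half l I).2 - (half l I).1 = (I.2 - I.1) / 2].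
Proof. by case: I l => u v [] /= uv; split; lra. Qed.

Let rintI F I J := rect_integral F I.1 I.2 J.1 J.2.
Let size (I J : R * R) := (I.2 - I.1) + (J.2 - J.1).
Let bad e F I J := e * size I J ^+ 2 < nm (rintI F I J).

Let quarter_bad e F I J : I.1 <= I.2 -> J.1 <= J.2 ->
  (forall z, in_rect I.1 I.2 J.1 J.2 z -> {for z, continuous F}) ->
  bad e F I J -> exists k : bool * bool, bad e F (half k.1 I) (half k.2 J).
Proof.
case: I J => a b [c d] /= ab cd cF badF; apply: contrapT => nbad.
have good k l : nm (rintI F (half k (a, b)) (half l (c, d))) <=
    e * (size (a, b) (c, d) / 2) ^+ 2.
  rewrite leNgt; apply/negP => lt_k; apply: nbad; exists (k, l).
  rewrite /bad /= (_ : size _ _ = size (a, b) (c, d) / 2) //.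
  have [_ _ _] := @half_sub k (a, b) ab; have [_ _ _] := @half_sub l (c, d) cd.
  by rewrite /size /=; lra.
have bF a' b' c' d' : a <= a' -> b' <= b -> c <= c' -> d' <= d ->
    continuous_boundary F a' b' c' d'.
  by move=> ? ? ? ? z [[/andP[? ?] /andP[? ?]] _]; apply: cF; split; apply/andP; split; lra.
move: badF; rewrite /bad /rintI /=.
rewrite (@rect_integral_splitx _ F a b c d ((a + b) / 2));
  [|by apply/andP; split; lra|by []|by apply: bF; lra|by apply: bF; lra].
do 2 (rewrite (@rect_integral_splity _ F _ _ c d ((c + d) / 2));
  [|by lra|by apply/andP; split; lra|by apply: bF; lra|by apply: bF; lra]).
move: (good true true) (good true false) (good false true) (good false false).
rewrite /rintI /=; set r1 := rect_integral _ _ _ _ _; set r2 := rect_integral _ _ _ _ _.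
set r3 := rect_integral _ _ _ _ _; set r4 := rect_integral _ _ _ _ _ => g1 g2 g3 g4.
rewrite ltNge => /negP; apply.
have {bF cF} n4 : nm (r1 + r2 + (r3 + r4)) <= (nm r1 + nm r2) + (nm r3 + nm r4).
  by apply: le_trans (nmD _ _) _; rewrite lerD // nmD.
apply: le_trans n4 _; apply: le_trans (lerD (lerD g1 g2) (lerD g3 g4)) _.
by rewrite le_eqVlt; apply/orP; left; apply/eqP; field.
Qed.

Lemma in_rect_dist a b c d z w : in_rect a b c d z -> in_rect a b c d w ->
  nm (w - z) <= (b - a) + (d - c).
Proof.
move=> [/andP[? ?] /andP[? ?]] [/andP[? ?] /andP[? ?]].
apply: le_trans (nm_le_ReIm _) _; apply: lerD.
  have -> : complex.Re (w - z) = complex.Re w - complex.Re z by case: (w) (z) => ? ? [].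
  by rewrite ler_norml; apply/andP; split; lra.
have -> : complex.Im (w - z) = complex.Im w - complex.Im z by case: (w) (z) => ? ? [].
by rewrite ler_norml; apply/andP; split; lra.
Qed.

(** If the integral is not 0, some [e > 0] satisfies [bad e]: the modulus of
    the integral exceeds [e] times the square of half the perimeter.
    Both quantities are compatible with quartering, so that one of the
    quarters is bad again.  The nested bad rectangles obtained in this way
    shrink to a point, near which F is affine up to a small error; this
    contradicts [bad e], as affine functions have integral 0. *)
Theorem goursat F a b c d : a <= b -> c <= d ->
  (forall z, in_rect a b c d z -> cdiff F z) -> rect_integral F a b c d = 0.
Proof.
move=> ab cd dF; apply/eqP; rewrite -nm_eq0; apply: contrapT => /negP nz.
have rpos : 0 < nm (rect_integral F a b c d) by rewrite lt_def nz nm_ge0.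
(* adding 1 makes the denominator positive for degenerate rectangles as well *)
pose e := nm (rect_integral F a b c d) / (size (a, b) (c, d) ^+ 2 + 1).
have S0 : 0 < size (a, b) (c, d) ^+ 2 + 1 by have := sqr_ge0 (size (a, b) (c, d)); lra.
have e0 : 0 < e by rewrite divr_gt0.
have bad0 : bad e F (a, b) (c, d).
  rewrite /bad /rintI /=.
  have : e * (size (a, b) (c, d) ^+ 2 + 1) = nm (rect_integral F a b c d) by rewrite divfK // gt_eqF.
  by rewrite mulrDr mulr1; set S := _ ^+ 2; lra.
pose step (Q : (R * R) * (R * R)) :=
  if [pick k : bool * bool | `[< bad e F (half k.1 Q.1) (half k.2 Q.2) >]] is Some k
  then (half k.1 Q.1, half k.2 Q.2) else Q.
pose Q n := iter n step ((a, b), (c, d)).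
have QS n : Q n.+1 = step (Q n) by [].
have inv n : [/\ bad e F (Q n).1 (Q n).2, (Q n).1.1 <= (Q n).1.2, (Q n).2.1 <= (Q n).2.2,
    a <= (Q n).1.1 /\ (Q n).1.2 <= b & c <= (Q n).2.1 /\ (Q n).2.2 <= d].
  elim: n => [|n [bn l1 l2 [l3 l4] [l5 l6]]]; first by split.
  rewrite QS /step; case: pickP => [k /asboolP bk|nk]; last by split.
  have [h1 h2 h3 _] := half_sub k.1 l1; have [h4 h5 h6 _] := half_sub k.2 l2.
  split => //=; split; [exact: le_trans h1|exact: le_trans h2 _|exact: le_trans h4|exact: le_trans h5 _].
have stepP n : exists k : bool * bool, Q n.+1 = (half k.1 (Q n).1, half k.2 (Q n).2).
  rewrite QS /step; case: pickP => [k _|nk]; first by exists k.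
  have [bn l1 l2 [l3 l4] [l5 l6]] := inv n.
  have [|k bk] := quarter_bad l1 l2 _ bn; last by have /asboolP := nk k.
  by move=> z zin; apply/cdiff_continuous/dF; exact: in_rectW zin.
have [|n|x xP] := @nested_segments (fun n => (Q n).1); first by move=> n; have [] := inv n.
  have [_ l1 _ _ _] := inv n; have [k ->] := stepP n.
  by have [? ?] := half_sub k.1 l1.
have [|n|y yP] := @nested_segments (fun n => (Q n).2); first by move=> n; have [] := inv n.
  have [_ _ l1 _ _] := inv n; have [k ->] := stepP n.
  by have [? ?] := half_sub k.2 l1.
have sizeQ n : size (Q n).1 (Q n).2 = size (a, b) (c, d) / 2 ^+ n.
  elim: n => [|n IH]; first by rewrite expr0 divr1.
  have [_ l1 l2 _ _] := inv n; have [k ->] := stepP n.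
  have [_ _ _ h1] := half_sub k.1 l1; have [_ _ _ h2] := half_sub k.2 l2.
  rewrite {1}/size h1 h2 -mulrDl -/(size _ _) IH exprS invfM.
  by rewrite -!mulrA; congr (_ * _); rewrite mulrC.
have [|L FL] := dF (pt x y).
  by have := xP 0%N; have := yP 0%N; split.
have e40 : 0 < e / 4 by lra.
have [dl dl0 FLd] := FL _ e40.
have [n Qn] : exists n, size (Q n).1 (Q n).2 < dl.
  have := @cvg_geometric R (size (a, b) (c, d)) 2^-1.
  rewrite gtr0_norm ?invr_gt0 // => /(_ ltac:(lra)) /cvgrPdist_lt /(_ _ dl0) [n _ /(_ n (leqnn n))].
  rewrite sub0r normrN /geometric /= => h; exists n; rewrite sizeQ -exprVn.
  exact: le_lt_trans (ler_norm _) h.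
have [bn l1 l2 [l3 l4] [l5 l6]] := inv n; move: bn; rewrite /bad /rintI.
set I := (Q n).1 in l1 l3 l4 *; set J := (Q n).2 in l2 l5 l6 *.
have zin : in_rect I.1 I.2 J.1 J.2 (pt x y) by split; [exact: xP|exact: yP].
have cF : continuous_boundary F I.1 I.2 J.1 J.2.
  by move=> z [zin' _]; apply/cdiff_continuous/dF; exact: in_rectW zin'.
pose A (z : C) : C := (F (pt x y) - L * pt x y) + L * z.
have cA (u v : C) : continuous_boundary (fun z : C => u + v * z) I.1 I.2 J.1 J.2.
  move=> z _; apply: continuousD; first exact: cst_continuous.
  by apply: continuousM; [exact: cst_continuous|exact: cvg_id].
have cAA : continuous_boundary A I.1 I.2 J.1 J.2 by exact: cA.
have cFA : continuous_boundary (fun z => F z - A z) I.1 I.2 J.1 J.2.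
  by move=> z zin'; apply: continuousB; [exact: cF|exact: cAA zin'].
have FA : F = (fun z => (F z - A z) + A z) by apply/funext => z; rewrite subrK.
have A0 : rect_integral A I.1 I.2 J.1 J.2 = 0 by exact: rect_integral_affine.
have -> : rect_integral F I.1 I.2 J.1 J.2 = rect_integral (fun z => F z - A z) I.1 I.2 J.1 J.2.
  by rewrite {1}FA (rect_integralD l1 l2 cFA cAA) A0 addr0.
have := @rect_integral_bound _ _ _ _ _ l1 l2 _ (e / 4 * size I J) cFA.
have -> : 4 * (e / 4 * size I J) * (I.2 - I.1 + (J.2 - J.1)) = e * size I J ^+ 2.
  by rewrite -/(size I J); lra.
move=> /(_ _) h; apply/negP; rewrite -leNgt; apply: h => z [zin' _].
have zd : nm (z - pt x y) <= size I J by apply: in_rect_dist.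
have -> : F z - A z = F z - (F (pt x y) + L * (z - pt x y)) by rewrite /A; ring.
apply: le_trans (FLd _ (le_lt_trans zd Qn)) _.
by rewrite ler_wpM2l //; lra.
Qed.
End Goursat.

(** * Deformation of contours *)

Section Cauchy.
Context {R : realType}.
Local Notation C := (R[i]^o).
Implicit Types (F G g : C -> C) (a b c d e x y r B : R) (z w : C).

(** The closure of the difference of the two rectangles is cut into
    four rectangles on which Goursat's lemma applies. *)
Lemma rect_integral_shrink F a b c d a' b' c' d' : a <= a' -> a' <= b' -> b' <= b ->
  c <= c' -> c' <= d' -> d' <= d ->
  (forall z, in_rect a b c d z ->
     ~ (a' < complex.Re z < b' /\ c' < complex.Im z < d') -> cdiff F z) ->
  rect_integral F a b c d = rect_integral F a' b' c' d'.
Proof.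
move=> aa ab bb cc cd dd dF.
have cB p q s t : a <= p -> q <= b -> c <= s -> t <= d ->
    p <= a' \/ b' <= p -> q <= a' \/ b' <= q \/ t <= c' \/ d' <= s ->
    s <= c' \/ d' <= s \/ b' <= p \/ q <= a' ->
    t <= c' \/ d' <= t \/ b' <= p \/ q <= a' ->
    continuous_boundary F p q s t.
  move=> ap qb cs td h1 h2 h3 h4 z [[/andP[z1 z2] /andP[z3 z4]] zb].
  apply/cdiff_continuous/dF; first by split; apply/andP; split; lra.
  move=> [/andP[z5 z6] /andP[z7 z8]].
  by case: zb => zb; move: h1 h2 h3 h4; rewrite -?zb; lra.
have dF0 p q s t : p <= q -> s <= t -> a <= p -> q <= b -> c <= s -> t <= d ->
    q <= a' \/ b' <= p \/ t <= c' \/ d' <= s -> rect_integral F p q s t = 0.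
  move=> pq st ap qb cs td h; apply: goursat => // z [/andP[z1 z2] /andP[z3 z4]].
  apply: dF; first by split; apply/andP; split; lra.
  by move=> [/andP[z5 z6] /andP[z7 z8]]; lra.
rewrite (@rect_integral_splitx _ F a b c d a'); [|lra|lra|by apply: cB; lra|by apply: cB; lra].
rewrite [X in X + _]dF0 ?add0r; [|lra..].
rewrite (@rect_integral_splitx _ F a' b c d b'); [|lra|lra|by apply: cB; lra|by apply: cB; lra].
rewrite [X in _ + X]dF0 ?addr0; [|lra..].
rewrite (@rect_integral_splity _ F a' b' c d c'); [|lra|lra|by apply: cB; lra|by apply: cB; lra].
rewrite [X in X + _]dF0 ?add0r; [|lra..].
rewrite (@rect_integral_splity _ F a' b' c' d d'); [|lra|lra|by apply: cB; lra|by apply: cB; lra].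
by rewrite [X in _ + X]dF0 ?addr0; [|lra..].
Qed.

Lemma eq_rect_integral F G a b c d : a <= b -> c <= d ->
  (forall z, on_boundary a b c d z -> F z = G z) -> rect_integral F a b c d = rect_integral G a b c d.
Proof.
move=> ab cd FG; have hyp x y : in_rect a b c d (pt x y) -> [\/ x = a, x = b, y = c | y = d] ->
    F (pt x y) = G (pt x y) by move=> ? ?; apply: FG; split.
rewrite /rect_integral; congr (_ + 'i * _); apply: eq_seg_integral => t tab.
  by rewrite !hyp //; [split|constructor 4|split|constructor 3]; rewrite /= ?lexx ?cd.
by rewrite !hyp //; [split|constructor 1|split|constructor 2]; rewrite /= ?lexx ?ab.
Qed.

Lemma cdiff_inv_shift z w : w != z -> cdiff (fun w : C => (w - z)^-1) w.
Proof.
move=> wz; apply/differentiable_cdiff/derivable1_diffP.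
apply: (@derivableV _ _ (fun w : C => w - z)); first by rewrite subr_eq0.
by apply: derivableB; [exact: derivable_id|exact: derivable_cst].
Qed.

Lemma continuous_inv_shift z w : w != z -> {for w, continuous (fun w : C => (w - z)^-1 : C)}.
Proof. by move=> wz; apply/cdiff_continuous/cdiff_inv_shift. Qed.

Definition diff_quotient g (L z w : C) : C := if w == z then L else (g w - g z) * (w - z)^-1.

Lemma cdiff_diff_quotient g L z w : differentiable g w -> w != z -> cdiff (diff_quotient g L z) w.
Proof.
move=> dg wz; have w0 : 0 < nm (w - z) by rewrite nm_gt0 subr_eq0.
apply: (@cdiff_local _ (fun w : C => (g w - g z) * (w - z)^-1 : C) _ _ _ w0).
  move=> v vw; rewrite /diff_quotient; case: eqVneq => // vz.
  by move: vw; rewrite vz nmB ltxx.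
apply/differentiable_cdiff/derivable1_diffP; apply: derivableM.
  by apply: derivableB; [apply/derivable1_diffP|exact: derivable_cst].
apply: (@derivableV _ _ (fun w : C => w - z)); first by rewrite subr_eq0.
by apply: derivableB; [exact: derivable_id|exact: derivable_cst].
Qed.

(** With the derivative of [g] as the value at [z], the first order estimate
    bounds the quotient near [z]. *)
Lemma bound_diff_quotient g z : differentiable g z -> exists L M e,
  [/\ 0 < e, 0 <= M & forall w, nm (w - z) < e -> nm (diff_quotient g L z w) <= M].
Proof.
move=> /differentiable_cdiff[L gL]; have [e e0 eP] := gL 1 ltr01.
exists L, (nm L + 1), e; split=> //; first by rewrite addr_ge0 ?nm_ge0.
move=> w we; rewrite /diff_quotient; case: eqVneq => [_|wz]; first by rewrite lerDl.
rewrite nmM nmV ler_pdivrMr ?nm_gt0 ?subr_eq0 //.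
have := nmD (g w - (g z + L * (w - z))) (L * (w - z)).
have -> : g w - (g z + L * (w - z)) + L * (w - z) = g w - g z by ring.
by have := eP w we; rewrite nmM; lra.
Qed.

Definition square_integral F (rho : R) : C := rect_integral F (- rho) rho (- rho) rho.

(** The contour can be shrunk to small squares around [z], over
    which the integral of a bounded function tends to 0. *)
Lemma square_integral_diff_quotient g z rho : (forall w, differentiable g w) -> nm z < rho ->
  exists L, square_integral (diff_quotient g L z) rho = 0.
Proof.
move=> dg zr; have [L [M [e [e0 M0 eP]]]] := bound_diff_quotient (dg z).
exists L; apply/eqP; rewrite -nm_eq0; apply/eqP/le_anti; rewrite nm_ge0 andbT.
apply/ler_addgt0Pl => d d0; rewrite addr0.
have [zR zI] : - rho < complex.Re z < rho /\ - rho < complex.Im z < rho.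
  by rewrite -!ltr_norml; split; apply: le_lt_trans zr; [exact: Re_le_nm|exact: Im_le_nm].
(* m is small enough for the square around z of half-side m to stay inside the
   contour and in the disc of radius e, and for the final estimate 16 M m <= d *)
pose m := \big[Num.min/1]_(x <- [:: rho - complex.Re z; rho + complex.Re z;
  rho - complex.Im z; rho + complex.Im z; e / 3; d / (16 * (M + 1))]) x.
have m0 : 0 < m.
  rewrite /m !big_cons big_nil !lt_min ltr01 !divr_gt0 ?mulr_gt0 //; try lra.
have : m <= m by [].
rewrite {2}/m !big_cons big_nil !le_min => /and5P[m1 m2 m3 m4 /and3P[m5 m6 _]].
rewrite /square_integral (@rect_integral_shrink _ _ _ _ _ (complex.Re z - m) (complex.Re z + m)
  (complex.Im z - m) (complex.Im z + m)); try lra; last first.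
  move=> w _ wz; apply: cdiff_diff_quotient => //; apply: contra_notN wz => /eqP ->.
  by split; apply/andP; split; lra.
have zin w : in_rect (complex.Re z - m) (complex.Re z + m) (complex.Im z - m)
    (complex.Im z + m) w -> nm (w - z) < e.
  move=> [/andP[? ?] /andP[? ?]]; apply: le_lt_trans (nm_le_ReIm _) _.
  have -> : complex.Re (w - z) = complex.Re w - complex.Re z by case: (w) (z) => ? ? [].
  have -> : complex.Im (w - z) = complex.Im w - complex.Im z by case: (w) (z) => ? ? [].
  apply: (@le_lt_trans _ _ (m + m)); last by lra.
  by rewrite lerD // ler_norml; apply/andP; split; lra.
apply: le_trans (@rect_integral_bound _ _ _ _ _ _ _ _ M _ _) _; try lra.
- move=> w [win wb]; apply/cdiff_continuous/cdiff_diff_quotient => //; apply/eqP => wz.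
  by move: wb; rewrite wz; case; lra.
- by move=> w [win _]; apply/eP/zin.
- move: m6; rewrite ler_pdivlMr ?mulr_gt0 //; try lra.
Qed.
End Cauchy.

(** * Cauchy's formula and Taylor expansion on a disc *)

Section CauchyFormula.
Context {R : realType}.
Local Notation C := (R[i]^o).
Implicit Types (F G g : C -> C) (a b c d e x y r B rho : R) (z w : C).

Lemma boundary_square rho w : 0 < rho -> on_boundary (- rho) rho (- rho) rho w ->
  rho <= nm w <= 2 * rho.
Proof.
move=> r0 [[/andP[? ?] /andP[? ?]] wb]; apply/andP; split.
  have := Re_le_nm w; have := Im_le_nm w.
  by case: wb => ->; rewrite ?normrN (gtr0_norm r0).
apply: le_trans (nm_le_ReIm _) _; rewrite mulr2n mulrDl mul1r.
by apply: lerD; rewrite ler_norml; apply/andP; split; lra.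
Qed.

Lemma square_integral_bound F rho M : 0 < rho ->
  continuous_boundary F (- rho) rho (- rho) rho ->
  (forall w, rho <= nm w <= 2 * rho -> nm (F w) <= M) ->
  nm (square_integral F rho) <= 16 * M * rho.
Proof.
move=> r0 cF FM; apply: le_trans (@rect_integral_bound _ _ _ _ _ _ _ _ M cF _) _; try lra.
by move=> w /(boundary_square r0); exact: FM.
Qed.

(** The value is 2 i pi for [nm z < rho].  The proof of Cauchy's formula rests
    on its independence of [z] and on a positive lower bound for its modulus. *)
Definition kappa z rho := square_integral (fun w => (w - z)^-1) rho.

Lemma boundary_neq rho z w : nm z < rho -> on_boundary (- rho) rho (- rho) rho w -> w != z.
Proof.
move=> zr wb; have r0 : 0 < rho by apply: le_lt_trans zr; exact: nm_ge0.
by apply: contraTneq zr => <-; rewrite -leNgt; have /andP[] := boundary_square r0 wb.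
Qed.

Lemma kappa_grow z rho rho' : nm z < rho -> rho <= rho' -> kappa z rho' = kappa z rho.
Proof.
move=> zr rr; have r0 : 0 < rho by apply: le_lt_trans zr; exact: nm_ge0.
rewrite /kappa /square_integral; apply: rect_integral_shrink; try lra.
move=> w _ wo; apply: cdiff_inv_shift; apply: contra_notN wo => /eqP ->.
by rewrite -!ltr_norml; split; apply: le_lt_trans zr; [exact: Re_le_nm|exact: Im_le_nm].
Qed.

(** The contour can be enlarged without changing either value, and
    1/(w - z) - 1/w = z/(w (w - z)) has order 1/w^2 while the length of the
    contour has order w. *)
Lemma kappa_indep z rho : nm z < rho -> kappa z rho = kappa 0 rho.
Proof.
move=> zr; have r0 : 0 < rho by apply: le_lt_trans zr; exact: nm_ge0.
apply/eqP; rewrite -subr_eq0 -nm_eq0; apply/eqP/le_anti; rewrite nm_ge0 andbT.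
apply/ler_addgt0Pl => d d0; rewrite addr0.
(* on the contour of half-side rho' the integrand is at most 2 rho / rho'^2 *)
pose rho' := Num.max (2 * rho) (32 * rho / d).
have r1 : 2 * rho <= rho' by rewrite /rho' le_max lexx.
have r2 : 32 * rho / d <= rho' by rewrite /rho' le_max lexx orbT.
have r0' : 0 < rho' by lra.
have z0' : nm (0 : C) < rho' by rewrite nm0.
rewrite -(@kappa_grow z rho rho') //; last by lra.
rewrite -(@kappa_grow 0 rho rho') ?nm0 //; last by lra.
have cz u : nm u < rho' -> continuous_boundary (fun w : C => (w - u)^-1) (- rho') rho' (- rho') rho'.
  by move=> ur w wb; apply: continuous_inv_shift; exact: boundary_neq wb.
have zr' : nm z < rho' by lra.
rewrite -[X in _ - X]mul1r -mulNr /kappa /square_integral -rect_integralZ; try lra; last exact: cz.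
rewrite -rect_integralD; try lra; [|exact: cz|]; last first.
  by move=> w wb; apply: continuousM; [exact: cst_continuous|exact: cz].
rewrite -/(square_integral _ _).
apply: le_trans (square_integral_bound (M := 2 * rho / rho' ^+ 2) r0' _ _) _.
- move=> w wb; apply: continuousD; first exact: cz.
  by apply: continuousM; [exact: cst_continuous|exact: cz].
- move=> w /andP[w1 w2].
  have w0 : w != 0 by rewrite -nm_gt0; lra.
  have wz : rho' / 2 <= nm (w - z).
    by have := nmD (w - z) z; rewrite subrK; lra.
  have wz0 : w - z != 0 by rewrite -nm_gt0; lra.
  have -> : (w - z)^-1 + -1 * (w - 0)^-1 = z * (w^-1 * (w - z)^-1) by rewrite subr0; field; rewrite wz0 w0.
  rewrite !nmM !nmV -invfM ler_pdivrMr; last by rewrite mulr_gt0 // ?nm_gt0.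
  rewrite mulrAC ler_pdivlMr; last by rewrite exprn_gt0.
  apply: (@le_trans _ _ (rho * rho' ^+ 2)); first by rewrite ler_wpM2r ?sqr_ge0 // ltW.
  have : rho' * (rho' / 2) <= nm w * nm (w - z) by apply: ler_pM; lra.
  move=> /(ler_wpM2l (ltW r0)); lra.
- have -> : 16 * (2 * rho / rho' ^+ 2) * rho' = 32 * rho / rho' by field; lra.
  by move: r2; rewrite !ler_pdivrMr // (mulrC d).
Qed.

(** On opposite edges the values of 1/w combine to i phi and to phi, where
    phi(t) = 2 rho/(rho^2 + t^2).  This is real and at least 1/rho, so that
    its integral over [-rho, rho] is at least 2. *)
Lemma kappa_ge rho : 0 < rho -> 4 <= nm (kappa 0 rho).
Proof.
move=> r0; pose phi t : C := (2 * rho / (rho ^+ 2 + t ^+ 2))%:C.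
have den t : rho ^+ 2 + t ^+ 2 != 0.
  by rewrite gt_eqF // ltr_wpDr ?sqr_ge0 // exprn_gt0.
have den' (t : R) : ((rho ^+ 2 + t ^+ 2)%:C : R[i]) != 0.
  by apply: contra (den t) => /eqP[->].
have sqD (t : R) : (rho%:C ^+ 2 + t%:C ^+ 2 : R[i]) = (rho ^+ 2 + t ^+ 2)%:C.
  by rewrite rmorphD !rmorphXn.
have i2 := @sqr_i R.
have ptE x y : pt x y = (x%:C + 'i * y%:C)%R :> R[i] by rewrite -pt0r -ptl0 /pt; simpc.
have phiE t : phi t = 2 * rho%:C * ((rho ^+ 2 + t ^+ 2)%:C)^-1.
  by rewrite /phi fmorph_div; congr (_ / _); rewrite rmorphM rmorph_nat.
have rhoN : (- rho)%:C = - rho%:C :> R[i] by rewrite rmorphN.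
have frac_h (u v : R[i]) : u - 'i * v != 0 -> u + 'i * v != 0 ->
    (u - 'i * v)^-1 - (u + 'i * v)^-1 = 'i * (2 * v / ((u - 'i * v) * (u + 'i * v))).
  by move=> d1 d2; field; rewrite d1 d2.
have frac_v (u v : R[i]) : - u + 'i * v != 0 -> u + 'i * v != 0 ->
    (u + 'i * v)^-1 - (- u + 'i * v)^-1 = 2 * u / - ((- u + 'i * v) * (u + 'i * v)).
  by move=> d1 d2; field; rewrite ?oppr_eq0 ?mulf_neq0 ?d1 ?d2.
have phi_h t : (pt t (- rho) - 0)^-1 - (pt t rho - 0)^-1 = 'i * phi t.
  rewrite !subr0 phiE !ptE rhoN mulrN.
  have n1 : (t%:C - 'i * rho%:C : R[i]) * (t%:C + 'i * rho%:C) = (rho ^+ 2 + t ^+ 2)%:C.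
    by rewrite -sqD [LHS](_ : _ = t%:C ^+ 2 - 'i ^+ 2 * rho%:C ^+ 2); [rewrite i2; ring|ring].
  have := den' t; rewrite -n1 mulf_eq0 negb_or => /andP[d1 d2].
  exact: frac_h.
have phi_v t : (pt rho t - 0)^-1 - (pt (- rho) t - 0)^-1 = phi t.
  rewrite !subr0 phiE !ptE rhoN.
  have n1 : (- rho%:C + 'i * t%:C : R[i]) * (rho%:C + 'i * t%:C) = - (rho ^+ 2 + t ^+ 2)%:C.
    by rewrite -sqD [LHS](_ : _ = 'i ^+ 2 * t%:C ^+ 2 - rho%:C ^+ 2); [rewrite i2; ring|ring].
  have := den' t; rewrite -oppr_eq0 -n1 mulf_eq0 negb_or => /andP[d1 d2].
  by rewrite frac_v // n1 opprK.
have cphi : continuous_seg phi (- rho) rho.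
  have -> : phi = (fun t => (pt rho t - 0)^-1 - (pt (- rho) t - 0)^-1) by apply/funext => t.
  have c0 : continuous_boundary (fun w : C => (w - 0)^-1) (- rho) rho (- rho) rho.
    by move=> w wb; apply: continuous_inv_shift; apply: boundary_neq wb; rewrite nm0.
  have rr : - rho <= rho by lra.
  by have [] := continuous_pairs rr rr c0.
have -> : kappa 0 rho = 2 * 'i * seg_integral phi (- rho) rho.
  rewrite /kappa /square_integral /rect_integral.
  rewrite (eq_seg_integral (k := fun t => 'i * phi t)); last by move=> t _.
  rewrite seg_integralZ //.
  rewrite (eq_seg_integral (h := fun y => (pt rho y - 0)^-1 - _) (k := phi)); last by move=> t _.
  by ring.
rewrite !nmM nm_i nm_nat mulr1.
suff : 2 <= complex.Re (seg_integral phi (- rho) rho).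
  have := Re_le_nm (seg_integral phi (- rho) rho).
  by have := ler_norm (complex.Re (seg_integral phi (- rho) rho)); lra.
rewrite /seg_integral /=.
have e2 : \int[@lebesgue_measure R]_(t in `[- rho, rho]) (cst rho^-1) t = 2.
  rewrite Rintegral_cst //= lebesgue_measure_itv /= lte_fin ifT; last by lra.
  by rewrite /= opprK; field; lra.
rewrite -[leLHS]e2; apply: le_Rintegral => //.
- apply: (@integrable_part _ (fun=> rho^-1) (fun=> 0)); last exact: continuous_seg_cst.
  by move=> z w; rewrite subrr normr0 nm_ge0.
- exact: (integrable_part (@Re_lip R) cphi).
- move=> t; rewrite /= in_itv /= => /andP[t1 t2].
  rewrite ler_pdivlMr; last by rewrite lt_def den addr_ge0 ?sqr_ge0.
  rewrite mulrC ler_pdivrMr //.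
  have : t ^+ 2 <= rho ^+ 2.
    by rewrite -ler_sqrt ?exprn_ge0 ?sqrtr_sqr ?(gtr0_norm r0) ?ler_norml ?t1 // ?ltW ?exprn_gt0.
  by lra.
Qed.

Lemma continuous_invX K w : w != 0 -> {for w, continuous (fun w : C => w^-1 ^+ K : C)}.
Proof.
move=> w0; elim: K => [|K IH]; first exact: cst_continuous.
have -> : (fun w : C => w^-1 ^+ K.+1 : C) = (fun w : C => (w - 0)^-1 * w^-1 ^+ K).
  by apply/funext => v; rewrite exprS subr0.
have c1 : {for w, continuous (fun w : C => (w - 0)^-1 : C)} by exact: continuous_inv_shift.
exact: (continuousM c1 IH).
Qed.

Lemma cauchy_formula g z rho : (forall w, differentiable g w) -> nm z < rho ->
  g z * kappa 0 rho = square_integral (fun w => g w * (w - z)^-1) rho.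
Proof.
move=> dg zr; have r0 : 0 < rho by apply: le_lt_trans zr; exact: nm_ge0.
have rr : - rho <= rho by lra.
have [L hL] := square_integral_diff_quotient dg zr.
have ci : continuous_boundary (fun w => (w - z)^-1) (- rho) rho (- rho) rho.
  by move=> w wb; apply: continuous_inv_shift; exact: boundary_neq wb.
have cd : continuous_boundary (diff_quotient g L z) (- rho) rho (- rho) rho.
  by move=> w wb; apply/cdiff_continuous/cdiff_diff_quotient => //; exact: boundary_neq wb.
have ce : continuous_boundary (fun w => g z * (w - z)^-1) (- rho) rho (- rho) rho.
  by move=> w wb; apply: continuousM; [exact: cst_continuous|exact: ci].
rewrite -(kappa_indep zr) /kappa /square_integral -(rect_integralZ rr rr _ ci).
rewrite -[LHS]add0r -hL /square_integral.
rewrite -(rect_integralD rr rr cd ce); apply: eq_rect_integral => // w wb.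
rewrite /diff_quotient (negbTE (boundary_neq zr wb)).
by rewrite -mulrDl subrK.
Qed.

(** The identity 1/(w - z) = 1/w + z/(w (w - z)), iterated K times in
    Cauchy's formula. *)
Lemma cauchy_expansion g z rho K : (forall w, differentiable g w) -> nm z < rho ->
  g z * kappa 0 rho =
  \sum_(k < K) square_integral (fun w => g w * w^-1 ^+ k.+1) rho * z ^+ k +
  z ^+ K * square_integral (fun w => g w * w^-1 ^+ K * (w - z)^-1) rho.
Proof.
move=> dg zr; have r0 : 0 < rho by apply: le_lt_trans zr; exact: nm_ge0.
have rr : - rho <= rho by lra.
have n0 w : on_boundary (- rho) rho (- rho) rho w -> w != 0.
  by apply: boundary_neq; rewrite nm0.
have cg k : continuous_boundary (fun w => g w * w^-1 ^+ k) (- rho) rho (- rho) rho.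
  move=> w wb; apply: continuousM; first exact/cdiff_continuous/differentiable_cdiff.
  by apply: continuous_invX; exact: n0.
have ci k : continuous_boundary (fun w => g w * w^-1 ^+ k * (w - z)^-1) (- rho) rho (- rho) rho.
  move=> w wb; apply: continuousM; first exact: cg.
  by apply: continuous_inv_shift; exact: boundary_neq wb.
elim: K => [|K IH].
  rewrite big_ord0 add0r expr0 mul1r cauchy_formula //.
  by congr square_integral; apply/funext => w; rewrite expr0 mulr1.
rewrite IH big_ord_recr /= -addrA; congr (_ + _).
rewrite exprSr -mulrA [RHS]addrC [_ * z ^+ K]mulrC -mulrDr; congr (_ * _).
rewrite /square_integral -(rect_integralZ rr rr _ (ci _)) -rect_integralD //.
- apply: eq_rect_integral => // w wb; have w0 := n0 _ wb; have wz := boundary_neq zr wb.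
  have wz0 : w - z != 0 by rewrite subr_eq0.
  have aux (x u v q : R[i]) : v - q != 0 -> v != 0 ->
      x * u * (v - q)^-1 = q * (x * (v^-1 * u) * (v - q)^-1) + x * (v^-1 * u).
    by move=> d1 d2; field; rewrite d1 d2.
  by rewrite exprS; exact: aux.
- by move=> w wb; apply: continuousM; [exact: cst_continuous|exact: ci].
Qed.

(** The error depends on [g] only through the bound [B]; this uniformity is
    what allows the other variables to be parameters.  The contour is the
    boundary of the square of half-side 2 r, which lies in the disc of radius
    4 r. *)
Theorem taylor_bound g r B : 0 < r -> (forall w, differentiable g w) ->
  (forall w, nm w <= 4 * r -> nm (g w) <= B) ->
  exists c : nat -> C, forall K z, nm z <= r ->
    nm (g z - \sum_(k < K) c k * z ^+ k) <= 8 * B / 2 ^+ K.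
Proof.
move=> r0 dg gB; pose rho := 2 * r; have rho0 : 0 < rho by rewrite /rho; lra.
have B0 : 0 <= B by apply: le_trans (gB 0 _); rewrite ?nm_ge0 // nm0; lra.
have k4 := kappa_ge rho0; have k0 : kappa 0 rho != 0 by rewrite -nm_gt0; lra.
exists (fun k => square_integral (fun w => g w * w^-1 ^+ k.+1) rho / kappa 0 rho) => K z zr.
have zr' : nm z < rho by rewrite /rho; lra.
have -> : g z = g z * kappa 0 rho / kappa 0 rho by rewrite mulfK.
rewrite (cauchy_expansion K dg zr') mulrDl mulr_suml.
rewrite [X in X + _ - _](eq_bigr (fun k : 'I_K =>
   square_integral (fun w => g w * w^-1 ^+ k.+1) rho / kappa 0 rho * z ^+ k)); last first.
  by move=> k _; rewrite mulrAC.
rewrite addrAC subrr add0r !nmM nmV nmX.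
have rK : nm z ^+ K <= r ^+ K by rewrite lerXn2r ?nnegrE ?nm_ge0 // ltW.
have -> : 8 * B / 2 ^+ K = r ^+ K * (32 * B / rho ^+ K) * 4^-1.
  by rewrite /rho exprMn; field; rewrite !expf_neq0 //; lra.
have sB : nm (square_integral (fun w => g w * w^-1 ^+ K * (w - z)^-1) rho) <= 32 * B / rho ^+ K.
  apply: le_trans (square_integral_bound (M := B / rho ^+ K / r) rho0 _ _) _.
  - move=> w wb; have w0 : w != 0 by apply: boundary_neq wb; rewrite nm0.
    apply: continuousM; last by apply: continuous_inv_shift; exact: boundary_neq wb.
    apply: continuousM; first exact/cdiff_continuous/differentiable_cdiff.
    exact: continuous_invX.
  - move=> w /andP[w1 w2]; have wp : 0 < nm w by lra.
    have wz : r <= nm (w - z) by have := nmD (w - z) z; rewrite subrK /rho in w1 *; lra.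
    rewrite !nmM nmX !nmV exprVn.
    apply: ler_pM; rewrite ?mulr_ge0 ?invr_ge0 ?exprn_ge0 ?nm_ge0 //; last first.
      by rewrite lef_pV2 ?posrE //; lra.
    apply: ler_pM; rewrite ?invr_ge0 ?exprn_ge0 ?nm_ge0 //.
      by apply: gB; move: w2; rewrite /rho; lra.
    by rewrite lef_pV2 ?posrE ?exprn_gt0 // lerXn2r ?nnegrE ?nm_ge0 // ltW.
  - rewrite le_eqVlt; apply/orP; left; apply/eqP; rewrite {2}/rho.
    by field; rewrite expf_neq0 //; lra.
apply: ler_pM; rewrite ?mulr_ge0 ?exprn_ge0 ?invr_ge0 ?nm_ge0 //.
  by apply: ler_pM; rewrite ?exprn_ge0 ?nm_ge0.
by rewrite lef_pV2 ?posrE //; lra.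
Qed.
End CauchyFormula.

(** * Interpolation at roots of unity *)

Section RootsOfUnity.
Context {R : realType}.
Local Notation C := (R[i]^o).

Lemma primitive_root_exists n : (0 < n)%N -> exists w : R[i], n.-primitive_root w.
Proof.
move=> n0; pose p : {poly R[i]} := ('X^n - 1)%R.
have [r Dp] := closed_field_poly_normal p.
rewrite (monicP _) ?monicXnsubC // scale1r in Dp.
have rn1 : all n.-unity_root r by apply/allP => z; rewrite -root_prod_XsubC -Dp.
have sz : (n < (size r).+1)%N by rewrite -(size_prod_XsubC r id) -Dp size_XnsubC.
have [|z] := hasP (cyclic.has_prim_root n0 rn1 _ sz); last by exists z.
by rewrite -separable_prod_XsubC -Dp separable_Xn_sub_1 // pnatr_eq0 -lt0n.
Qed.

Variables (n : nat) (w : C).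
Hypotheses (n0 : (0 < n)%N) (pw : n.-primitive_root (w : R[i])).

Lemma nm_root : nm w = 1.
Proof.
apply: (@pexpIrn _ n n0); rewrite ?nnegrE ?nm_ge0 //.
by rewrite -nmX (prim_expr_order pw) nm1 expr1n.
Qed.

Lemma root_neq0 : w != 0.
Proof. by rewrite -nm_gt0 nm_root. Qed.

(** Orthogonality of the characters of the cyclic group of order n. *)
Lemma sum_root_expr a b : (a < n)%N -> (b < n)%N ->
  \sum_(s < n) (w ^+ s) ^+ a * (w ^+ s) ^- b = (if a == b then n%:R else 0) :> C.
Proof.
move=> an bn; pose x : R[i] := w ^+ a * w ^- b.
have xE (s : 'I_n) : (w ^+ s) ^+ a * (w ^+ s) ^- b = x ^+ s :> R[i].
  by rewrite /x exprMn exprVn -!exprM !(mulnC s).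
rewrite (eq_bigr (fun s : 'I_n => x ^+ s : R[i])) => [|s _]; last exact: xE.
have [ab|ab] := eqVneq a b.
  rewrite (eq_bigr (fun=> 1)) => [|s _].
    by rewrite sumr_const card_ord.
  by rewrite /x ab divff ?expr1n // expf_neq0 // root_neq0.
have xn : x ^+ n = 1.
  by rewrite /x exprMn exprVn -!exprM !(mulnC _ n) !exprM (prim_expr_order pw) !expr1n invr1 mulr1.
have x1 : x - 1 != 0.
  rewrite subr_eq0; apply: contra ab => /eqP x1.
  have : (w : R[i]) ^+ a = w ^+ b.
    by rewrite -[LHS](divfK (expf_neq0 b root_neq0)) -/x x1 mul1r.
  by move=> /eqP; rewrite (eq_prim_root_expr pw) !modn_small.
by apply: (mulfI x1); rewrite mulr0 -subrX1 xn subrr.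
Qed.

Variables (r : R) (r0 : 0 < r).

(** The coefficient of z^k in the polynomial of degree less than n that
    interpolates [g] at the points r w^s: a linear combination of values of [g]. *)
Definition interp_coef (g : C -> C) (k : nat) : C :=
  \sum_(s < n) (n%:R * r%:C ^+ k * (w ^+ s) ^+ k)^-1 * g (r%:C * w ^+ s).

Let nN0 : (n%:R : R[i]) != 0. Proof. by rewrite pnatr_eq0 -lt0n. Qed.
Let rN0 : (r%:C : R[i]) != 0. Proof. by apply/eqP => -[] /eqP; rewrite gt_eqF. Qed.

Lemma interp_coef_poly (c : nat -> C) k : (k < n)%N ->
  interp_coef (fun z => \sum_(l < n) c l * z ^+ l) k = c k.
Proof.
move=> kn; rewrite /interp_coef; under eq_bigr do rewrite mulr_sumr.
rewrite exchange_big /= (bigD1 (Ordinal kn)) //= [X in _ + X]big1 ?addr0.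
  transitivity ((c k / n%:R) * \sum_(s < n) (w ^+ s) ^+ k * (w ^+ s) ^- k).
    rewrite mulr_sumr; apply: eq_bigr => s _.
    rewrite exprMn !invfM.
    have aux (x y z u v : R[i]) : v != 0 -> x * v^-1 * z * (y * (v * u)) = y * x * (u * z).
      by move=> v0; field.
    by apply: aux; rewrite expf_neq0.
  by rewrite sum_root_expr // eqxx divfK.
move=> l lk.
transitivity ((c l * (r%:C ^+ l / (n%:R * r%:C ^+ k))) * \sum_(s < n) (w ^+ s) ^+ l * (w ^+ s) ^- k).
  rewrite mulr_sumr; apply: eq_bigr => s _; rewrite exprMn !invfM.
  have aux (x y z u v t : R[i]) : x * v * z * (y * (t * u)) = y * (t * (x * v)) * (u * z) by ring.
  exact: aux.
by rewrite sum_root_expr // ifN ?mulr0.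
Qed.

Lemma interp_coef_bound g k M : (forall z, nm z <= r -> nm (g z) <= M) ->
  nm (interp_coef g k) <= M / r ^+ k.
Proof.
move=> gM; apply: le_trans (nm_sum _ _ _) _.
apply: (@le_trans _ _ (\sum_(s < n) (n%:R^-1 * (M / r ^+ k)))); last first.
  by rewrite sumr_const card_ord -(mulr_natl (_ * _)) mulrA divff ?mul1r // pnatr_eq0 -lt0n.
apply: ler_sum => s _; rewrite nmM nmV !nmM !nmX nm_root !expr1n mulr1 nm_nat nmC (gtr0_norm r0).
rewrite invfM -mulrA; apply: ler_wpM2l; first by rewrite invr_ge0.
rewrite mulrC; apply: ler_wpM2r; first by rewrite invr_ge0 exprn_ge0 // ltW.
apply: gM.
by rewrite nmM nmX nm_root expr1n mulr1 nmC gtr0_norm.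
Qed.

(** Interpolation reproduces the Taylor polynomial of degree less than n,
    and on the disc of radius r it increases the sup norm by a factor at most n.
    The Taylor error of order 2^-n thus becomes an error of order (n + 1) 2^-n. *)
Lemma interpolation_bound (g : C -> C) (B : R) : (forall z, differentiable g z) ->
  (forall z, nm z <= 4 * r -> nm (g z) <= B) ->
  forall z, nm z <= r ->
  nm (g z - \sum_(k < n) z ^+ k * interp_coef g k) <= 8 * B * (n.+1%:R / 2 ^+ n).
Proof.
move=> dg gB z zr; have [c cP] := taylor_bound r0 dg gB.
pose p (u : C) : C := \sum_(k < n) c k * u ^+ k.
pose e := 8 * B / 2 ^+ n.
have gp u : nm u <= r -> nm (g u - p u) <= e by exact: cP.
have dftE k : (k < n)%N -> interp_coef g k = c k + interp_coef (fun u => g u - p u) k.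
  move=> kn; rewrite -{1}(interp_coef_poly c kn) /interp_coef -big_split /=; apply: eq_bigr => s _.
  by rewrite -mulrDr; congr (_ * _); rewrite addrC subrK.
have -> : g z - \sum_(k < n) z ^+ k * interp_coef g k =
    (g z - p z) - \sum_(k < n) z ^+ k * interp_coef (fun u => g u - p u) k.
  rewrite -addrA -opprD -big_split /=; congr (_ - _); apply: eq_bigr => k _.
  by rewrite dftE // mulrDr [c k * _]mulrC.
apply: le_trans (nmBD _ _) _.
have -> : 8 * B * (n.+1%:R / 2 ^+ n) = e + n%:R * e.
  by rewrite /e mulrSr; ring.
apply: lerD; first exact: gp.
apply: le_trans (nm_sum _ _ _) _.
apply: (@le_trans _ _ (\sum_(s < n) e)); last first.
  by rewrite sumr_const card_ord -(mulr_natl e).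
apply: ler_sum => k _; rewrite nmM nmX.
have e0 : 0 <= e by apply: le_trans (gp 0 _); rewrite ?nm_ge0 // nm0 ltW.
apply: (@le_trans _ _ (r ^+ k * (e / r ^+ k))).
  apply: ler_pM; rewrite ?exprn_ge0 ?nm_ge0 //.
    by rewrite lerXn2r ?nnegrE ?nm_ge0 // ltW.
  exact: interp_coef_bound.
by rewrite mulrC divfK // expf_neq0 // gt_eqF.
Qed.
End RootsOfUnity.

(** * Multi-indices and contractive projections on polynomials *)

Section Multiindices.
Implicit Types (al be : multiindex).

(** Iterations over a support become iterations over a range, which two
    multi-indices can share. *)
Lemma big_finsupp (T : Type) (idx : T) (op : Monoid.com_law idx) al m (F : nat -> T) :
  (forall j, al j = 0%N -> F j = idx) -> (forall j, (m <= j)%N -> al j = 0%N) ->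
  \big[op/idx]_(j <- finsupp al) F j = \big[op/idx]_(j < m) F j.
Proof.
move=> F0 al0; rewrite -(big_mkord xpredT F).
rewrite [RHS](bigID (fun j => j \in finsupp al)) /= [X in op _ X]big1 ?Monoid.mulm1; last first.
  by move=> j; rewrite memNfinsupp => /eqP /F0.
rewrite -[RHS]big_filter; apply: perm_big; apply: uniq_perm.
- exact: fset_uniq.
- by rewrite filter_uniq // iota_uniq.
move=> j; rewrite mem_filter mem_index_iota /=.
case: (boolP (j \in finsupp al)) => //= jal.
rewrite ltnNge; apply/esym/negP => /al0 j0.
by move: jal; rewrite mem_finsupp j0 eqxx.
Qed.

Lemma len_eq0 al j : (len al <= j)%N -> al j = 0%N.
Proof.
move=> lj; apply/eqP; rewrite -memNfinsupp; apply: contraTN lj => jal.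
by rewrite -ltnNge /len; apply: (@leq_bigmax_seq _ _ _ (fun j => j.+1)).
Qed.

Lemma len_last al : (0 < len al)%N -> al (len al).-1 != 0%N.
Proof.
have aux (s : seq nat) : (0 < \max_(j <- s) j.+1)%N ->
    exists2 j, j \in s & (\max_(j <- s) j.+1)%N = j.+1.
  elim: s => [|i s IH]; first by rewrite big_nil.
  rewrite big_cons => _; case: (leqP i.+1 (\max_(j <- s) j.+1)) => h.
    have [|j js jE] := IH; first exact: leq_ltn_trans h.
    by exists j; rewrite ?inE ?js ?orbT // -jE.
  by exists i; rewrite ?inE ?eqxx.
rewrite /len => /aux[j jal ->] /=.
by rewrite -mem_finsupp.
Qed.

Lemma degree_range al m : (len al <= m)%N -> degree al = (\sum_(j < m) al j)%N.
Proof. by move=> lm; apply: big_finsupp => // j mj; apply/len_eq0/(leq_trans lm). Qed.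

(** The first alternative in the square order, a smaller length, is the case
    where the last difference occurs at the last index of [be]. *)
Lemma square_ltE al be : square_lt al be <->
  exists j, (al j < be j)%N /\ forall i, (j < i)%N -> al i = be i.
Proof.
split=> [[ab|[_ //]]|[j [abj abi]]].
  have b0 : (0 < len be)%N by apply: leq_ltn_trans ab.
  exists (len be).-1; split=> [|i bi].
    rewrite [al _]len_eq0 ?lt0n ?len_last //.
    by rewrite -ltnS prednK.
  have lbi : (len be <= i)%N by rewrite -(prednK b0).
  by rewrite !len_eq0 // (leq_trans (ltnW ab)).
have : (len al <= len be)%N.
  rewrite leqNgt; apply/negP => ba.
  have a0 : (0 < len al)%N by apply: leq_ltn_trans ba.
  have bl : be (len al).-1 = 0%N by apply: len_eq0; rewrite -ltnS prednK.
  have := len_last a0; rewrite -lt0n.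
  have [jl|jl] := ltnP j (len al).-1; first by rewrite abi // bl.
  have jb : (len be <= j)%N by apply: leq_trans jl; rewrite -ltnS prednK.
  by move: abj; rewrite [be j]len_eq0.
by rewrite leq_eqVlt => /orP[/eqP ab|ab]; [right; split=> //; exists j|left].
Qed.
End Multiindices.

Lemma big_exclusive (V : nmodType) (I J : finType) (P : pred I) (Q : J -> pred I) (F : I -> V) :
  (forall i j k, Q j i -> Q k i -> j = k) ->
  \sum_(i | P i && [exists j, Q j i]) F i = \sum_j \sum_(i | P i && Q j i) F i.
Proof.
move=> Qu; rewrite (exchange_big_dep P) /=; last by move=> j i _ /andP[].
rewrite big_mkcondr; apply: eq_bigr => i Pi; rewrite Pi /=.
case: existsP => [[j Qj]|nQ].
  by rewrite (bigD1 j) //= big1 ?addr0 // => k /andP[Qk]; rewrite (Qu _ _ _ Qk Qj) eqxx.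
by rewrite big1 // => j Qj; case: nQ; exists j.
Qed.

Section Projections.
Context {R : realType}.
Local Notation C := (R[i]^o).
Implicit Types (al be : multiindex) (z l : nat -> C).

Definition monom al z : C := \prod_(j <- finsupp al) z j ^+ al j.

Lemma monom_range al z m : (len al <= m)%N -> monom al z = \prod_(j < m) z j ^+ al j.
Proof.
move=> lm; apply: (@big_finsupp _ _ *%R) => [j ->|j mj]; first by rewrite expr0.
exact/len_eq0/(leq_trans lm).
Qed.

Lemma monomM al l z : monom al (fun j => l j * z j) = monom al l * monom al z.
Proof. by rewrite /monom -big_split; apply: eq_bigr => j _; rewrite exprMn. Qed.

(** The exponent by which a monomial is multiplied when the j-th coordinate is
    rotated [w j] times. *)
Definition weight (w : nat -> nat) al := (\sum_(j <- finsupp al) al j * w j)%N.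

Lemma monom_weight (x : C) w al : monom al (fun j => x ^+ w j) = x ^+ weight w al.
Proof.
rewrite /monom /weight; elim: (enum_fset _) => [|j s IH]; first by rewrite !big_nil.
by rewrite !big_cons IH exprD exprAC -exprM mulnC exprM exprAC -!exprM mulnC.
Qed.

Definition solid (D : set (nat -> C)) := forall z l, D z ->
  (forall j, nm (l j) <= 1) -> D (fun j => l j * z j).

Definition bounded_on (D : set (nat -> C)) (p : (nat -> C) -> C) (B : R) :=
  forall z, D z -> nm (p z) <= B.

Section Fixed.
Variables (D : set (nat -> C)) (Ds : solid D) (L : nat) (a : nat -> C) (al : nat -> multiindex).

Local Notation part P := (fun z => \sum_(i < L | P i) a i * monom (al i) z).

(** Averaging over the rotations z_j |-> x^(s w_j) z_j, for x a primitive root of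
    unity of an order n beyond all weights and s < n, keeps exactly the monomials
    of weight [c]; a solid set is stable under these rotations. *)
Lemma part_weight (P : pred 'I_L) w c B : bounded_on D (part P) B ->
  bounded_on D (part (fun i => P i && (weight w (al i) == c))) B.
Proof.
move=> PB z Dz; pose n := (c + \max_(i < L) weight w (al i)).+1.
have n0 : (0 < n)%N by [].
have wn (i : 'I_L) : (weight w (al i) < n)%N.
  by rewrite ltnS; apply: leq_trans (leq_addl _ _); exact: leq_bigmax.
have cn : (c < n)%N by rewrite ltnS leq_addr.
have [x px] := @primitive_root_exists R n n0.
have nx := nm_root n0 px.
have -> : \sum_(i < L | P i && (weight w (al i) == c)) a i * monom (al i) z =
    \sum_(s < n) (n%:R)^-1 * (x ^+ s) ^- c * part P (fun j => (x ^+ s) ^+ w j * z j) :> C.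
  under [RHS]eq_bigr do rewrite mulr_sumr.
  rewrite exchange_big /= big_mkcondr /=; apply: eq_bigr => i Pi.
  transitivity (n%:R^-1 * (a i * monom (al i) z) *
      \sum_(s < n) (x ^+ s) ^+ weight w (al i) * (x ^+ s) ^- c : C); last first.
    rewrite mulr_sumr; apply: eq_bigr => s _; rewrite monomM monom_weight.
    have aux (u v t y k : R[i]) : u * (v * t) * (y * k) = u * k * (v * (y * t)) by ring.
    exact: aux.
  rewrite (sum_root_expr n0 px) //; case: eqP => _; last by rewrite mulr0.
  by rewrite mulrAC mulVf ?mul1r // pnatr_eq0.
apply: le_trans (nm_sum _ _ _) _.
apply: (@le_trans _ _ (\sum_(s < n) (n%:R^-1 * B))); last first.
  by rewrite sumr_const card_ord -(mulr_natl (_ * _)) mulrA divff ?mul1r // pnatr_eq0.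
apply: ler_sum => s _; rewrite nmM nmM !nmV !nmX nx !expr1n invr1 mulr1 nm_nat.
apply: ler_wpM2l; first by rewrite invr_ge0.
by apply: PB; apply: Ds => // j; rewrite !nmX nx !expr1n.
Qed.

Lemma part_degree (P : pred 'I_L) c B : bounded_on D (part P) B ->
  bounded_on D (part (fun i => P i && (degree (al i) == c))) B.
Proof.
move=> /(part_weight (fun=> 1%N) c) PB z /PB; congr (nm _ <= _).
apply: eq_bigl => i; congr (_ && (_ == _)).
by rewrite /weight; under eq_bigr do rewrite muln1.
Qed.

Lemma part_coord (P : pred 'I_L) j c B : bounded_on D (part P) B ->
  bounded_on D (part (fun i => P i && (al i j == c))) B.
Proof.
move=> /(part_weight (fun k => (k == j) : nat) c) PB z /PB; congr (nm _ <= _).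
apply: eq_bigl => i; congr (_ && (_ == _)).
rewrite /weight (@big_finsupp _ _ addn _ (maxn (len (al i)) j.+1)).
- have jm : (j < maxn (len (al i)) j.+1)%N by rewrite leq_max leqnn orbT.
  rewrite (bigD1 (Ordinal jm)) //= eqxx muln1 big1 ?addn0 // => k.
  by rewrite -val_eqE /= => /negbTE ->; rewrite muln0.
- by move=> k ->.
- by move=> k; rewrite geq_max => /andP[/len_eq0].
Qed.

Lemma part_coords (P : pred 'I_L) (s : seq nat) be B : bounded_on D (part P) B ->
  bounded_on D (part (fun i => P i && all (fun j => al i j == be j) s)) B.
Proof.
elim: s P => [|j s IH] P PB.
  by move=> z /PB; congr (nm _ <= _); apply: eq_bigl => i; rewrite andbT.
move=> z /(IH _ (part_coord j (be j) PB)); congr (nm _ <= _).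
by apply: eq_bigl => i /=; rewrite andbA.
Qed.
End Fixed.
End Projections.

(** * Partial sums in the square order *)

Section SquareOrder.
Context {R : realType}.
Local Notation C := (R[i]^o).
Implicit Types (z l : nat -> C).

(** The multi-indices before [be] are sorted by the last index [j] where
    they differ from [be] and by the value [k < be j] there; the part for a given
    (j, k) is a contractive projection, and there are [degree be] such pairs. *)
Lemma part_square_lt (D : set (nat -> C)) (Ds : solid D) (L : nat) (a : nat -> C)
    (al : nat -> multiindex) (P : pred 'I_L) (be : multiindex) B :
  bounded_on D (fun z => \sum_(i < L | P i) a i * monom (al i) z) B ->
  bounded_on D (fun z => \sum_(i < L | P i && `[< square_lt (al i) be >]) a i * monom (al i) z)
    ((degree be)%:R * B).
Proof.
move=> PB z Dz; pose m := maxn (len be) (\max_(i < L) len (al i)).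
have lbe : (len be <= m)%N by rewrite leq_maxl.
have lal (i : 'I_L) : (len (al i) <= m)%N.
  by apply: leq_trans (leq_maxr _ _); exact: leq_bigmax.
pose up (j : 'I_m) (i : 'I_L) := all (fun k => al i k == be k) (index_iota j.+1 m).
have upP (j : 'I_m) (i : 'I_L) : reflect (forall k, (j < k)%N -> al i k = be k) (up j i).
  apply: (iffP allP) => [h k jk|h k].
    have [km|mk] := ltnP k m; first by apply/eqP/h; rewrite mem_index_iota jk km.
    by rewrite !len_eq0 // (leq_trans _ mk).
  by rewrite mem_index_iota => /andP[jk _]; apply/eqP/h.
pose Q (j : 'I_m) (i : 'I_L) := (al i j < be j)%N && up j i.
have QE (i : 'I_L) : `[< square_lt (al i) be >] = [exists j, Q j i].
  apply/asboolP/existsP => [/square_ltE[j [abj abi]]|[j /andP[abj /upP abi]]]; last first.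
    by apply/square_ltE; exists (val j).
  have jm : (j < m)%N.
    by rewrite ltnNge; apply: contraTN abj => mj; rewrite -leqNgt [be j]len_eq0 ?(leq_trans lbe).
  by exists (Ordinal jm); rewrite /Q abj; apply/upP.
have Qu (i : 'I_L) (j k : 'I_m) : Q j i -> Q k i -> j = k.
  move=> /andP[j1 /upP j2] /andP[k1 /upP k2]; apply: ord_inj.
  case: (ltngtP (nat_of_ord j) (nat_of_ord k)) => // h.
    by move: k1; rewrite j2 // ltnn.
  by move: j1; rewrite k2 // ltnn.
have -> : \sum_(i < L | P i && `[< square_lt (al i) be >]) a i * monom (al i) z =
    \sum_(j < m) \sum_(k < be j) \sum_(i < L | (P i && up j i) && (al i j == k)) a i * monom (al i) z.
  rewrite (eq_bigl (fun i => P i && [exists j, Q j i])); last by move=> i; rewrite QE.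
  rewrite (big_exclusive _ _ Qu); apply: eq_bigr => j _.
  rewrite -(@big_exclusive _ _ _ (fun i => P i && up j i) (fun (k : 'I_(be j)) i => al i j == k)).
    apply: eq_bigl => i; rewrite /Q [_ && up _ _]andbC andbA; congr (_ && _).
    apply/idP/existsP => [ab|[k /eqP ->//]]; by exists (Ordinal ab).
  by move=> i k k' /eqP ik /eqP ik'; apply: val_inj; rewrite /= -ik -ik'.
rewrite (degree_range lbe) natr_sum mulr_suml.
apply: le_trans (nm_sum _ _ _) _; apply: ler_sum => j _.
apply: le_trans (nm_sum _ _ _) _.
apply: (@le_trans _ _ (\sum_(k < be j) B)); last first.
  by rewrite sumr_const card_ord -(mulr_natl B).
apply: ler_sum => k _; have := part_coord Ds j k (part_coords Ds (index_iota j.+1 m) be PB) Dz.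
by [].
Qed.

Variables (sigma : nat -> multiindex) (sc : compatible_ordering sigma).

(** The monomials of degree [n] among the first [M] are those that precede
    the first monomial of degree [n] left out.  If none is left out, the sum
    is the whole homogeneous part. *)
Lemma part_initial (D : set (nat -> C)) (Ds : solid D) (L M n : nat) (a : nat -> C) B :
  0 <= B ->
  bounded_on D (fun z => \sum_(i < L) a i * monom (sigma i) z) B ->
  bounded_on D (fun z => \sum_(i < L | (i < M)%N && (degree (sigma i) == n))
    a i * monom (sigma i) z) (n.+1%:R * B).
Proof.
move=> B0 PB; have nB := part_degree Ds n PB.
have [[i0 /andP[Mi0 /eqP ni0] imin]|none] :=
    pselect (exists2 i0 : 'I_L, (M <= i0)%N && (degree (sigma i0) == n) &
      forall i : 'I_L, (M <= i)%N -> degree (sigma i) = n -> (i0 <= i)%N).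
  have nle : n%:R * B <= n.+1%:R * B by rewrite ler_wpM2r // ler_nat.
  move=> z Dz; apply: le_trans nle; rewrite -{2}ni0.
  have := part_square_lt Ds (sigma i0) nB Dz; congr (nm _ <= _).
  apply: eq_bigl => i /=; case: eqP => ni; rewrite !(andbT, andbF) //.
  have [_ /(_ i i0)] := sc; rewrite ni ni0 => /(_ erefl) sq.
  case: sq => sq1 sq2; apply/idP/idP => [/asboolP h|iM]; last first.
    by apply/asboolP; apply: sq1; exact: leq_trans Mi0.
  have ii0 := sq2 h.
  by rewrite ltnNge; apply: contraTN ii0 => /imin -/(_ ni); rewrite -leqNgt.
have nle : B <= n.+1%:R * B by rewrite ler_peMl // ler1n.
move=> z Dz; apply: le_trans nle; have := nB z Dz; congr (nm _ <= _).
apply: eq_bigl => i /=; case: eqP => ni; last by rewrite andbF.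
rewrite andbT; apply/esym; rewrite ltnNge; apply/negP => Mi; apply: none.
have Pi : (M <= i)%N && (degree (sigma i) == n) by rewrite Mi ni eqxx.
case: (@arg_minnP _ i (fun i : 'I_L => (M <= i)%N && (degree (sigma i) == n)) val Pi) => i0 Pi0 imin.
by exists i0 => // j Mj nj; apply: imin; rewrite Mj nj eqxx.
Qed.

Lemma sum_arith_geo d : \sum_(n < d) (n.+1%:R / 2 ^+ n) = 4 - (2 * d + 4)%:R / 2 ^+ d :> R.
Proof.
elim: d => [|d IH]; first by rewrite big_ord0 muln0 add0n expr0 divr1 subrr.
by rewrite big_ord_recr /= IH exprS !natrD !natrM -!natr1; field; rewrite expf_neq0.
Qed.

(** The homogeneous part of degree n of z |-> p (2 z) is 2^n times that of
    p, so that the bounds of [part_initial] add up to the sum over n of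
    (n + 1) 2^-n, which is at most 4. *)
Theorem partial_sum_bound (D : set (nat -> C)) (Ds : solid D) (L M : nat) (a : nat -> C) B :
  0 <= B ->
  bounded_on D (fun z => \sum_(i < L) a i * monom (sigma i) (fun j => 2 * z j)) B ->
  bounded_on D (fun z => \sum_(i < L | (i < M)%N) a i * monom (sigma i) z) (4 * B).
Proof.
move=> B0 PB; pose D2 : set (nat -> C) := [set z | D (fun j => 2^-1 * z j)].
have D2s : solid D2.
  move=> z l Dz l1; rewrite /D2 /=.
  have -> : (fun j => 2^-1 * (l j * z j)) = (fun j => l j * (2^-1 * z j)).
    by apply/funext => j; rewrite mulrCA.
  exact: Ds.
have n2 : (2 : R[i]) != 0 by rewrite pnatr_eq0.
have PB2 : bounded_on D2 (fun z => \sum_(i < L) a i * monom (sigma i) z) B.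
  move=> z /PB; congr (nm _ <= _); apply: eq_bigr => i _; congr (_ * monom _ _).
  by apply/funext => j; rewrite mulrA divff ?mul1r.
move=> z Dz; pose d := (\max_(i < L) degree (sigma i)).+1.
have dP (i : 'I_L) : (degree (sigma i) < d)%N by rewrite ltnS; exact: leq_bigmax.
have -> : \sum_(i < L | (i < M)%N) a i * monom (sigma i) z =
    \sum_(n < d) \sum_(i < L | (i < M)%N && (degree (sigma i) == n)) a i * monom (sigma i) z.
  rewrite -(@big_exclusive _ _ _ (fun i : 'I_L => (i < M)%N) (fun (n : 'I_d) i => degree (sigma i) == n)).
    apply: eq_bigl => i; case: (i < M)%N => //=; apply/esym/existsP.
    by exists (Ordinal (dP i)).
  by move=> i j k /eqP ij /eqP ik; apply: val_inj; rewrite /= -ij -ik.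
apply: le_trans (nm_sum _ _ _) _.
apply: (@le_trans _ _ (\sum_(n < d) (n.+1%:R / 2 ^+ n * B))); last first.
  by rewrite -mulr_suml sum_arith_geo ler_wpM2r // gerBl divr_ge0 // exprn_ge0.
apply: ler_sum => n _; rewrite mulrAC ler_pdivlMr ?exprn_gt0 //.
rewrite -[X in _ * X ^+ _]nm_nat -nmX -nmM mulr_suml.
have D2z : D2 (fun j => 2 * z j).
  rewrite /D2 /=; have -> // : (fun j => 2^-1 * (2 * z j)) = z.
  by apply/funext => j; rewrite mulrA mulVf ?mul1r.
have := part_initial D2s M n B0 PB2 D2z; congr (nm _ <= _).
apply: eq_bigr => i /andP[_ /eqP <-]; rewrite -mulrA; congr (_ * _).
rewrite [LHS](monomM _ (fun=> 2)) mulrC; congr (_ * _).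
by have := monom_weight (2 : C) (fun=> 1%N) (sigma i); rewrite /weight; under eq_bigr do rewrite muln1.
Qed.
End SquareOrder.

(** * Spaces with unconditional coordinates *)

Section Coordinates.
Context {R : realType}.
Local Notation C := (R[i]^o).

Definition lincomb (X : normedModType R[i]) (b : nat -> X) (a : nat -> C) (m : nat) : X :=
  \sum_(n < m) a n *: b n.

(** What a 1-unconditional basis provides.  In contrast to convergent
    expansions, none of the conditions depends on the order of the basis, so that
    they can be verified for an arbitrary enumeration. *)
Record coordinate_system (X : normedModType R[i]) (b : nat -> X) := CoordinateSystem {
  coord :> nat -> X -> C;
  coord_linear : forall n, linear (coord n);
  coord_cont : forall n, continuous (coord n);
  coord_dual : forall m n, coord n (b m) = (n == m)%:R;
  coord_separate : forall x, (forall n, coord n x = 0) -> x = 0;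
  coord_multiplier : forall (l : nat -> C) x, (forall n, nm (l n) <= 1) ->
    exists2 y, (forall n, coord n y = l n * coord n x) & nm y <= nm x;
  coord_dense : forall x e, 0 < e -> exists m a, nm (x - lincomb b a m) < e }.

Context (X : normedModType R[i]) (b : nat -> X) (co : coordinate_system b).
Implicit Types (x y : X) (l : nat -> C) (e : R) (m n : nat) (K : set X).

Lemma coordD n x y : co n (x + y) = co n x + co n y.
Proof. by have := coord_linear co n 1 x y; rewrite !scale1r. Qed.

Lemma coord0 n : co n 0 = 0.
Proof. by apply: (@addrI _ (co n 0)); rewrite -coordD !addr0. Qed.

Lemma coordZ n (a : C) x : co n (a *: x) = a * co n x.
Proof. by have := coord_linear co n a x 0; rewrite !addr0 coord0 addr0. Qed.

Lemma coordN n x : co n (- x) = - co n x.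
Proof. by rewrite -scaleN1r coordZ mulN1r. Qed.

Lemma coordB n x y : co n (x - y) = co n x - co n y.
Proof. by rewrite coordD coordN. Qed.

Lemma coord_lincomb n (a : nat -> C) m : co n (lincomb b a m) = if (n < m)%N then a n else 0.
Proof.
rewrite /lincomb; elim: m => [|m IH]; first by rewrite big_ord0 coord0.
rewrite big_ord_recr /= coordD IH coordZ coord_dual ltnS.
by case: ltngtP => [_|_|->]; rewrite ?mulr0 ?mulr1 ?addr0 ?add0r.
Qed.

Lemma coord_inj x y : (forall n, co n x = co n y) -> x = y.
Proof.
move=> xy; apply/eqP; rewrite -subr_eq0; apply/eqP/(coord_separate (c := co)) => n.
by rewrite coordB xy subrr.
Qed.

Definition unit_mult l := forall n, nm (l n) <= 1.

Lemma smult_ex l x : exists y, unit_mult l -> (forall n, co n y = l n * co n x) /\ nm y <= nm x.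
Proof.
have [ul|nl] := pselect (unit_mult l); last by exists 0.
by have [y y1 y2] := coord_multiplier co x ul; exists y.
Qed.

(** Multiplication of the coordinates of [x] by [l]; the value is arbitrary
    when the entries of [l] are not bounded by 1. *)
Definition smult l x : X := sval (cid (smult_ex l x)).

Lemma coord_smult l x n : unit_mult l -> co n (smult l x) = l n * co n x.
Proof. by move=> ul; have [-> //] := svalP (cid (smult_ex l x)) ul. Qed.

Lemma nm_smult l x : unit_mult l -> nm (smult l x) <= nm x.
Proof. by move=> ul; have [_] := svalP (cid (smult_ex l x)) ul. Qed.

Lemma smultB l x y : unit_mult l -> smult l (x - y) = smult l x - smult l y.
Proof.
by move=> ul; apply: coord_inj => n; rewrite coordB !coord_smult // coordB mulrBr.
Qed.

Definition btrunc m x : X := lincomb b (co^~ x) m.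

Lemma coord_btrunc m x n : co n (btrunc m x) = if (n < m)%N then co n x else 0.
Proof. exact: coord_lincomb. Qed.

Let ind m n : C := (n < m)%:R.

Let unit_ind m : unit_mult (ind m).
Proof. by move=> n; rewrite /ind; case: ltnP => _; rewrite ?nm1 // nm0. Qed.

Lemma btrunc_smult m x : btrunc m x = smult (ind m) x.
Proof.
apply: coord_inj => n; rewrite coord_btrunc coord_smult // /ind.
by case: ifP => _; rewrite ?mul1r ?mul0r.
Qed.

Lemma btruncB m x y : btrunc m (x - y) = btrunc m x - btrunc m y.
Proof. by rewrite !btrunc_smult smultB. Qed.

Lemma nm_btrunc m x : nm (btrunc m x) <= nm x.
Proof. by rewrite btrunc_smult nm_smult. Qed.

Lemma btruncS m x : btrunc m.+1 x = btrunc m x + co m x *: b m.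
Proof. by rewrite /btrunc /lincomb big_ord_recr. Qed.

(** The truncations are contractions and reproduce finite combinations of
    the basis, which are dense. *)
Lemma btrunc_near x e : 0 < e -> exists m0, forall m, (m0 <= m)%N -> nm (x - btrunc m x) < e.
Proof.
move=> e0; have [|m0 [a xa]] := coord_dense co x (e := e / 2); first by lra.
exists m0 => m m0m; set y := lincomb b a m0 in xa.
have yE : btrunc m y = y.
  apply: coord_inj => n; rewrite coord_btrunc coord_lincomb.
  by case: (ltnP n m0) => nm0; [rewrite (leq_trans nm0)|rewrite if_same].
have -> : x - btrunc m x = (x - y) - btrunc m (x - y).
  by rewrite btruncB yE opprB addrA subrK.
by have := nmBD (x - y) (btrunc m (x - y)); have := nm_btrunc m (x - y); lra.
Qed.

Lemma btrunc_cvg x : (fun m => btrunc m x) @ \oo --> x.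
Proof.
apply/cvg_nmP => e /(btrunc_near x)[m0 h]; exists m0 => // m /= /h.
by rewrite nmB.
Qed.

Lemma expansionE (a : nat -> C) x : expansion None b a x <-> a = co^~ x.
Proof.
rewrite /expansion /=; split=> [ax|->]; last exact: btrunc_cvg.
apply/funext => k.
have ck : (fun n => co k (lincomb b a n)) @ \oo --> co k x.
  by apply: continuous_cvg; [exact: coord_cont|exact: ax].
have ak : (fun n => co k (lincomb b a n)) @ \oo --> a k.
  by apply: cvg_near_cst; exists k.+1 => // n /= kn; rewrite coord_lincomb kn.
exact: (cvg_unique _ ak ck).
Qed.

Lemma coordinate_schauder : schauder_basis None b.
Proof.
exists co; split=> [k _|x]; first exact: coord_cont.
by split=> [|a /expansionE -> k]; [apply/expansionE|].
Qed.

Lemma coef_functionalE k x : coef_functional b k x = co k x.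
Proof.
rewrite /coef_functional; case: xgetP => [a _ /expansionE ->//|/(_ (co^~ x)) []].
exact/expansionE.
Qed.

Lemma nm_continuous (V : normedModType R[i]) : continuous (nm : V -> R).
Proof.
move=> x; apply/cvgrPdist_lt => e e0; apply/nbhs_nmP; exists e => // y.
apply: le_lt_trans; rewrite distrC ler_norml.
have := nmD (y - x) x; have := nmD (x - y) y; rewrite !subrK nmB.
by move=> h1 h2; apply/andP; split; lra.
Qed.

Lemma disc_compact (r : R) : compact [set z : C | nm z <= r].
Proof.
pose S := [set pt z.1 z.2 | z in `[- r, r] `*` `[- r, r]] : set C.
apply: (@subclosed_compact _ _ S).
- apply: (@closed_comp _ _ (nm : C -> R) [set x | x <= r]) => [z _|].
    exact: nm_continuous.
  exact: closed_le.
- apply: continuous_compact; last by apply: compact_setX; exact: segment_compact.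
  apply: continuous_subspaceT => -[x y]; apply/cvg_nmP => e e0.
  have e2 : 0 < e / 2 by lra.
  near=> z; apply: le_lt_trans (nm_trans (pt x z.2) _ _) _.
  rewrite [e]splitr nm_ptl nm_ptr ltrD // distrC; near: z.
    have h : (fun z : R * R => z.1) @ nbhs (x, y) --> x by exact: cvg_fst.
    by move/cvgrPdist_lt : h => /(_ _ e2).
  have h : (fun z : R * R => z.2) @ nbhs (x, y) --> y by exact: cvg_snd.
  by move/cvgrPdist_lt : h => /(_ _ e2).
- move=> z /= zr; exists (complex.Re z, complex.Im z); last by case: (z).
  rewrite /= !in_itv /= -!ler_norml; split; apply: le_trans zr.
    exact: Re_le_nm.
  exact: Im_le_nm.
Unshelve. all: by end_near. Qed.

Definition cube : set (prod_topology (fun _ : nat => C)) := [set l | unit_mult l].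

Lemma cube_compact : compact cube.
Proof. exact: (@tychonoff _ (fun=> C) (fun=> [set z : C | nm z <= 1]) (fun=> @disc_compact 1)). Qed.

Lemma near_prod_lt (l : prod_topology (fun _ : nat => C)) (d : R) m : 0 < d ->
  \forall l' \near l, forall n, (n < m)%N -> nm (l' n - l n) < d.
Proof.
move=> d0; have FF : Filter (nbhs l) := nbhs_filter l.
elim: m => [|m IH]; first by apply: filterE => l' n.
have h : \forall l' \near l, nm (l' m - l m) < d.
  have := @proj_continuous _ (fun _ : nat => C) m l.
  by move/cvg_nmP/(_ _ d0).
apply: filterS2 IH h => l' h1 h2 n; rewrite ltnS leq_eqVlt => /orP[/eqP ->//|].
exact: h1.
Qed.

Definition hull K : set X := [set smult p.1 p.2 | p in cube `*` K].

(** The hull is the image of the compact product of the cube of multipliers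
    and [K] under a map that is continuous there: up to a small error only
    finitely many coordinates of [x] count, and on these multipliers are
    compared coordinatewise. *)
Lemma hull_compact K : compact K -> compact (hull K).
Proof.
move=> cK; apply: continuous_compact; last by apply: compact_setX => //; exact: cube_compact.
apply/subspace_continuousP => -[l x] [/= ul Kx]; apply/cvg_nmP => e e0.
have e8 : 0 < e / 8 by lra.
have [m /(_ m (leqnn m)) xm] := btrunc_near x e8.
pose M := \sum_(n < m) nm (co n x *: b n).
have M0 : 0 <= M by apply: sumr_ge0 => n _; exact: nm_ge0.
(* with this d the change of the first m coordinates contributes at most e / 4 *)
pose d := e / 4 / (M + 1).
have d0 : 0 < d by rewrite !divr_gt0 //; lra.
near=> q; have [/= uq Kq] : (cube `*` K) q by near: q; exact: withinT.
have q2 : nm (q.2 - x) < e / 4.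
  near: q; apply: cvg_within.
  have h : (fun z : prod_topology (fun _ : nat => C) * X => z.2) @ nbhs (l, x) --> x.
    exact: cvg_snd.
  by move/cvg_nmP : h; apply; lra.
have q1 n : (n < m)%N -> nm (q.1 n - l n) < d.
  move: n; near: q; apply: cvg_within.
  have h : (fun z : prod_topology (fun _ : nat => C) * X => z.1) @ nbhs (l, x) --> l.
    exact: cvg_fst.
  by apply: (h [set l' | forall n, (n < m)%N -> nm (l' n - l n) < d]); exact: near_prod_lt.
have -> : smult q.1 q.2 - smult l x = smult q.1 (q.2 - x) +
   (smult q.1 (x - btrunc m x) - smult l (x - btrunc m x)) + \sum_(n < m) (q.1 n - l n) *: (co n x *: b n).
  apply: coord_inj => n.
  have -> : \sum_(n < m) (q.1 n - l n) *: (co n x *: b n) =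
      lincomb b (fun n => (q.1 n - l n) * co n x) m.
    by apply: eq_bigr => k _; rewrite scalerA.
  rewrite !(coordD, coordN) !coord_smult // coord_lincomb !(coordD, coordN) coord_btrunc.
  by case: ifP => _; ring.
have h1 := nm_smult (q.2 - x) uq.
have h2 := nm_smult (x - btrunc m x) uq.
have h3 := nm_smult (x - btrunc m x) ul.
have h4 : nm (\sum_(n < m) (q.1 n - l n) *: (co n x *: b n)) <= e / 4.
  apply: le_trans (nm_sum _ _ _) _; apply: (@le_trans _ _ (d * M)); last first.
    by rewrite /d mulrAC ler_pdivrMr; [apply: ler_wpM2l|]; lra.
  rewrite mulr_sumr; apply: ler_sum => n _; rewrite nmZ ler_wpM2r ?nm_ge0 //.
  exact/ltW/q1.
apply: le_lt_trans (nmD _ _) _; apply: (@lt_le_trans _ _ (e / 4 + (e / 8 + e / 8) + e / 4)); last by lra.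
apply: ltr_leD => //; apply: le_lt_trans (nmD _ _) _; apply: ltr_leD; first exact: le_lt_trans q2.
by apply: le_trans (nmBD _ _) _; apply: lerD; apply/ltW/le_lt_trans/xm.
Unshelve. all: by end_near. Qed.

Lemma hull_sub K x : K x -> hull K x.
Proof.
move=> Kx; have u1 : unit_mult (fun=> 1) by move=> n; rewrite nm1.
exists (fun=> 1, x) => //=; apply: coord_inj => n.
by rewrite coord_smult // mul1r.
Qed.

Definition coords x : nat -> C := fun n => co n x.

(** Two successive multipliers amount to their product. *)
Lemma hull_solid K : solid (coords @` hull K).
Proof.
move=> _ l [y [[l' x] [/= ul' Kx] <-] <-] ul.
have ull : unit_mult (fun n => l n * l' n).
  by move=> n; rewrite nmM mulr_ile1 ?nm_ge0.
exists (smult (fun n => l n * l' n) x); first by exists ((fun n => l n * l' n), x).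
by apply/funext => n; rewrite /coords !coord_smult // mulrA.
Qed.
End Coordinates.

(** * The compact-open topology and the span of the monomials *)

Section CompactOpen.
Context {R : realType} (X : normedModType R[i]).
Local Notation C := (R[i]^o).
Implicit Types (h : entire X) (K : set X).

Lemma entire_differentiable h x : differentiable (h : X -> C) x.
Proof. by have := entireP h; rewrite inE; apply. Qed.

Lemma entire_continuous h : continuous (h : X -> C).
Proof. by move=> x; apply: differentiable_continuous; exact: entire_differentiable. Qed.

Lemma entire_mem (f : X -> C) : (forall x, differentiable f x) -> f \in @entire_pred R X.
Proof. by move=> df; rewrite inE. Qed.

Lemma uniform_nmP (F : set_system (X -> C)) (f : X -> C) (K : set X) : Filter F ->
  {uniform K, F --> f} <->
  forall e : R, 0 < e -> \forall g \near F, forall x, K x -> nm (g x - f x) < e.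
Proof.
move=> FF; split=> [Ff e e0|Ff A /uniform_nbhs[E [entE EA]]].
  apply: (Ff [set g | forall x, K x -> nm (g x - f x) < e]).
  apply/uniform_nbhs; exists [set p : C * C | ball p.1 e%:C p.2]; split.
    by rewrite -entourage_ballE; exists e%:C => //=; rewrite ltcR.
  by move=> g gP x /gP; rewrite /= -ball_normE /= distrC normE ltcR.
move: entE; rewrite -entourage_ballE => -[_ /pos_complex[e e0 ->] eE].
apply: filterS (Ff e e0) => g gP; apply: EA => x Kx; apply: eE.
by rewrite /= -ball_normE /= distrC normE ltcR; exact: gP.
Qed.

(** For continuous functions the compact-open topology is that of uniform
    convergence on compact sets. *)
Lemma entire_cvgP (F : set_system (entire X)) h : Filter F ->
  F --> h <-> forall K, compact K -> forall e : R, 0 < e ->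
    \forall g \near F, forall x, K x -> nm ((g : entire X) x - h x) < e.
Proof.
move=> FF.
have initP : F --> h <-> {compact-open, (@entire_fun R X @ F) --> (h : X -> C)}.
  split=> [Fh|Fh A /= [_ [[B Bop <-] Bfs sBfA]]].
    by move=> A hA; apply: Fh; exact: initial_continuous hA.
  by apply: filterS sBfA _; apply: Fh; apply: open_nbhs_nbhs.
rewrite initP compact_open_fam_compactP; last exact: entire_continuous.
rewrite fam_cvgP; split=> [Fh K cK e e0|Fh K cK].
  have /uniform_nmP := Fh K cK; exact.
by apply/uniform_nmP => e e0; exact: Fh.
Qed.
End CompactOpen.

Section Polynomials.
Context {R : realType}.
Local Notation C := (R[i]^o).
Context (X : normedModType R[i]) (b : nat -> X) (co : coordinate_system b).
Context (sigma : nat -> multiindex) (sigma_bij : bijective sigma).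
Implicit Types (K : set X) (x : X) (a : nat -> C).

Definition sigma_sum a L x : C := \sum_(i < L) a i * monom (sigma i) (coords co x).

Definition monomial_span (p : X -> C) := exists L a, p =1 sigma_sum a L.

Lemma sigma_sum_pad a L L' x : (L <= L')%N ->
  sigma_sum a L x = sigma_sum (fun i => if (i < L)%N then a i else 0) L' x.
Proof.
move=> LL; rewrite /sigma_sum (big_ord_widen _ (fun i => a i * monom (sigma i) (coords co x)) LL).
rewrite big_mkcond; apply: eq_bigr => i _; case: ifP => // _.
by rewrite mul0r.
Qed.

Lemma monomial_span_ext p q : p =1 q -> monomial_span p -> monomial_span q.
Proof. by move=> pq [L [a pE]]; exists L, a => x; rewrite -pq. Qed.

Lemma monomial_span0 : monomial_span (fun=> 0).
Proof. by exists 0%N, (fun=> 0) => x; rewrite /sigma_sum big_ord0. Qed.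

Lemma monomial_spanD p q : monomial_span p -> monomial_span q -> monomial_span (fun x => p x + q x).
Proof.
move=> [L [a pE]] [L' [a' qE]]; exists (maxn L L'),
  (fun i => (if (i < L)%N then a i else 0) + (if (i < L')%N then a' i else 0)) => x.
rewrite pE qE (sigma_sum_pad _ _ (leq_maxl L L')) (sigma_sum_pad _ _ (leq_maxr L L')).
by rewrite /sigma_sum -big_split /=; apply: eq_bigr => i _; rewrite mulrDl.
Qed.

Lemma monomial_span_sum n (p : nat -> X -> C) : (forall i, monomial_span (p i)) ->
  monomial_span (fun x => \sum_(i < n) p i x).
Proof.
move=> pp; elim: n => [|n IH].
  by apply: monomial_span_ext monomial_span0 => x; rewrite big_ord0.
by apply: monomial_span_ext (monomial_spanD IH (pp n)) => x; rewrite big_ord_recr.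
Qed.

Lemma monomial_span_monom (c : C) al : monomial_span (fun x => c * monom al (coords co x)).
Proof.
have [tau _ tauK] := sigma_bij; exists (tau al).+1, (fun i => if i == tau al then c else 0) => x.
rewrite /sigma_sum big_ord_recr /= eqxx tauK big1 ?add0r // => i _.
by rewrite ltn_eqF ?mul0r.
Qed.

(** The exponent of x_m x^al. *)
Definition addm (al : multiindex) (m : nat) : multiindex :=
  [fsfun j in (finsupp al `|` [fset m])%fset => (al j + (j == m))%N].

Lemma addmE al m j : addm al m j = (al j + (j == m))%N.
Proof.
rewrite fsfunE !inE; case: ifP => // /negbT; rewrite negb_or => /andP[].
by rewrite memNfinsupp => /eqP -> /negbTE ->.
Qed.

Lemma monom_addm al m (z : nat -> C) : monom (addm al m) z = z m * monom al z.
Proof.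
pose M := maxn (maxn (len al) (len (addm al m))) m.+1.
have l1 : (len al <= M)%N by rewrite !leq_max leqnn.
have l2 : (len (addm al m) <= M)%N by rewrite !leq_max leqnn orbT.
have mM : (m < M)%N by rewrite leq_max leqnn orbT.
rewrite (monom_range _ l1) (monom_range _ l2).
rewrite (eq_bigr (fun j : 'I_M => z j ^+ (j == m :> nat) * z j ^+ al j)); last first.
  by move=> j _; rewrite addmE addnC exprD.
rewrite big_split /=; congr (_ * _); rewrite (bigD1 (Ordinal mM)) //= eqxx expr1.
rewrite big1 ?mulr1 // => j; rewrite -val_eqE /= => /negbTE ->.
by rewrite expr0.
Qed.

Lemma monomial_span_coordM m p : monomial_span p -> monomial_span (fun x => co m x * p x).
Proof.
move=> [L [a pE]].
apply: monomial_span_ext (@monomial_span_sum L (fun i x => a i * monom (addm (sigma i) m) (coords co x)) _).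
  move=> x; rewrite pE /sigma_sum mulr_sumr; apply: eq_bigr => i _.
  by rewrite monom_addm mulrCA.
by move=> i; exact: monomial_span_monom.
Qed.

Lemma monomial_span_coordX m k p : monomial_span p -> monomial_span (fun x => co m x ^+ k * p x).
Proof.
move=> pp; elim: k => [|k IH]; first by apply: monomial_span_ext pp => x; rewrite expr0 mul1r.
by apply: monomial_span_ext (monomial_span_coordM m IH) => x; rewrite exprS mulrA.
Qed.

Lemma monomial_span_cst (c : C) : monomial_span (fun=> c).
Proof.
apply: monomial_span_ext (monomial_span_monom c [fsfun with 0%N]) => x.
by rewrite /monom finsupp0 big_nil mulr1.
Qed.

(** Local bounds near each point of [A] are made uniform by compactness. *)
Lemma compact_nm_bounded (T : topologicalType) (f : T -> C) (A : set T) :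
  compact A -> continuous f -> exists2 B : R, 0 <= B & forall x : T, A x -> nm (f x) <= B.
Proof.
move=> /compact_near_coveringP cA cf.
have : \forall B \near +oo, A `<=` (fun x : T => nm (f x) <= B).
  apply: (cA _ _ (fun B (x : T) => nm (f x) <= B)) => x Ax.
  exists ([set y | nm (f y - f x) < 1], [set B | nm (f x) + 1 <= B]).
    split; first by have /cvg_nmP/(_ _ ltr01) := cf x.
    by apply: nbhs_pinfty_ge; rewrite num_real.
  move=> [y B] /= [fy fB].
  by have := nmD (f y - f x) (f x); rewrite subrK; lra.
move=> [B0 [_ hB]]; exists (Num.max 0 (B0 + 1)); first by rewrite le_max lexx.
by apply: hB; rewrite lt_max ltrDl ltr01 orbT.
Qed.

Lemma interpolation_error_small (B e : R) : 0 <= B -> 0 < e ->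
  exists n, (0 < n)%N /\ 8 * B * (n.+1%:R / 2 ^+ n) < e.
Proof.
move=> B0 e0.
(* this is (n + 1)^2 <= 4 * 2^n; the induction step starts at n = 3 *)
have bnd n : n.+1%:R / 2 ^+ n <= 4 / n.+1%:R :> R.
  rewrite ler_pdivrMr ?exprn_gt0 // mulrAC ler_pdivlMr //.
  rewrite -natrM -[X in _ <= 4 * X](natrX _ 2) -natrM ler_nat.
  elim: n => [//|n IH]; rewrite expnS.
  have [n2|] := leqP 3 n; last by case: (n) => [|[|[|]]].
  by nia.
have [n nP] : exists n : nat, 32 * B / e < n.+1%:R.
  exists (Num.truncn (32 * B / e)); exact: truncnS_gt.
exists n.+1; split=> //; apply: le_lt_trans (ler_wpM2l _ (bnd n.+1)) _; first lra.
have n0 : 0 < n.+2%:R :> R by [].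
rewrite mulrA ltr_pdivrMr //; move: nP; rewrite ltr_pdivrMr // => nP.
have : n.+1%:R <= n.+2%:R :> R by rewrite ler_nat.
by move=> /(ler_wpM2l (ltW e0)); rewrite [e * n.+1%:R]mulrC; lra.
Qed.
End Polynomials.

(** * Density of the span of the monomials *)

Section Density.
Context {R : realType}.
Local Notation C := (R[i]^o).
Context (X : normedModType R[i]) (b : nat -> X) (co : coordinate_system b).
Context (sigma : nat -> multiindex) (sigma_bij : bijective sigma).
Implicit Types (K : set X) (x : X) (e : R) (f : X -> C).

(** Near a point x, the truncation of y is close to that of x, which is close
    to x.  Continuity of [f] at x gives the estimate on a neighbourhood of x, and
    compactness makes it uniform. *)
Lemma btrunc_uniform f K e : continuous f -> compact K -> 0 < e ->
  exists m0, forall m, (m0 <= m)%N -> forall x, K x -> nm (f x - f (btrunc co m x)) < e.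
Proof.
move=> cf cK e0.
have : \forall m \near \oo, K `<=` (fun x => nm (f x - f (btrunc co m x)) < e).
  move/compact_near_coveringP : cK.
  apply; move=> x Kx.
  have e2 : 0 < e / 2 by lra.
  have /continuous_nmP/(_ _ e2) [d d0 fd] := cf x.
  have d2 : 0 < d / 2 by lra.
  have [m0 m0P] := btrunc_near co x d2.
  exists ([set y | nm (y - x) < d / 2], [set m | (m0 <= m)%N]).
    split; first by apply/nbhs_nmP; exists (d / 2).
    by exists m0.
  move=> [y m] /= [yx mm].
  have fy : nm (f y - f x) < e / 2 by apply: fd; lra.
  have fp : nm (f (btrunc co m y) - f x) < e / 2.
    apply: fd; apply: le_lt_trans (nm_trans (btrunc co m x) _ _) _.
    have := nm_btrunc co m (y - x); rewrite btruncB.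
    by have := m0P m mm; rewrite nmB; lra.
  apply: le_lt_trans (nm_trans (f x) _ _) _.
  by rewrite [X in _ + X]nmB; lra.
by move=> [m0 _ h]; exists m0 => m mm x Kx; exact: h.
Qed.

Lemma differentiable_lincomb n (c : nat -> C) (F : nat -> X -> C) x :
  (forall s, differentiable (F s) x) ->
  differentiable (fun y => \sum_(s < n) c s * F s y) x.
Proof.
move=> dF; elim: n => [|n IH].
  have -> : (fun y => \sum_(s < 0) c s * F s y) = cst 0.
    by apply/funext => y; rewrite big_ord0.
  exact: differentiable_cst.
have -> : (fun y => \sum_(s < n.+1) c s * F s y) =
    c n *: F n + (fun y => \sum_(s < n) c s * F s y).
  by apply/funext => y; rewrite big_ord_recr /= addrC.
exact: differentiable_submod.
Qed.

Lemma differentiable_shift f v x : (forall y, differentiable f y) ->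
  differentiable (fun y => f (y + v)) x.
Proof.
move=> df; apply: (@differentiable_comp _ _ _ _ (fun y => y + v) f) => //.
Qed.

Lemma differentiable_line f y v (z : C) : (forall y, differentiable f y) ->
  differentiable (fun z : C => f (y + z *: v)) z.
Proof.
move=> df; apply: (@differentiable_comp _ _ _ _ (fun z : C => y + z *: v) f) => //.
Qed.

(** For a fixed truncation y of x, f (y + z b_m) is interpolated in z.  The
    error is uniform in y, as f is bounded on the relevant compact set, and the
    coefficient of z^k is Q_k (y) with [Q k] entire, to which the induction
    hypothesis applies. *)
Lemma approx_btrunc m f K e : (forall x, differentiable f x) -> compact K -> 0 < e ->
  exists2 p, monomial_span co sigma p & forall x, K x -> nm (f (btrunc co m x) - p x) < e.
Proof.
elim: m f e => [|m IH] f e df cK e0.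
  exists (fun=> f 0); first exact: monomial_span_cst.
  by move=> x _; rewrite /btrunc /lincomb big_ord0 subrr nm0.
have cf : continuous f by move=> x; exact: differentiable_continuous.
have [B1 B10 coB] := compact_nm_bounded cK (@coord_cont _ _ _ co m).
pose r := B1 + 1; have r0 : 0 < r by rewrite /r; lra.
pose h (q : X * C) := f (btrunc co m q.1 + q.2 *: b m).
have ch : continuous h.
  move=> q; apply: (@continuous_comp _ _ _ (fun q : X * C => btrunc co m q.1 + q.2 *: b m) f);
    last exact: cf.
  apply: (@cvgD _ _ _ _ _ (fun q : X * C => btrunc co m q.1) (fun q : X * C => q.2 *: b m)).
    apply: (@continuous_comp _ _ _ fst (btrunc co m)); first exact: cvg_fst.
    apply/continuous_nmP => e' e'0; exists e' => // y yq.
    by rewrite -btruncB; apply: le_lt_trans yq; exact: nm_btrunc.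
  by apply: cvgZr_tmp; exact: cvg_snd.
have [B B0 hB] := compact_nm_bounded (compact_setX cK (disc_compact (r := 4 * r))) ch.
have e2 : 0 < e / 2 by lra.
have [n [n0 nB]] := interpolation_error_small B0 e2.
have [w pw] := @primitive_root_exists R n n0.
pose cf' (k s : nat) : C := (n%:R * r%:C ^+ k * (w ^+ s) ^+ k)^-1.
pose Q (k : nat) (y : X) : C := \sum_(s < n) cf' k s * f (y + (r%:C * w ^+ s) *: b m).
have dQ k x : differentiable (Q k) x.
  apply: (@differentiable_lincomb n (cf' k) (fun s y => f (y + (r%:C * w ^+ s) *: b m))) => s.
  exact: differentiable_shift.
pose S := \sum_(k < n) r ^+ k.
have S0 : 0 <= S by apply: sumr_ge0 => k _; rewrite exprn_ge0 // ltW.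
(* the errors of the coefficients are multiplied by powers of r, with sum S *)
pose e' := e / 2 / (S + 1).
have e'0 : 0 < e' by rewrite divr_gt0 //; lra.
have /choice[p pP] k : exists p, monomial_span co sigma p /\
    forall x, K x -> nm (Q k (btrunc co m x) - p x) < e'.
  by have [p p1 p2] := IH (Q k) e' (dQ k) cK e'0; exists p.
exists (fun x => \sum_(k < n) co m x ^+ k * p k x).
  apply: (@monomial_span_sum _ _ _ co sigma n (fun k x => co m x ^+ k * p k x)) => k.
  by apply: monomial_span_coordX => //; case: (pP k).
move=> x Kx; have cor : nm (co m x) <= r by have := coB x Kx; rewrite /r; lra.
have gB (z : C) : nm z <= 4 * r -> nm (f (btrunc co m x + z *: b m)) <= B.
  by move=> zr; apply: (hB (x, z)).
have dg z : differentiable (fun z : C => f (btrunc co m x + z *: b m)) z.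
  exact: differentiable_line.
have ib := interpolation_bound n0 pw r0 dg gB cor.
rewrite btruncS; set g := (fun z : C => _) in ib.
apply: le_lt_trans (nm_trans (\sum_(k < n) co m x ^+ k * interp_coef n w r g k) _ _) _.
rewrite [e]splitr; apply: ltr_leD; first exact: le_lt_trans nB.
rewrite -sumrB; apply: le_trans (nm_sum _ _ _) _.
apply: (@le_trans _ _ (\sum_(k < n) r ^+ k * e')).
  apply: ler_sum => k _; rewrite -mulrBr nmM nmX; apply: ler_pM; rewrite ?exprn_ge0 ?nm_ge0 //.
    by rewrite lerXn2r ?nnegrE ?nm_ge0 // ltW.
  by have [_ /(_ x Kx)/ltW] := pP k.
rewrite -mulr_suml -/S /e' mulrA ler_pdivrMr; last by lra.
by rewrite mulrC; apply: ler_wpM2l; lra.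
Qed.

Theorem monomial_span_dense f K e : (forall x, differentiable f x) -> compact K -> 0 < e ->
  exists2 p, monomial_span co sigma p & forall x, K x -> nm (f x - p x) < e.
Proof.
move=> df cK e0; have e2 : 0 < e / 2 by lra.
have cf : continuous f by move=> x; exact: differentiable_continuous.
have [m /(_ m (leqnn m)) mP] := btrunc_uniform cf cK e2.
have [p pp pP] := approx_btrunc m df cK e2.
exists p => // x Kx; apply: le_lt_trans (nm_trans (f (btrunc co m x)) _ _) _.
by rewrite [e]splitr ltrD // ?mP // pP.
Qed.
End Density.

(** * The monomial basis *)

Section ComplexCauchy.
Context {R : realType}.
Local Notation C := (R[i]^o).

Lemma real_cauchy (u : nat -> R) :
  (forall e, 0 < e -> exists N, forall n m, (N <= n)%N -> (N <= m)%N -> `|u n - u m| < e) ->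
  exists c, forall e, 0 < e -> exists N, forall n, (N <= n)%N -> `|u n - c| < e.
Proof.
move=> uC; have uc : cauchy (u @ \oo).
  apply: cauchy_exP => e e0; have [N NP] := uC e e0.
  exists (u N); exists N => // n /= Nn; rewrite -ball_normE /=; exact: NP.
have /cauchy_cvgP uc' := uc; exists (lim (u @ \oo)) => e e0.
have /cvgrPdist_lt/(_ e e0)[N _ NP] := uc'.
by exists N => n Nn; rewrite distrC; exact: NP.
Qed.

Lemma complex_cauchy (u : nat -> C) :
  (forall e, 0 < e -> exists N, forall n m, (N <= n)%N -> (N <= m)%N -> nm (u n - u m) < e) ->
  exists c : C, forall e, 0 < e -> exists N, forall n, (N <= n)%N -> nm (u n - c) < e.
Proof.
move=> uC.
have [|a aP] := @real_cauchy (fun n => complex.Re (u n)).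
  move=> e /uC[N NP]; exists N => n m Nn Nm; apply: le_lt_trans (NP n m Nn Nm).
  exact: Re_lip.
have [|c cP] := @real_cauchy (fun n => complex.Im (u n)).
  move=> e /uC[N NP]; exists N => n m Nn Nm; apply: le_lt_trans (NP n m Nn Nm).
  exact: Im_lip.
exists (pt a c) => e e0; have e2 : 0 < e / 2 by lra.
have [N NP] := aP _ e2; have [M MP] := cP _ e2; exists (maxn N M) => n.
rewrite geq_max => /andP[/NP h1 /MP h2]; apply: le_lt_trans (nm_le_ReIm _) _.
by move: h1 h2; case: (u n) => x y /= h1 h2; rewrite [e]splitr ltrD.
Qed.
End ComplexCauchy.

Section MonomialBasis.
Context {R : realType}.
Local Notation C := (R[i]^o).
Context (X : normedModType R[i]) (b : nat -> X) (co : coordinate_system b).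
Context (sigma : nat -> multiindex) (sc : compatible_ordering sigma).
Implicit Types (K : set X) (x y : X) (e B : R) (f : X -> C) (a : nat -> C) (L M k : nat).

Let sigma_bij : bijective sigma. Proof. by case: sc. Qed.

Local Notation ssum := (sigma_sum co sigma).
Local Notation mon i x := (monom (sigma i) (coords co x)).

(** The dilation by 2 pays for the growth of the bounds with the degree. *)
Definition double_hull K : set X := [set 2 *: y | y in hull co K].

Lemma double_hull_compact K : compact K -> compact (double_hull K).
Proof.
move=> cK; apply: continuous_compact; last exact: hull_compact.
apply: continuous_subspaceT => x; apply/continuous_nmP => e e0.
exists (e / 2) => [|y]; first by lra.
by rewrite -scalerBr nmZ nm_nat; lra.
Qed.

Lemma ssum_partial_bound K a L M B : 0 <= B -> (forall y, double_hull K y -> nm (ssum a L y) <= B) ->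
  forall x, K x -> nm (\sum_(i < L | (i < M)%N) a i * mon i x) <= 4 * B.
Proof.
move=> B0 aB x Kx.
apply: (@partial_sum_bound R sigma sc _ (hull_solid (co := co) (K := K)) L M a B B0); last first.
  by exists x => //; exact: hull_sub.
move=> _ [y hy <-]; have := aB (2 *: y); rewrite /sigma_sum.
have -> : coords co (2 *: y) = (fun j => 2 * coords co y j).
  by apply/funext => j; rewrite /coords coordZ.
by apply; exists y.
Qed.

(** The k-th monomial takes the value 1 here, so that bounds for its multiples
    bound their coefficients. *)
Definition test_point k : X := lincomb b (fun=> 1) (len (sigma k)).

Definition test_set k := double_hull [set test_point k].

Lemma test_set_compact k : compact (test_set k).
Proof. by apply: double_hull_compact; exact: compact_set1. Qed.

Lemma mon_test_point k : mon k (test_point k) = 1.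
Proof.
rewrite (monom_range _ (leqnn _)) big1 // => j _.
by rewrite /coords coord_lincomb ltn_ord expr1n.
Qed.

(** The k-th term is the difference of two consecutive partial sums. *)
Lemma ssum_coef_bound k a L B : (k < L)%N -> 0 <= B ->
  (forall y, test_set k y -> nm (ssum a L y) <= B) -> nm (a k) <= 8 * B.
Proof.
move=> kL B0 aB; set x := test_point k.
have part M : (M <= L)%N -> \sum_(i < L | (i < M)%N) a i * mon i x = \sum_(i < M) a i * mon i x.
  by move=> ML; rewrite (big_ord_widen _ (fun i => a i * mon i x) ML).
have h M := ssum_partial_bound M B0 aB (erefl x).
have := h k.+1; have := h k; rewrite !part //; last exact: ltnW.
rewrite big_ord_recr /= mon_test_point mulr1; set s := \sum_(i < k) _ => h1 h2.
have := nmBD (s + a k) s; rewrite (_ : s + a k - s = a k); first by lra.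
by rewrite addrAC subrr add0r.
Qed.

(** Coefficients beyond [L] are erased, so that sums of different lengths can be
    compared. *)
Definition pad a L i : C := if (i < L)%N then a i else 0.

Lemma ssumB a L a' L' x :
  ssum a L x - ssum a' L' x = ssum (fun i => pad a L i - pad a' L' i) (maxn L L') x.
Proof.
rewrite (sigma_sum_pad _ _ _ _ (leq_maxl L L')) (sigma_sum_pad _ _ _ _ (leq_maxr L L')).
by rewrite /sigma_sum -sumrB; apply: eq_bigr => i _; rewrite mulrBl.
Qed.

(** [c] is the limit of the k-th coefficients of polynomials that approximate
    [f] on the test set: this determines it uniquely, by density, and contains
    the continuity of [f |-> c]. *)
Definition is_coef f k (c : C) := forall L a B, (k < L)%N -> 0 <= B ->
  (forall y, test_set k y -> nm (f y - ssum a L y) <= B) -> nm (c - a k) <= 8 * B.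

Lemma approx_ssum f K k e : (forall x, differentiable f x) -> compact K -> 0 < e ->
  exists L a, (k < L)%N /\ forall x, K x -> nm (f x - ssum a L x) < e.
Proof.
move=> df cK e0; have [p [L [a pE]] pP] := monomial_span_dense co sigma_bij df cK e0.
exists (maxn L k.+1), (pad a L); rewrite leq_maxr; split=> // x /pP.
by rewrite pE (sigma_sum_pad _ _ _ _ (leq_maxl L k.+1)).
Qed.

(** The coefficients of approximating polynomials form a Cauchy sequence, by
    [ssum_coef_bound] applied to their differences. *)
Lemma is_coef_exists f k : (forall x, differentiable f x) -> exists c, is_coef f k c.
Proof.
move=> df.
have /choice[p pP] (n : nat) : exists p : nat * (nat -> C), (k < p.1)%N /\
    forall x, test_set k x -> nm (f x - ssum p.2 p.1 x) < n.+1%:R^-1.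
  have n0 : 0 < n.+1%:R^-1 :> R by rewrite invr_gt0.
  by have [L [a h]] := approx_ssum k df (@test_set_compact k) n0; exists (L, a).
have ub L a B n : (k < L)%N -> 0 <= B -> (forall y, test_set k y -> nm (f y - ssum a L y) <= B) ->
    nm ((p n).2 k - a k) <= 8 * (B + n.+1%:R^-1).
  move=> kL B0 aB; have [kp pn] := pP n.
  have := @ssum_coef_bound k (fun i => pad (p n).2 (p n).1 i - pad a L i) (maxn (p n).1 L) (B + n.+1%:R^-1).
  rewrite /pad kp kL leq_max kp; apply => //; first by rewrite addr_ge0 // invr_ge0.
  move=> y Ty; rewrite -/(pad _ _) -ssumB.
  apply: le_trans (nm_trans (f y) _ _) _; rewrite nmB addrC.
  by apply: lerD; [exact: aB|apply/ltW/pn].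
have inv_small e : 0 < e -> exists N, forall n, (N <= n)%N -> n.+1%:R^-1 < e.
  move=> e0; exists (Num.truncn e^-1) => n Nn.
  rewrite invf_plt ?posrE //; apply: lt_le_trans (truncnS_gt _) _.
  by rewrite ler_nat.
have [|c cP] := @complex_cauchy R (fun n => (p n).2 k).
  move=> e e0; have [|N NP] := inv_small (e / 16); first by lra.
  exists N => n m Nn Nm; have [kp pm] := pP m.
  have := @ub _ _ (m.+1%:R^-1) n kp _ (fun y Ty => ltW (pm y Ty)).
  rewrite invr_ge0 => /(_ (ler0n _ _)); have := NP n Nn; have := NP m Nm.
  by move: n.+1%:R^-1 m.+1%:R^-1 => u v; lra.
exists c => L a B kL B0 aB; apply/ler_addgt0Pr => e e0.
have [|N NP] := inv_small (e / 16); first by lra.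
have [|M MP] := cP (e / 2); first by lra.
set n := maxn N M; have := NP n (leq_maxl _ _); have := MP n (leq_maxr _ _).
have := ub L a B n kL B0 aB; have := nm_trans ((p n).2 k) c (a k).
by rewrite (nmB c ((p n).2 k)); move: n.+1%:R^-1 => u; lra.
Qed.

Definition coef (h : entire X) k : C := sval (cid (is_coef_exists k (entire_differentiable h))).

Lemma coef_le (h : entire X) k L a B : (k < L)%N -> 0 <= B ->
  (forall y, test_set k y -> nm (h y - ssum a L y) <= B) ->
  nm (coef h k - a k) <= 8 * B.
Proof. by apply: (svalP (cid (is_coef_exists k (entire_differentiable h)))). Qed.

Lemma coef_continuous k : continuous (fun h : entire X => coef h k).
Proof.
move=> h; have FF : Filter (nbhs h) := nbhs_filter h.
apply/cvg_nmP => e e0; have e32 : 0 < e / 32 by lra.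
have [L [a [kL aP]]] := approx_ssum k (entire_differentiable h) (@test_set_compact k) e32.
have nh : \forall h' \near h, forall x, test_set k x -> nm ((h' : entire X) x - h x) < e / 32.
  have /entire_cvgP := @cvg_id _ (nbhs h); apply => //; exact: test_set_compact.
apply: filterS nh => h' hh'.
have c1 : nm (coef h k - a k) <= 8 * (e / 32).
  by apply: (coef_le kL) => [|y Ty]; [lra|apply/ltW/aP].
have c2 : nm (coef h' k - a k) <= 8 * (e / 16).
  apply: (coef_le kL) => [|y Ty]; first by lra.
  apply: le_trans (nm_trans (h y) _ _) _; have := hh' y Ty; have := aP y Ty; lra.
by have := nm_trans (a k) (coef h' k) (coef h k); rewrite (nmB (a k)); lra.
Qed.

Lemma differentiable_coord n x : differentiable (co n) x.
Proof.
pose g : {linear X -> C} := HB.pack (co n : X -> C)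
  (GRing.isLinear.Build R[i] X C *:%R (co n) (coord_linear co n)).
by apply: (@linear_differentiable _ _ _ g); exact: coord_cont.
Qed.

Lemma differentiable_monom al x : differentiable (fun x => monom al (coords co x)) x.
Proof.
rewrite /monom; elim: (enum_fset _) => [|j s IH].
  by under eq_fun do rewrite big_nil; exact: differentiable_cst.
under eq_fun do rewrite big_cons.
apply: differentiableM => //; case: (al j) => [|n].
  by under eq_fun do rewrite expr0; exact: differentiable_cst.
have -> : (fun x => coords co x j ^+ n.+1) = (co j : X -> C) ^+ n.+1.
  by apply/funext => y; rewrite exprfctE.
by apply: differentiableX; exact: differentiable_coord.
Qed.

Definition monomial_entire n : entire X :=
  Entire (@entire_mem R X _ (differentiable_monom (sigma n))).

Lemma entire_sumE (c : nat -> C) n x :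
  (\sum_(i < n) c i *: monomial_entire i : entire X) x = ssum c n x.
Proof.
elim: n => [|n IH]; first by rewrite /sigma_sum !big_ord0.
have -> : ssum c n.+1 x = ssum c n x + c n * mon n x by rewrite /sigma_sum big_ord_recr.
by rewrite -IH big_ord_recr.
Qed.

(** This is [ssum_partial_bound] for an entire function.  It is obtained from
    polynomials that approximate [h] closely on the double hull and on the test
    sets of all coefficients involved; [eta] is chosen small in
    terms of the values of these monomials at [x]. *)
Lemma coef_partial_sum (h : entire X) K L a e M x : 0 <= e -> (L <= M)%N -> K x -> compact K ->
  (forall y, double_hull K y -> nm (h y - ssum a L y) <= e) ->
  nm (ssum (coef h) M x - ssum a L x) <= 4 * e.
Proof.
move=> e0 LM Kx cK ha; apply/ler_addgt0Pr => d d0.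
pose W := \sum_(i < M) nm (mon i x).
have W0 : 0 <= W by apply: sumr_ge0 => i _; exact: nm_ge0.
pose eta := d / (8 * W + 4).
have eta0 : 0 < eta by rewrite divr_gt0 //; lra.
pose K' := double_hull K `|` \big[setU/set0]_(i < M) test_set i.
have cK' : compact K'.
  apply: compactU; first exact: double_hull_compact.
  by apply: bigsetU_compact => i _; exact: test_set_compact.
have [L' [a' [ML' a'P]]] := approx_ssum M (entire_differentiable h) cK' eta0.
have h1 : nm (ssum (coef h) M x - ssum a' M x) <= 8 * eta * W.
  rewrite /sigma_sum -sumrB mulr_sumr; apply: le_trans (nm_sum _ _ _) _.
  apply: ler_sum => i _; rewrite -mulrBl nmM ler_wpM2r ?nm_ge0 //.
  apply: (coef_le (ltn_trans (ltn_ord i) ML') (ltW eta0)) => y Ty.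
  apply/ltW/a'P; right; rewrite -bigcup_mkord; exists i => //=; exact: ltn_ord.
have h2 : nm (ssum a' M x - ssum a L x) <= 4 * (eta + e).
  have hb := @ssum_partial_bound K (fun i => pad a' L' i - pad a L i) (maxn L' L) M (eta + e).
  have <- : \sum_(i < maxn L' L | (i < M)%N) (pad a' L' i - pad a L i) * mon i x =
      ssum a' M x - ssum a L x.
    have MM : (M <= maxn L' L)%N by rewrite leq_max ltnW.
    rewrite -(big_ord_widen _ (fun i => (pad a' L' i - pad a L i) * mon i x) MM).
    rewrite (sigma_sum_pad _ _ _ _ LM) /sigma_sum -sumrB; apply: eq_bigr => i _.
    by rewrite -mulrBl {1}/pad (ltn_trans (ltn_ord i) ML').
  apply: hb => //; first by rewrite addr_ge0 // ltW.
  move=> y hy; rewrite -ssumB; apply: le_trans (nm_trans (h y) _ _) _.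
  by apply: lerD; [rewrite nmB; apply/ltW/a'P; left|exact: ha].
have : eta * (8 * W + 4) = d by rewrite /eta divfK // gt_eqF //; lra.
by have := nm_trans (ssum a' M x) (ssum (coef h) M x) (ssum a L x); lra.
Qed.

(** Convergence: the operator taking M-th partial sums fixes an approximating
    polynomial of length [L <= M], and is bounded independently of [M].
    Uniqueness: partial sums of any expansion of [h] approximate [h], and beyond
    [k] they all have the same k-th coefficient. *)
Theorem monomial_schauder : schauder_basis None monomial_entire.
Proof.
exists (fun k h => coef h k); split=> [k _|h]; first exact: coef_continuous.
split=> [|a ah k _].
  apply/entire_cvgP => K cK e e0; have e8 : 0 < e / 8 by lra.
  have cKK : compact (double_hull K `|` K) by apply: compactU => //; exact: double_hull_compact.
  have [L [a [_ aP]]] := approx_ssum 0 (entire_differentiable h) cKK e8.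
  exists L => // M /= LM x Kx; rewrite entire_sumE.
  have h1 : nm (ssum (coef h) M x - ssum a L x) <= 4 * (e / 8).
    by apply: (coef_partial_sum _ LM Kx cK) => [|y hy]; [lra|apply/ltW/aP; left].
  have h2 := aP x (or_intror Kx).
  by have := nm_trans (ssum a L x) (ssum (coef h) M x) (h x); rewrite (nmB (ssum a L x)); lra.
apply/eqP; rewrite -subr_eq0 -nm_eq0; apply/eqP/le_anti; rewrite nm_ge0 andbT.
apply/ler_addgt0Pr => e e0; rewrite add0r nmB; have e8 : 0 < e / 8 by lra.
have /entire_cvgP/(_ _ (@test_set_compact k) _ e8)[N _ NP] := ah.
have -> : e = 8 * (e / 8) by lra.
apply: (coef_le (leq_maxr N k.+1)); first by lra.
move=> y Ty; rewrite nmB; apply/ltW.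
by have := NP (maxn N k.+1) (leq_maxl _ _) y Ty; rewrite entire_sumE.
Qed.
End MonomialBasis.

Theorem coordinate_monomials_basis (R : realType) (X : normedModType R[i]) (b : nat -> X) :
  coordinate_system b -> monomials_form_basis b.
Proof.
move=> co sigma sc; exists (monomial_entire co sigma); split; last exact: monomial_schauder.
by move=> n x; apply: eq_bigr => j _; rewrite (coef_functionalE co).
Qed.

(** * E-sums *)

Section SchauderCoefficients.
Context {R : realType}.
Local Notation C := (R[i]^o).
Context (V : normedModType R[i]) (N : option nat) (e : nat -> V) (f : nat -> V -> C).
Hypothesis f_exp : forall x, expansion N e (fun k => f k x) x.
Hypothesis f_uniq : forall x a, expansion N e a x -> forall k, below N k -> a k = f k x.

Lemma expansion_linear (t : C) a a' (x y : V) : expansion N e a x -> expansion N e a' y ->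
  expansion N e (fun k => t * a k + a' k) (t *: x + y).
Proof.
move=> ax ay; rewrite /expansion.
have -> : (fun n : nat => \sum_(k < n | below N k) (t * a k + a' k) *: e k) =
    (fun n : nat => t *: (\sum_(k < n | below N k) a k *: e k) + \sum_(k < n | below N k) a' k *: e k).
  apply/funext => n; rewrite scaler_sumr -big_split /=.
  by apply: eq_bigr => k _; rewrite scalerDl scalerA.
by apply: cvgD => //; exact: cvgZr.
Qed.

Lemma schauder_coef_linear k : below N k -> linear (f k).
Proof.
move=> bk t x y.
by rewrite -(@f_uniq _ _ (@expansion_linear t _ _ _ _ (@f_exp x) (@f_exp y)) k bk).
Qed.

Lemma schauder_coef_dual k l : below N k -> below N l -> f k (e l) = (k == l)%:R.
Proof.
move=> bk bl; apply/esym.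
apply: (@f_uniq (e l) (fun i => (i == l)%:R)) => //; rewrite /expansion.
apply: cvg_near_cst; exists l.+1 => // n /= ln.
rewrite (bigD1 (Ordinal ln)) //= eqxx scale1r big1 ?addr0 // => i /andP[_].
by rewrite -val_eqE /= => /negbTE ->; rewrite scale0r.
Qed.

Lemma schauder_coef_separate x : (forall k, below N k -> f k x = 0) -> x = 0.
Proof.
move=> fx; have := @f_exp x; rewrite /expansion.
have -> : (fun n : nat => \sum_(k < n | below N k) f k x *: e k) = (fun=> 0).
  by apply/funext => n; rewrite big1 // => k /fx ->; rewrite scale0r.
by move=> /(cvg_unique (@norm_hausdorff _ _)) -/(_ _ (cvg_cst 0)).
Qed.
End SchauderCoefficients.

Section EsumNorm.
Context {R : realType}.
Local Notation C := (R[i]^o).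
Context (E : normedModType R[i]) (S : seq_structure E) (X : nat -> normedModType R[i]).

Lemma unit_seq_ex (j : nat) : exists d : E, S d = (fun i => (i == j)%:R).
Proof.
by apply: seq_of_c00; exists j.+1 => // i /= ji; rewrite gtn_eqF.
Qed.

Definition unit_seq j : E := sval (cid (unit_seq_ex j)).

Lemma unit_seqE j i : S (unit_seq j) i = (i == j)%:R.
Proof. by rewrite (svalP (cid (unit_seq_ex j))). Qed.

Lemma nm_unit_seq_gt0 j : 0 < nm (unit_seq j).
Proof.
rewrite nm_gt0; apply/eqP => d0; have := unit_seqE j j.
by rewrite d0 linear0 eqxx => /esym/eqP; rewrite oner_eq0.
Qed.

(** By solidity, erasing all entries but the j-th does not increase the norm. *)
Lemma nm_seq_coord z j : nm (S z j) * nm (unit_seq j) <= nm z.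
Proof.
have [i|w wE wz] := @seq_of_solid _ _ S z (fun i => S z j * (i == j)%:R).
  by case: eqVneq => [->|_]; rewrite ?mulr1 // mulr0 normr0.
rewrite -nmZ -nm_le; suff -> : S z j *: unit_seq j = w by [].
apply: (@seq_of_inj _ _ S); rewrite wE; apply/funext => i.
by rewrite linearZ /= fctE unit_seqE.
Qed.

Local Notation ES := (Defs.esum S X).
Implicit Types x y : ES.

Lemma nm_esumE x : nm x = nm (esum_abs x).
Proof. by []. Qed.

Lemma nm_esum_le x (z : E) : (forall j, nm (x j) <= nm (S z j)) -> nm x <= nm z.
Proof.
move=> xz; rewrite nm_esumE -nm_le; apply: esum_abs_le => j.
by rewrite nm_le.
Qed.

Lemma nm_esum_mono x y : (forall j, nm (x j) <= nm (y j)) -> nm x <= nm y.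
Proof.
move=> xy; rewrite [nm y]nm_esumE; apply: nm_esum_le => j.
by rewrite esum_absE /nm normr_id; exact: xy.
Qed.

Lemma nm_esum_coord x j : nm (x j) * nm (unit_seq j) <= nm x.
Proof.
apply: le_trans (nm_seq_coord (esum_abs x) j).
by rewrite esum_absE /nm normr_id.
Qed.

Lemma esum_sumE n (F : nat -> ES) j : (\sum_(i < n) F i) j = \sum_(i < n) F i j.
Proof. by elim: n => [|n IH]; rewrite ?big_ord0 // !big_ord_recr /= -IH. Qed.

Lemma block_linear i : linear (block S X i).
Proof.
move=> a u v; apply: esum_ext => j.
have [<-|ij] := eqVneq i j; last by rewrite /= !dfwithout // scaler0 addr0.
by rewrite /= !dfwithin.
Qed.

Lemma nm_block i (v : X i) : nm (block S X i v) = nm v * nm (unit_seq i).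
Proof.
rewrite nm_esumE -[nm v]/(nm v) -[in RHS](ger0_norm (nm_ge0 v)) -nmC -nmZ; congr nm.
apply: (@seq_of_inj _ _ S); apply/funext => j; rewrite esum_absE linearZ /= fctE unit_seqE.
rewrite -[RHS]/((nm v)%:C * (j == i)%:R).
have [->|ij] := eqVneq j i; first by rewrite mulr1 dfwithin normE.
by rewrite dfwithout 1?eq_sym // normr0 mulr0.
Qed.
End EsumNorm.

Section EsumCoordinates.
Context {R : realType}.
Local Notation C := (R[i]^o).
Context (E : normedModType R[i]) (S : seq_structure E) (X : nat -> normedModType R[i]).
Hypothesis S_dense : forall (z : E) (e : R), 0 < e ->
  exists z' : E, (\forall j \near \oo, S z' j = 0) /\ nm (z - z') < e.
Context (N : nat -> option nat) (e : forall j, nat -> X j).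
Hypothesis e_basis : forall j, schauder_basis (N j) (e j).
Hypothesis e_uncond : forall j, one_unconditional (N j) (e j).
Context (phi : nat -> nat * nat).
Hypothesis phi_bij : set_bij [set: nat] [set jk | below (N jk.1) jk.2] phi.
Local Notation ES := (Defs.esum S X).
Implicit Types x y : ES.

Let f j : nat -> X j -> C := sval (cid (e_basis j)).

Let f_cont j k : below (N j) k -> continuous (@f j k).
Proof. by move=> bk; have [h _] := svalP (cid (e_basis j)); exact: h. Qed.

Let f_exp j v : expansion (N j) (@e j) (fun k => @f j k v) v.
Proof. by have [_ h] := svalP (cid (e_basis j)); case: (h v). Qed.

Let f_uniq j v a : expansion (N j) (@e j) a v -> forall k, below (N j) k -> a k = @f j k v.
Proof. by have [_ h] := svalP (cid (e_basis j)); case: (h v) => _; exact. Qed.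

Let b n : ES := block S X (phi n).1 (e (phi n).1 (phi n).2).

Let phi_below n : below (N (phi n).1) (phi n).2.
Proof. by have [h _ _] := phi_bij; exact: (h n I). Qed.

Let phi_surj j k : below (N j) k -> exists n, phi n = (j, k).
Proof. by move=> bk; have [_ _ h] := phi_bij; have [n _ pn] := h (j, k) bk; exists n. Qed.

Let phi_inj m n : phi m = phi n -> m = n.
Proof. by have [_ h _] := phi_bij; apply: h; rewrite inE. Qed.

Definition esum_coord n x : C := @f (phi n).1 (phi n).2 (x (phi n).1).

Lemma coef_block_linear j k : below (N j) k -> linear (@f j k).
Proof. exact: (schauder_coef_linear (@f_exp j) (@f_uniq j)). Qed.

Lemma esum_coord_dual m n : esum_coord n (b m) = (n == m)%:R.
Proof.
have inj' : m = n -> phi m = phi n by move->.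
rewrite /esum_coord /b; move: (phi_below m) (phi_below n) (@phi_inj m n) inj'.
case: (phi m) => i k; case: (phi n) => j l /= bk bl inj inj'.
have [ij|ij] := eqVneq i j; last first.
  rewrite dfwithout //; case: eqVneq => [nm0|_]; last first.
    have := coef_block_linear bl (-1) 0 0.
    by rewrite scaler0 addr0 scaleN1r addNr.
  by case: (inj' (esym nm0)) => h _; rewrite h eqxx in ij.
case: j / ij bl inj inj' => bl inj inj'.
rewrite dfwithin (schauder_coef_dual (@f_uniq i)) //; congr (_ %:R).
have [lk|lk] := eqVneq l k; first by rewrite -(inj _) ?eqxx // lk.
by case: eqVneq => // h; case: (inj' (esym h)) lk => ->; rewrite eqxx.
Qed.

Lemma esum_coord_linear n : linear (esum_coord n).
Proof. by move=> t x y; exact: coef_block_linear. Qed.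

Lemma esum_coord_continuous n : continuous (esum_coord n).
Proof.
move=> x; apply: (@continuous_comp _ _ _ (fun x : ES => x (phi n).1) (@f (phi n).1 (phi n).2)).
  apply/continuous_nmP => d d0; exists (d * nm (unit_seq S (phi n).1)).
    by rewrite mulr_gt0 // nm_unit_seq_gt0.
  move=> y yx; rewrite -(ltr_pM2r (nm_unit_seq_gt0 S (phi n).1)).
  exact: le_lt_trans (nm_esum_coord (y - x) (phi n).1) yx.
by apply: f_cont; exact: phi_below.
Qed.

Lemma esum_coord_separate x : (forall n, esum_coord n x = 0) -> x = 0.
Proof.
move=> x0; apply: esum_ext => j.
apply: (schauder_coef_separate (@f_exp j)) => k /phi_surj[n pn].
by have := x0 n; rewrite /esum_coord pn.
Qed.

(** The multipliers are distributed over the blocks along the inverse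
    of [phi]; in each block unconditionality applies, and solidity of E
    recombines the blocks. *)
Lemma esum_coord_multiplier (l : nat -> C) x : (forall n, nm (l n) <= 1) ->
  exists2 y, (forall n, esum_coord n y = l n * esum_coord n x) & nm y <= nm x.
Proof.
move=> l1.
have /choice[psi psiP] (q : nat * nat) : exists n, below (N q.1) q.2 -> phi n = q.
  have [bq|nb] := pselect (below (N q.1) q.2); last by exists 0%N.
  by have [n pn] := phi_surj bq; exists n => _; rewrite pn; case: (q).
have yP j : exists v : X j,
    expansion (N j) (@e j) (fun k => l (psi (j, k)) * @f j k (x j)) v /\ nm v <= nm (x j).
  have ul k : `|l (psi (j, k))| <= 1 by rewrite normE -(rmorph1 (real_complex R)) lecR.
  have [v v1 v2] := @e_uncond j (fun k => @f j k (x j)) (fun k => l (psi (j, k))) (x j) (@f_exp j (x j)) ul.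
  by exists v; rewrite -nm_le.
pose y j := sval (cid (yP j)).
have y1 j : expansion (N j) (@e j) (fun k => l (psi (j, k)) * @f j k (x j)) (y j).
  by case: (svalP (cid (yP j))).
have y2 j : nm (y j) <= nm (x j) by case: (svalP (cid (yP j))).
have Py : esum_pred S y.
  by apply: (@esum_dom _ _ S X y (esum_abs x)) => j; rewrite esum_absE normr_id nm_le.
exists (ESum Py); last exact: nm_esum_mono.
move=> n; rewrite /esum_coord /= -(f_uniq (y1 (phi n).1) (phi_below n)) -surjective_pairing.
by congr (l _ * _); apply/phi_inj/psiP; exact: phi_below.
Qed.

Definition spanned x := exists m a, x = lincomb b a m.

Lemma lincomb_pad a m m' : (m <= m')%N ->
  lincomb b a m = lincomb b (fun n => if (n < m)%N then a n else 0) m'.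
Proof.
move=> mm; rewrite /lincomb (big_ord_widen _ (fun n => a n *: b n) mm) big_mkcond.
by apply: eq_bigr => n _; case: ifP => //; rewrite scale0r.
Qed.

Lemma spanned_linear (t : C) x y : spanned x -> spanned y -> spanned (t *: x + y).
Proof.
move=> [m [a ->]] [m' [a' ->]]; exists (maxn m m'),
  (fun n => t * (if (n < m)%N then a n else 0) + (if (n < m')%N then a' n else 0)).
rewrite (lincomb_pad _ (leq_maxl m m')) (lincomb_pad _ (leq_maxr m m')).
rewrite /lincomb scaler_sumr -big_split /=; apply: eq_bigr => n _.
by rewrite scalerDl scalerA.
Qed.

Lemma spanned0 : spanned 0.
Proof. by exists 0%N, (fun=> 0); rewrite /lincomb big_ord0. Qed.

Lemma spanned_sum n (P : pred 'I_n) (F : 'I_n -> ES) :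
  (forall i, P i -> spanned (F i)) -> spanned (\sum_(i < n | P i) F i).
Proof.
move=> sF; elim/big_ind : _ => //; first exact: spanned0.
by move=> x y sx sy; rewrite -[x]scale1r; exact: spanned_linear.
Qed.

Lemma spanned_basis n : spanned (b n).
Proof.
exists n.+1, (fun i => (i == n)%:R); rewrite /lincomb big_ord_recr /= eqxx scale1r.
by rewrite big1 ?add0r // => i _; rewrite ltn_eqF // scale0r.
Qed.

Lemma spanned_block j k : below (N j) k -> spanned (block S X j (e j k)).
Proof.
move=> /phi_surj[n pn]; have := spanned_basis n; rewrite /b.
by case: (phi n) pn => ? ? [-> ->].
Qed.

Lemma block_sum j n (P : pred 'I_n) (F : 'I_n -> X j) :
  block S X j (\sum_(k < n | P k) F k) = \sum_(k < n | P k) block S X j (F k).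
Proof.
have b0 : block S X j 0 = 0.
  by apply: esum_ext => i /=; have [<-|ij] := eqVneq j i; rewrite ?dfwithin ?dfwithout.
have bD u v : block S X j (u + v) = block S X j u + block S X j v.
  by have := block_linear S (X := X) 1 u v; rewrite !scale1r.
exact: (big_morph _ bD b0).
Qed.

(** A finitely supported sequence close to the norms of the blocks of [x]
    shows that the blocks from [J] on are negligible; the remaining ones are
    approximated by finite combinations of their bases. *)
Lemma spanned_dense x (d : R) : 0 < d -> exists m a, nm (x - lincomb b a m) < d.
Proof.
move=> d0; have d2 : 0 < d / 2 by lra.
have [z' [[J _ z'J] zz']] := S_dense (esum_abs x) d2.
pose W := \sum_(j < J) nm (unit_seq S j).
have W0 : 0 <= W by apply: sumr_ge0 => j _; exact: nm_ge0.
pose d' := d / 2 / (W + 1); have d'0 : 0 < d' by rewrite divr_gt0 //; lra.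
have vP j : exists v : X j, spanned (block S X j v) /\ nm (x j - v) < d'.
  have /cvg_nmP/(_ _ d'0)[n _ nP] := @f_exp j (x j).
  exists (\sum_(k < n | below (N j) k) @f j k (x j) *: e j k); split.
    rewrite block_sum; apply: spanned_sum => k bk.
    have -> : block S X j (f k (x j) *: e j k) = f k (x j) *: block S X j (e j k) + 0.
      rewrite addr0; apply: esum_ext => i /=.
      by have [<-|ji] := eqVneq j i; rewrite ?dfwithin ?dfwithout ?scaler0.
    by apply: spanned_linear; [exact: spanned_block|exact: spanned0].
  by rewrite nmB; apply: nP => /=.
pose v j := sval (cid (vP j)).
have v1 j : spanned (block S X j (v j)) by case: (svalP (cid (vP j))).
have v2 j : nm (x j - v j) < d' by case: (svalP (cid (vP j))).
have [m [a sE]] : spanned (\sum_(j < J) block S X j (v j)).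
  by apply: spanned_sum => j _.
exists m, a; rewrite -sE.
have tailE : nm (x - \sum_(j < J) block S X j (x j)) <= nm (esum_abs x - z').
  apply: nm_esum_le => i; rewrite linearB.
  have -> : (x - \sum_(j < J) block S X j (x j)) i = if (i < J)%N then 0 else x i.
    rewrite -[LHS]/(x i - (\sum_(j < J) block S X j (x j) : ES) i).
    rewrite (esum_sumE J (fun j => block S X j (x j))); case: ltnP => iJ.
      rewrite (bigD1 (Ordinal iJ)) //= dfwithin big1 ?addr0 ?subrr // => j.
      by rewrite -val_eqE /= => ji; rewrite dfwithout.
    rewrite big1 ?subr0 // => j _; rewrite /= dfwithout //.
    by rewrite neq_ltn (leq_trans (ltn_ord j) iJ).
  case: ltnP => iJ; first by rewrite nm0 nm_ge0.
  rewrite -[X in _ <= nm X]/(S (esum_abs x) i - S z' i) esum_absE z'J // subr0.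
  by rewrite /nm normr_id.
have bB j (u w : X j) : block S X j u - block S X j w = block S X j (u - w).
  apply: esum_ext => i /=; have [<-|ij] := eqVneq j i; rewrite ?dfwithin ?dfwithout ?subr0 //.
apply: le_lt_trans (nm_trans (\sum_(j < J) block S X j (x j)) _ _) _.
rewrite [d]splitr; apply: ltr_leD; first exact: le_lt_trans zz'.
rewrite -sumrB; apply: le_trans (nm_sum _ _ _) _.
apply: (@le_trans _ _ (\sum_(j < J) d' * nm (unit_seq S j))).
  by apply: ler_sum => j _; rewrite bB nm_block ler_wpM2r ?nm_ge0 // ltW.
rewrite -mulr_sumr -/W /d' mulrAC ler_pdivrMr; last by lra.
by apply: ler_wpM2l; lra.
Qed.

Definition esum_coordinates : coordinate_system b := CoordinateSystem
  esum_coord_linear esum_coord_continuous esum_coord_dual esum_coord_separate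
  esum_coord_multiplier spanned_dense.
End EsumCoordinates.

Theorem esum_monomials (R : realType) (E : normedModType R[i]) (S : seq_structure E)
    (X : nat -> normedModType R[i])
    (S_dense : forall (z : E) (e : R), 0 < e ->
       exists z' : E, (\forall j \near \oo, S z' j = 0) /\ nm (z - z') < e)
    (N : nat -> option nat) (e : forall j, nat -> X j)
    (he : forall j, schauder_basis (N j) (e j))
    (hu : forall j, one_unconditional (N j) (e j)) :
  esum_monomials_basis S X N e.
Proof.
move=> phi phi_bij b; have co := esum_coordinates S_dense he hu phi_bij.
split; first exact: coordinate_schauder co.
exact: coordinate_monomials_basis co.
Qed.

(** * The concrete spaces and the theorem *)

Section Spaces.
Context {R : realType}.
Local Notation C := (R[i]^o).

Lemma nm_normc (z : C) : nm z = normc z.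
Proof. by rewrite /nm normr_normc. Qed.

Lemma dense_approx (E : normedModType R[i]) (A : set E) (z : E) (e : R) : dense A -> 0 < e ->
  exists2 y, A y & nm (z - y) < e.
Proof.
move=> dA e0; pose O := interior [set y : E | nm (y - z) < e].
have [|y [/interior_subset Oy Ay]] := dA O _ (open_interior _).
  by exists z; apply/nbhs_nmP; exists e.
by exists y => //; rewrite nmB.
Qed.

Section Ellpd.
Context (p : R) (hp : 1 <= p) (d : nat).
Local Notation T := (ellpd d hp).
Implicit Types x y : T.

Let p0 : 0 < p. Proof. exact: lt_le_trans hp. Qed.

Lemma nm_ellpdE x : nm x = (\sum_(i < d) nm (x i : C) `^ p) `^ p^-1.
Proof.
rewrite -[LHS]/((\sum_(i < d) normc (x i) `^ p) `^ p^-1).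
by congr (_ `^ _); apply: eq_bigr => i _; rewrite nm_normc.
Qed.

Lemma nm_ellpd_mono x y : (forall i, nm (x i : C) <= nm (y i : C)) -> nm x <= nm y.
Proof.
move=> xy; rewrite !nm_ellpdE; apply: ge0_ler_powR.
- by rewrite invr_ge0 ltW.
- by rewrite nnegrE sumr_ge0 // => i _; exact: powR_ge0.
- by rewrite nnegrE sumr_ge0 // => i _; exact: powR_ge0.
- by apply: ler_sum => i _; apply: ge0_ler_powR; rewrite ?nnegrE ?nm_ge0 //; exact: ltW.
Qed.

Lemma nm_ellpd_coord x i : nm (x i : C) <= nm x.
Proof.
rewrite nm_ellpdE -[leLHS]powRr1 ?nm_ge0 // -(divff (lt0r_neq0 p0)) powRrM.
apply: ge0_ler_powR; first by rewrite invr_ge0 ltW.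
- by rewrite nnegrE powR_ge0.
- by rewrite nnegrE sumr_ge0 // => k _; exact: powR_ge0.
- by rewrite (bigD1 i) //= lerDl sumr_ge0 // => k _; exact: powR_ge0.
Qed.

Definition ellpd_coef (k : nat) (x : T) : C := if insub k is Some i then x i else 0.

Lemma ellpd_coefE k (hk : (k < d)%N) x : ellpd_coef k x = x (Ordinal hk).
Proof. by rewrite /ellpd_coef insubT. Qed.

Lemma ellpd_sumE n (P : pred 'I_n) (F : 'I_n -> T) i :
  (\sum_(k < n | P k) F k : T) i = \sum_(k < n | P k) (F k i : C).
Proof. by elim/big_rec2 : _ => // k y z _ <-. Qed.

Lemma ellpd_partial_sum (a : nat -> C) n i : (d <= n)%N ->
  (\sum_(k < n | below (Some d) k) a k *: ellpd_unit hp d k : T) i = a i.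
Proof.
move=> dn; rewrite ellpd_sumE; have iN := leq_trans (ltn_ord i) dn.
rewrite (bigD1 (Ordinal iN)) /= ?ltn_ord // big1 => [|k /andP[_]].
  rewrite addr0 -[LHS]/(a i * (i == i :> nat)%:R) eqxx mulr1 //.
rewrite -val_eqE /= => /negbTE ki.
by rewrite -[LHS]/(a k * (k == i :> nat)%:R) ki mulr0.
Qed.

Lemma ellpd_expansion (a : nat -> C) x : (forall i, a (val i) = x i) ->
  expansion (Some d) (ellpd_unit hp d) a x.
Proof.
move=> ax; apply: cvg_near_cst; exists d => // n /= dn.
by apply/funext => i; rewrite ellpd_partial_sum // ax.
Qed.

(** Coordinates do not increase the norm, and those of the partial sums
    are eventually equal to those of [a]. *)
Lemma expansion_ellpd (a : nat -> C) x : expansion (Some d) (ellpd_unit hp d) a x ->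
  forall i : 'I_d, a i = x i.
Proof.
move=> ax i; apply/eqP; rewrite -subr_eq0 -nm_eq0; apply/eqP/le_anti; rewrite nm_ge0 andbT.
apply/ler_addgt0Pr => e e0; rewrite add0r.
have /cvg_nmP/(_ _ e0)[n _ nP] := ax.
have := nP (maxn n d) (leq_maxl _ _) => /ltW; apply: le_trans.
apply: le_trans (nm_ellpd_coord _ i).
by rewrite -(ellpd_partial_sum a i (leq_maxr n d)).
Qed.

Lemma ellpd_basis : schauder_basis (Some d) (ellpd_unit hp d).
Proof.
exists ellpd_coef; split=> [k /= kd x|x].
  apply/continuous_nmP => e e0; exists e => // y; apply: le_lt_trans.
  by rewrite !(ellpd_coefE kd); exact: (nm_ellpd_coord (y - x)).
split=> [|a /expansion_ellpd ax k /= kd]; last by rewrite (ellpd_coefE kd) -ax.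
by apply: ellpd_expansion => i; rewrite (ellpd_coefE (ltn_ord i)); congr (x _); apply: val_inj.
Qed.

Lemma ellpd_one_unconditional : one_unconditional (Some d) (ellpd_unit hp d).
Proof.
move=> a l x /expansion_ellpd ax l1; exists (fun i : 'I_d => l i * x i : C).
  by apply: ellpd_expansion => i; rewrite ax.
rewrite nm_le; apply: nm_ellpd_mono => i; rewrite nmM -[leRHS]mul1r.
by apply: ler_wpM2r; [exact: nm_ge0|rewrite -lecR -normE].
Qed.
End Ellpd.

Lemma c0_approx (z : c0 R) (e : R) : 0 < e -> exists z' : c0 R,
  (\forall j \near \oo, c0_structure R z' j = 0) /\ nm (z - z') < e.
Proof.
move=> e0; have e2 : 0 < e / 2 by lra.
have : (z : nat -> C) @ \oo --> (0 : C) by have := c0P z; rewrite inE.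
move=> /cvg_nmP/(_ _ e2)[J _ JP].
have tr0 : \forall j \near \oo, (if (j < J)%N then z j else 0) = 0 :> C.
  by exists J => // j /= Jj; rewrite ltnNge Jj.
have [z' z'E] := c0_c00 tr0; exists z'; split.
  by apply: filterS tr0 => j h; rewrite -[LHS]/(c0_seq z' j) z'E.
apply: (@le_lt_trans _ _ (e / 2)); last by lra.
rewrite -[leLHS]/(sup (range (fun n => normc ((z - z') n)))).
apply: ge_sup; first by exists (normc ((z - z') 0%N)), 0%N.
move=> _ [n _ <-]; rewrite -nm_normc -[(z - z') n]/(z n - z' n).
have -> : z' n = if (n < J)%N then z n else 0 by rewrite -[LHS]/(c0_seq z' n) z'E.
case: ltnP => nJ; first by rewrite subrr nm0 ltW.
by apply/ltW; have := JP n nJ; rewrite /= !subr0.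
Qed.

Section Ellr.
Context (r : R) (hr : 1 <= r).

Let r0 : 0 < r. Proof. exact: lt_le_trans hr. Qed.

(** The tail of the convergent series of r-th powers tends to 0. *)
Lemma ellr_approx (z : ellr hr) (e : R) : 0 < e -> exists z' : ellr hr,
  (\forall j \near \oo, ellr_structure hr z' j = 0) /\ nm (z - z') < e.
Proof.
move=> e0; pose g k : \bar R := ((`|normc (z k)| `^ r)%:E)%E.
have g0 k : (0 <= g k)%E by rewrite lee_fin powR_ge0.
have sg : (\sum_(k <oo) g k < +oo)%E.
  have := ellrP z; rewrite inE /= /finite_norm lnormE // -/g.
  rewrite !ltey; apply: contra => /eqP gE.
  by rewrite gE poweRyr // invr_neq0 // lt0r_neq0.
have er0 : 0 < e `^ r by rewrite powR_gt0.
have [J Jtail] : exists J, (\sum_(J <= k <oo) g k < (e `^ r)%:E)%E.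
  have := nneseries_tail_cvg sg (fun k _ => g0 k).
  move=> /(_ [set y | (y < (e `^ r)%:E)%E]) [|J _ JP]; last by exists J; exact: (JP J (leqnn J)).
  by apply: lt_nbhsl.
have tr0 : \forall j \near \oo, (if (j < J)%N then z j else 0) = 0 :> C.
  by exists J => // j /= Jj; rewrite ltnNge Jj.
have [z' z'E] := ellr_c00 hr tr0; exists z'; split.
  by apply: filterS tr0 => j h; rewrite -[LHS]/(ellr_seq hr z' j) z'E.
rewrite -[ltLHS]/(fine ('N[counting]_(r%:E)[EFin \o (fun n => normc ((z - z')%R n))])%E).
rewrite lnormE //.
have -> : (\sum_(k <oo) ((`|normc ((z - z')%R k)| `^ r)%:E) = \sum_(J <= k <oo) g k)%E.
  rewrite [RHS]eseries_cond [RHS]eseries_mkcond; apply: eq_eseriesr => k _.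
  rewrite -[(z - z') k]/(z k - z' k) andTb.
  have -> : z' k = if (k < J)%N then z k else 0 by rewrite -[LHS]/(ellr_seq hr z' k) z'E.
  by case: ltnP => kJ; rewrite ?subr0 // subrr normc0 normr0 powR0 ?gt_eqF.
have s0 : (0 <= \sum_(J <= k <oo) g k)%E by apply: nneseries_ge0.
move: Jtail s0; case: (\sum_(J <= k <oo) g k)%E => // s; rewrite lte_fin lee_fin => se s0.
rewrite poweR_EFin /= -[ltRHS]powRr1 ?ltW // -(divff (lt0r_neq0 r0)) powRrM.
by apply: gt0_ltr_powR; rewrite ?nnegrE ?invr_gt0 // ltW.
Qed.
End Ellr.
End Spaces.

Theorem corollary6p4 (R : realType) :
  (forall (r : R) (hr : 1 <= r) (p : nat -> R) (hp : forall j, 1 <= p j)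
      (d : nat -> nat) (hd : forall j, (0 < d j)%N),
    let X j : normedModType R[i] := ellpd (d j) (hp j) in
    let N j := Some (d j) in
    let e j (k : nat) : X j := ellpd_unit (hp j) (d j) k in
    esum_monomials_basis (c0_structure R) X N e /\
    esum_monomials_basis (ellr_structure hr) X N e) /\
  (forall (E : completeNormedModType R[i]) (S : seq_structure E)
      (hS : dense [set z : E | \forall j \near \oo, S z j = 0])
      (X : nat -> completeNormedModType R[i])
      (N : nat -> option nat) (hN : forall j, N j <> Some 0%N)
      (e : forall j, nat -> X j)
      (he : forall j, schauder_basis (N j) (e j))
      (hu : forall j, one_unconditional (N j) (e j)),
    esum_monomials_basis S (fun j => X j) N e).
Proof.
split=> [r hr p hp d hd X N e|E S hS X N hN e he hu].
  have he j : schauder_basis (N j) (e j) by exact: ellpd_basis.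
  have hu j : one_unconditional (N j) (e j) by exact: ellpd_one_unconditional.
  split; apply: esum_monomials => // z t t0; first exact: c0_approx.
  exact: ellr_approx.
apply: (@esum_monomials R E S (fun j => X j)) => // z t t0.
by have [y Ay zy] := dense_approx z hS t0; exists y.
Qed.
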